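(* Let $A$ be a unital separable nuclear $C^*$-algebra, let $\alpha$ be an asymptotically representable action of a countable discrete amenable group $G$ on $A$, and let $B=A\rtimes_\alpha G$. Let $\gamma:G\curvearrowright C$ be an action of $G$ on a unital separable nuclear $C^*$-algebra $C$ and let $D=C\rtimes_\gamma G$. For any two homomorphisms $\rho,\sigma\in\mathrm{Hom}_{\hat G}(D,B)$, the following conditions are equivalent. (1) $\rho$ and $\sigma$ are $\hat G$-asymptotically unitarily equivalent. (2) $\rho$ and $\sigma$ are asymptotically unitarily equivalent.
   Context: An action $\alpha:G\curvearrowright A$ of a countable discrete group on a unital $C^*$-algebra is asymptotically representable if for each $g\in G$ there is a continuous family of unitaries $\{v_g(t)\}_{t\in[0,\infty)}$ in $A$ such that $\lim_{t\to\infty}\|v_g(t)v_h(t)-v_{gh}(t)\|=0$, $\lim_{t\to\infty}\|\alpha_g(v_h(t))-v_{ghg^{-1}}(t)\|=0$ and $\lim_{t\to\infty}\|v_g(t)av_g(t)^*-\alpha_g(a)\|=0$ for all $g,h\in G$ and $a\in A$. $C^*(G)$ is the group $C^*$-algebra with canonical unitaries $\lambda_g$. For an action $\alpha$ of $G$ on $A$ with implementing unitaries $\lambda^\alpha_g\in A\rtimes_\alpha G$, the dual coaction $\hat\alpha:A\rtimes_\alpha G\to(A\rtimes_\alpha G)\otimes C^*(G)$ is the homomorphism with $\hat\alpha(a)=a\otimes1$ for $a\in A$ and $\hat\alpha(\lambda^\alpha_g)=\lambda^\alpha_g\otimes\lambda_g$; similarly for $\hat\gamma$. $\mathrm{Hom}_{\hat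 G}(D,B)$ is the set of unital homomorphisms $\rho:D\to B$ with $(\rho\otimes\mathrm{id}_{C^*(G)})\circ\hat\gamma=\hat\alpha\circ\rho$. Two unital homomorphisms $\rho,\sigma:D\to B$ are asymptotically unitarily equivalent if there is a continuous family of unitaries $\{u_t\}_{t\in[0,\infty)}$ in $B$ with $\rho(x)=\lim_{t\to\infty}u_t\sigma(x)u_t^*$ for all $x\in D$. Elements $\rho,\sigma\in\mathrm{Hom}_{\hat G}(D,B)$ are $\hat G$-asymptotically unitarily equivalent if such a continuous family $\{u_t\}$ can be found consisting of unitaries in the subalgebra $A\subset B=A\rtimes_\alpha G$. *)

(* Defs.v *)
From HB Require Import structures.
From mathcomp Require Import all_boot all_order all_algebra.
From mathcomp Require Import complex.
From mathcomp Require Import all_classical all_reals all_analysis.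

Set Implicit Arguments.
Unset Strict Implicit.
Unset Printing Implicit Defensive.

Import Order.TTheory GRing.Theory Num.Theory.
Import numFieldNormedType.Exports.

Local Open Scope classical_set_scope.
Local Open Scope complex_scope.
Local Open Scope ring_scope.

(* A unital C*-algebra. No library structure has both a ring and a normed
   module structure below it except the scalar fields, and Hierarchy Builder
   rejects a new join of the two; so the norm is an operation with real values,
   and the uniform structure is required to be the one it defines.
   MathComp algebras satisfy 1 != 0, so unital C*-algebras are nonzero here. *)
HB.mixin Record isCStarAlgebra (R : realType) A
    of GRing.Algebra R[i] A & PreUniformLmodule R[i] A := {
  star : A -> A;
  starD : forall x y, star (x + y) = star x + star y;
  starZ : forall (c : R[i]) x, star (c *: x) = c^* *: star x;
  starM : forall x y, star (x * y) = star y * star x;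
  starK : forall x, star (star x) = x;
  cnorm : A -> R;
  cnormD : forall x y, cnorm (x + y) <= cnorm x + cnorm y;
  cnormZ : forall (c : R[i]) x, (cnorm (c *: x))%:C = `|c| * (cnorm x)%:C;
  cnorm0_eq0 : forall x, cnorm x = 0 -> x = 0;
  cnormM : forall x y, cnorm (x * y) <= cnorm x * cnorm y;
  cnorm_star : forall x, cnorm (star x * x) = cnorm x ^+ 2;
  cnorm_entourage : forall P : set (A * A), entourage P <->
    exists2 e : R, 0 < e & forall x y, cnorm (x - y) < e -> P (x, y);
  cnorm_complete : forall F : set_system A,
    ProperFilter F -> cauchy F -> exists x : A, F --> x
}.

#[short(type="cstarAlgType")]
HB.structure Definition CStarAlgebra (R : realType) :=
  {A of isCStarAlgebra R A & GRing.Algebra R[i] A & PreUniformLmodule R[i] A}.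

HB.mixin Record isStarMorphism (R : realType) (A B : cstarAlgType R)
    (f : A -> B) := {
  star_morph : forall a, f (star a) = star (f a)
}.

HB.structure Definition StarMorphism (R : realType) (A B : cstarAlgType R) :=
  {f of isStarMorphism R A B f & @GRing.LRMorphism R[i] A B *:%R f}.

Notation "{ 'starhom' A -> B }" := (StarMorphism.type A%type B%type)
  (at level 0, A at level 98, B at level 99,
   format "{ 'starhom'  A  ->  B }") : type_scope.

(* The norm of a normed module over R[i] takes its values in R[i]. *)
HB.mixin Record isHilbert (R : realType) H
    of CompleteNormedModule R[i] H := {
  inner : H -> H -> R[i];
  inner_linear : forall (c : R[i]) x y z,
    inner (c *: x + y) z = c * inner x z + inner y z;
  inner_conj : forall x y, inner y x = (inner x y)^*;
  inner_norm : forall x : H, inner x x = `|x| ^+ 2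
}.

#[short(type="hilbertType")]
HB.structure Definition Hilbert (R : realType) :=
  {H of isHilbert R H & CompleteNormedModule R[i] H}.

Definition separable (X : topologicalType) : Prop :=
  exists2 S : set X, countable S & dense S.

Section Basics.
Variables (R : realType) (A : cstarAlgType R).

Definition unitary (u : A) : Prop := star u * u = 1 /\ u * star u = 1.

Definition unitary_path (u : R -> A) : Prop :=
  {within `[0, +oo[, continuous u} /\ forall t, 0 <= t -> unitary (u t).

End Basics.

Section Nuclear.
Variable R : realType.

Definition adjoint_mx (S : pzRingType) (st : S -> S) n (X : 'M[S]_n) : 'M[S]_n :=
  map_mx st X^T.

(* The positive elements of the C*-algebra M_n(A) are the [X^* X]. *)
Definition completely_positive (S T : pzRingType) (stS : S -> S) (stT : T -> T)
    (phi : S -> T) : Prop :=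
  forall n (X : 'M[S]_n), exists Y : 'M[T]_n,
    map_mx phi (adjoint_mx stS X *m X) = adjoint_mx stT Y *m Y.

Definition cplx_adjoint k : 'M[R[i]]_k -> 'M[R[i]]_k :=
  @adjoint_mx R[i] (fun z => z^*) k.

(* The operator norm of [M] on the Hilbert space C^k is at most [c]. *)
Definition opnorm_le k (M : 'M[R[i]]_k) (c : R) : Prop :=
  0 <= c /\ forall v : 'cV[R[i]]_k,
    \sum_i `|(M *m v) i 0| ^+ 2 <= (c ^+ 2)%:C * \sum_i `|v i 0| ^+ 2.

(* Nuclearity as the completely positive approximation property. *)
Definition nuclear (A : cstarAlgType R) : Prop :=
  forall n (a : 'I_n -> A) (e : R), 0 < e ->
  exists k (phi : {linear A -> 'M[R[i]]_k}) (psi : {linear 'M[R[i]]_k -> A}),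
    [/\ completely_positive star (@cplx_adjoint k) phi,
        (forall x, opnorm_le (phi x) (cnorm x)),
        completely_positive (@cplx_adjoint k) star psi,
        (forall M c, opnorm_le M c -> cnorm (psi M) <= c) &
        forall j, cnorm (psi (phi (a j)) - a j) < e].

End Nuclear.

Section Groups.
Variables (R : realType) (G : groupType).

Definition bounded_fun_on (f : G -> R) : Prop :=
  exists M : R, forall g, `|f g| <= M.

(* A left invariant mean on the bounded real functions; the values of [m] on
   unbounded functions are irrelevant. *)
Definition amenable : Prop :=
  exists m : (G -> R) -> R,
    [/\ (forall (c : R) f h, bounded_fun_on f -> bounded_fun_on h ->
           m (fun g => c * f g + h g) = c * m f + m h),
        (forall f, bounded_fun_on f -> (forall g, 0 <= f g) -> 0 <= m f),
        m (fun=> 1) = 1 &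
        forall s f, bounded_fun_on f -> m (fun g => f (s * g)%g) = m f].

Definition unitary_rep (A : cstarAlgType R) (u : G -> A) : Prop :=
  (forall g, unitary (u g)) /\ forall g h, u (g * h)%g = u g * u h.

Record action (A : cstarAlgType R) := Action {
  act :> G -> {starhom A -> A};
  act1 : forall a, act 1%g a = a;
  actM : forall g h a, act (g * h)%g a = act g (act h a)
}.

Definition covariant (A : cstarAlgType R) (alpha : action A)
    (E : cstarAlgType R) (phi : {starhom A -> E}) (u : G -> E) : Prop :=
  unitary_rep u /\ forall g a, u g * phi a * star (u g) = phi (alpha g a).

Definition asymptotically_representable (A : cstarAlgType R)
    (alpha : action A) : Prop :=
  exists v : G -> R -> A,
    [/\ (forall g, unitary_path (v g)),
        (forall g h,
           cnorm (v g t * v h t - v (g * h)%g t) @[t --> +oo] --> (0 : R)),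
        (forall g h,
           cnorm (alpha g (v h t) - v (g * h * g^-1)%g t) @[t --> +oo]
             --> (0 : R)) &
        (forall g a,
           cnorm (v g t * a * star (v g t) - alpha g a) @[t --> +oo]
             --> (0 : R))].

(* The full crossed product (equal to the reduced one for amenable [G]),
   characterized up to isomorphism by its universal property. *)
Record crossed_product (A : cstarAlgType R) (alpha : action A) :=
  CrossedProduct {
  cp_alg :> cstarAlgType R;
  cp_emb : {starhom A -> cp_alg};
  cp_unit : G -> cp_alg;
  cp_covariant : covariant alpha cp_emb cp_unit;
  cp_dense : dense [set x : cp_alg | exists n (a : 'I_n -> A) (g : 'I_n -> G),
                      x = \sum_i cp_emb (a i) * cp_unit (g i)];
  cp_universal : forall (E : cstarAlgType R) (phi : {starhom A -> E})
      (u : G -> E), covariant alpha phi u ->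
    exists Phi : {starhom cp_alg -> E},
      (forall a, Phi (cp_emb a) = phi a) /\ (forall g, Phi (cp_unit g) = u g)
}.

Record group_cstar := GroupCStar {
  gc_alg :> cstarAlgType R;
  gc_unit : G -> gc_alg;
  gc_rep : unitary_rep gc_unit;
  gc_dense : dense [set x : gc_alg | exists n (c : 'I_n -> R[i])
                      (g : 'I_n -> G), x = \sum_i c i *: gc_unit (g i)];
  gc_universal : forall (E : cstarAlgType R) (u : G -> E), unitary_rep u ->
    exists Phi : {starhom gc_alg -> E}, forall g, Phi (gc_unit g) = u g
}.

End Groups.

Section Tensor.
Variable R : realType.

Definition hilbert_rep (A : cstarAlgType R) (H : hilbertType R)
    (pi : A -> H -> H) : Prop :=
  [/\ (forall a (c : R[i]) x y, pi a (c *: x + y) = c *: pi a x + pi a y),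
      (forall a, exists M : R[i], forall x, `|pi a x| <= M * `|x|),
      (forall (c : R[i]) a b x, pi (c *: a + b) x = c *: pi a x + pi b x),
      ((forall x, pi 1 x = x) /\ forall a b x, pi (a * b) x = pi a (pi b x)) &
      forall a x y, inner (pi a x) y = inner x (pi (star a) y)].

(* The square of the norm of [\sum_i x i (x) y i] in the Hilbert space tensor
   product of [H] and [K]. *)
Definition tensor_norm2 (H K : hilbertType R) (I : finType)
    (x : I -> H) (y : I -> K) : R[i] :=
  \sum_i \sum_j inner (x i) (x j) * inner (y i) (y j).

(* The spatial norm of [\sum_k a k (x) b k] is at most [c]: so is the norm of
   [\sum_k pi (a k) (x) rho (b k)] on the Hilbert space tensor product of [H]
   and [K], for all representations [pi] on [H] and [rho] on [K]. *)
Definition spatial_norm_le (A B : cstarAlgType R) m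
    (a : 'I_m -> A) (b : 'I_m -> B) (c : R) : Prop :=
  0 <= c /\
  forall (H K : hilbertType R) (pi : A -> H -> H) (rho : B -> K -> K),
    hilbert_rep pi -> hilbert_rep rho ->
  forall n (x : 'I_n -> H) (y : 'I_n -> K),
    tensor_norm2 (fun p : 'I_m * 'I_n => pi (a p.1) (x p.2))
                 (fun p : 'I_m * 'I_n => rho (b p.1) (y p.2))
      <= (c ^+ 2)%:C * tensor_norm2 x y.

(* The spatial (minimal) tensor product; the elementary tensor of [a] and [b]
   is [ct_tens a b] below. *)
Record cstar_tensor (A B : cstarAlgType R) := CStarTensor {
  ct_alg :> cstarAlgType R;
  ct_left : {starhom A -> ct_alg};
  ct_right : {starhom B -> ct_alg};
  ct_comm : forall a b, ct_left a * ct_right b = ct_right b * ct_left a;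
  ct_dense : dense [set x : ct_alg | exists n (a : 'I_n -> A) (b : 'I_n -> B),
                      x = \sum_i ct_left (a i) * ct_right (b i)];
  ct_norm : forall n (a : 'I_n -> A) (b : 'I_n -> B) (c : R),
    cnorm (\sum_i ct_left (a i) * ct_right (b i)) <= c <-> spatial_norm_le a b c
}.

Definition ct_tens (A B : cstarAlgType R) (T : cstar_tensor A B) a b : T :=
  ct_left T a * ct_right T b.

End Tensor.

Section Coactions.
Variables (R : realType) (G : groupType) (CG : group_cstar R G).

Definition dual_coaction (A : cstarAlgType R) (alpha : action G A)
    (B : crossed_product alpha) (BG : cstar_tensor B CG)
    (delta : {starhom B -> BG}) : Prop :=
  (forall a, delta (cp_emb B a) = ct_tens BG (cp_emb B a) 1) /\
  (forall g, delta (cp_unit B g) = ct_tens BG (cp_unit B g) (gc_unit CG g)).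

(* [rho] is in Hom_Ghat(D, B); [rho_id] is the homomorphism rho (x) id. *)
Definition equivariant_hom (D B : cstarAlgType R)
    (DG : cstar_tensor D CG) (BG : cstar_tensor B CG)
    (deltaD : {starhom D -> DG}) (deltaB : {starhom B -> BG})
    (rho : {starhom D -> B}) : Prop :=
  exists rho_id : {starhom DG -> BG},
    (forall d f, rho_id (ct_tens DG d f) = ct_tens BG (rho d) f) /\
    (forall d, rho_id (deltaD d) = deltaB (rho d)).

End Coactions.

Section Equivalences.
Variables (R : realType) (D B : cstarAlgType R).

Definition asymptotic_intertwiner (rho sigma : {starhom D -> B})
    (u : R -> B) : Prop :=
  unitary_path u /\
  forall x, (u t * sigma x * star (u t)) @[t --> +oo] --> rho x.

Definition asymp_unitarily_equiv (rho sigma : {starhom D -> B}) : Prop :=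
  exists u, asymptotic_intertwiner rho sigma u.

End Equivalences.

Definition Ghat_asymp_unitarily_equiv (R : realType) (G : groupType)
    (A : cstarAlgType R) (alpha : action G A) (B : crossed_product alpha)
    (D : cstarAlgType R) (rho sigma : {starhom D -> B}) : Prop :=
  exists2 u : R -> B, asymptotic_intertwiner rho sigma u &
    forall t, 0 <= t -> range (cp_emb B) (u t).

(* Main.v *)
(* The given path lives in [B = A x G]; it is pushed down to [A] by replacing the
   implementing unitaries [cp_unit B g] with the asymptotic unitaries [v g t].
   Along every free ultrafilter on the half line, [cp_emb B a |-> a] and
   [cp_unit B g |-> v g] extend to a homomorphism from [B] to the C*-ultrapower of
   [A], under which conjugation by [cp_unit B g] becomes the action [alpha g].

   Equivariance and the description of [A] as the fixed point algebra of the dual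
   coaction (obtained by slicing with the canonical trace of the group algebra) show
   that both [rho] and [sigma] map [C] into [A] and [cp_unit D g] into
   [A cp_unit B g]. For [x] in [C] or [x = cp_unit D g], a polynomial
   [p = \sum_i a i * cp_unit B (g i)] close to a unitary [w] with
   [w (sigma x) w^* ~ rho x] therefore lifts to elements
   [P t = \sum_i a i * v (g i) t] of [A] that are eventually almost unitary and
   satisfy [P t (sigma x) (P t)^* ~ rho x].

   Sampling the path so slowly that consecutive samples become arbitrarily close,
   interpolating their lifts linearly and taking unitary parts by Newton iteration
   gives a continuous path of unitaries in [A] that works on a countable set of
   generators of [D], hence on [D]. *)

Require Import Defs.
From HB Require Import structures.
From mathcomp Require Import all_boot all_order all_algebra.
From mathcomp Require Import complex.
From mathcomp Require Import all_classical all_reals all_analysis.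
From mathcomp Require Import ring lra.

Set Implicit Arguments.
Unset Strict Implicit.
Unset Printing Implicit Defensive.

Import Order.TTheory GRing.Theory Num.Theory.
Import numFieldNormedType.Exports.

Local Open Scope classical_set_scope.
Local Open Scope complex_scope.
Local Open Scope ring_scope.

(** * Norms and limits in C*-algebras *)

(** The obstacle is that [v] is multiplicative only in the limit: there is no homomorphism from [B]
    to [A] along which an estimate in [B] could be transported. Homomorphisms into the ultrapowers
    do exist and are contractive, and an estimate that holds along every free ultrafilter holds near
    [+oo], so passing through all of them costs nothing. The elements to be intertwined lie in
    [A * cp_unit B k], not in [A]. For [P] in [A], moving [cp_unit B k] past [star P] applies
    [alpha k] to [P]; the second condition on [v] is what controls [alpha k] on lifts. The spatial
    tensor norm is given through Hilbert space representations, so bounding a slice map requires GNS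
    representations, hence states, hence positivity of [star x * x]. These rest on the square root
    of [1 - z] and on growth estimates for powers, in place of spectral theory. Finally, the lift of
    a sample is good only after a time that depends on the sample, so the path in [A] needs a clock
    of its own. *)

Section CNorm.
Variables (R : realType) (A : cstarAlgType R).
Implicit Types (x y z : A) (t : R) (c : R[i]).

Lemma cnormZR t x : cnorm (t%:C *: x) = `|t| * cnorm x.
Proof.
apply: complexI; rewrite cnormZ rmorphM /=; congr (_ * _).
by rewrite normc_def /= expr0n /= addr0 sqrtr_sqr.
Qed.

Lemma cnorm0 : cnorm (0 : A) = 0.
Proof. by have := cnormZR 0 0; rewrite scaler0 normr0 mul0r. Qed.

Lemma cnormN x : cnorm (- x) = cnorm x.
Proof. by have := cnormZR (-1) x; rewrite rmorphN1 scaleN1r normrN1 mul1r. Qed.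

Lemma cnormBC x y : cnorm (x - y) = cnorm (y - x).
Proof. by rewrite -cnormN opprB. Qed.

Lemma cnorm_ge0 x : 0 <= cnorm x.
Proof.
have := cnormD x (- x); rewrite subrr cnorm0 cnormN -mulr2n -mulr_natl.
by rewrite pmulr_rge0.
Qed.
Hint Resolve cnorm_ge0 : core.

Lemma cnormB x y : cnorm (x - y) <= cnorm x + cnorm y.
Proof. by rewrite -(cnormN y) cnormD. Qed.

Lemma cnorm_trans y x z : cnorm (x - z) <= cnorm (x - y) + cnorm (y - z).
Proof. by rewrite -[x - z](subrKA y); exact: cnormD. Qed.

Lemma ler_cnormB x y : `|cnorm x - cnorm y| <= cnorm (x - y).
Proof.
rewrite ler_norml; apply/andP; split.
  have := cnormD (y - x) x; rewrite subrK cnormBC => h; lra.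
by have := cnormD (x - y) y; rewrite subrK => h; lra.
Qed.

Lemma starB x y : star (x - y) = star x - star y.
Proof.
rewrite starD -[- y]scaleN1r starZ -[- star y]scaleN1r.
by rewrite rmorphN1.
Qed.

Lemma star0 : star (0 : A) = 0.
Proof. by rewrite -[X in star X](subrr 0) starB subrr. Qed.

Lemma starN x : star (- x) = - star x.
Proof. by rewrite -[- x]add0r starB star0 add0r. Qed.

Lemma star1 : star (1 : A) = 1.
Proof. by rewrite -[LHS]mulr1 -[X in _ * X]starK -starM mulr1 starK. Qed.

Lemma star_sum (I : Type) (r : seq I) (P : pred I) (F : I -> A) :
  star (\sum_(i <- r | P i) F i) = \sum_(i <- r | P i) star (F i).
Proof. by elim/big_ind2: _ => [|x1 x2 y1 y2 <- <-|//]; rewrite ?star0 ?starD. Qed.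

Lemma starZR t x : star (t%:C *: x) = t%:C *: star x.
Proof. by rewrite starZ (conjc_real t : (t%:C)^*%R = _). Qed.

(** The C*-identity gives [cnorm y ^ 2 <= cnorm (star y) * cnorm y]; cancel [cnorm y] and apply this
    to [star x] as well. *)
Lemma cnorm_starE x : cnorm (star x) = cnorm x.
Proof.
suff h y : cnorm y <= cnorm (star y).
  by apply/le_anti; rewrite h -{2}[x]starK h.
have [y0|y0] := eqVneq (cnorm y) 0; first by rewrite y0.
have := cnormM (star y) y; rewrite cnorm_star expr2 ler_pM2r //.
by rewrite lt_def y0 cnorm_ge0.
Qed.

Lemma cnorm1 : cnorm (1 : A) = 1.
Proof.
have := cnorm_star (1 : A); rewrite star1 mulr1 expr2 => /eqP.
rewrite -subr_eq0 -{1}[cnorm 1]mulr1 -mulrBr mulf_eq0 subr_eq0 => /orP[/eqP h|/eqP//].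
by have /eqP := @cnorm0_eq0 _ A _ h; rewrite oner_eq0.
Qed.

Lemma cnorm_unitary (u : A) : unitary u -> cnorm u = 1 :> R.
Proof.
move=> [h _]; have := cnorm_star u; rewrite h cnorm1 => /esym/eqP.
by rewrite -[X in _ == X](expr1n _ 2) eqrXn2 // => /eqP.
Qed.

Lemma cnorm_scal t : cnorm (t%:C%:A : A) = `|t|.
Proof. by rewrite cnormZR cnorm1 mulr1. Qed.

Lemma starX x n : star (x ^+ n) = star x ^+ n.
Proof. by elim: n => [|n ih]; rewrite ?expr0 ?star1 // exprSr starM ih exprS. Qed.

Lemma cnorm_sa_sqr x : star x = x -> cnorm (x * x) = cnorm x ^+ 2.
Proof. by move=> h; rewrite -{1}h cnorm_star. Qed.

Lemma cnorm_sa_pow2 x n : star x = x -> cnorm (x ^+ (2 ^ n)) = cnorm x ^+ (2 ^ n).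
Proof.
move=> h; elim: n => [|n ih]; first by rewrite !expr1.
rewrite expnSr !exprM expr2 cnorm_sa_sqr ?ih //.
by rewrite starX h.
Qed.

End CNorm.
#[export] Hint Extern 0 (is_true (0 <= cnorm _)) => apply: cnorm_ge0 : core.

Section NormConvergence.
Variables (R : realType) (A : cstarAlgType R).

Lemma cnorm_cvgP (T : Type) (F : set_system T) (f : T -> A) (l : A) : Filter F ->
  f @ F --> l <-> cnorm (f t - l) @[t --> F] --> (0 : R).
Proof.
move=> FF; split => [h|h].
  apply/cvgrPdist_lt => e e0.
  suff hl : nbhs l [set y | cnorm (l - y) < e].
    have : F (f @^-1` [set y | cnorm (l - y) < e]) := h _ hl.
    by apply: filterS => t /=; rewrite sub0r normrN ger0_norm // cnormBC.
  rewrite -nbhs_entourageE.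
  exists [set xy | cnorm (xy.1 - xy.2) < e] => [|y] /=; last by rewrite xsectionE.
  by apply/cnorm_entourage; exists e.
move=> P; rewrite -nbhs_entourageE => -[E /cnorm_entourage[e e0 hE] hP].
move/cvgrPdist_lt : h => /(_ e e0); apply: filterS => t /=.
rewrite sub0r normrN ger0_norm // => ht; apply: hP; apply/xsectionP; apply: hE.
by rewrite cnormBC.
Qed.

(** Convergence is expressed by a real function, so that each limit law becomes a squeeze in [R];
    [cnorm_cvgP] translates to the topology of [A]. *)
Definition ncvg (T : Type) (F : set_system T) (f : T -> A) (l : A) :=
  cnorm (f t - l) @[t --> F] --> (0 : R).

Section Filtered.
Context (T : Type) (F : set_system T) {FF : ProperFilter F}.
Implicit Types (f g : T -> A) (l m : A).

Lemma ncvgP f l : ncvg F f l <-> forall e : R, 0 < e -> \near F, cnorm (f F - l) < e.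
Proof.
split => [/cvgrPdist_lt h e e0|h].
  by apply: filterS (h e e0) => t; rewrite sub0r normrN ger0_norm.
by apply/cvgrPdist_lt => e e0; apply: filterS (h e e0) => t; rewrite sub0r normrN ger0_norm.
Qed.

Lemma ncvg_squeeze f l (h : T -> R) : (\near F, cnorm (f F - l) <= h F) ->
  h @ F --> (0 : R) -> ncvg F f l.
Proof.
move=> hf h0; apply: (squeeze_cvgr _ (cvg_cst 0) h0).
by apply: filterS hf => t ->; rewrite cnorm_ge0.
Qed.

Lemma ncvg_cst l : ncvg F (fun=> l) l.
Proof. by rewrite /ncvg subrr cnorm0; exact: cvg_cst. Qed.

Lemma ncvgD f g l m : ncvg F f l -> ncvg F g m -> ncvg F (fun t => f t + g t) (l + m).
Proof.
move=> hf hg; apply: (@ncvg_squeeze _ _ (fun t => cnorm (f t - l) + cnorm (g t - m))).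
  by apply: nearW => t; rewrite opprD addrACA cnormD.
by rewrite -[X in _ --> X](addr0 0); exact: cvgD.
Qed.

Lemma ncvg_norm f l : ncvg F f l -> cnorm (f t) @[t --> F] --> cnorm l.
Proof.
move=> /ncvgP h; apply/cvgrPdist_lt => e e0; apply: filterS (h e e0) => t.
by rewrite cnormBC; apply: le_lt_trans (ler_cnormB _ _).
Qed.

Lemma ncvgM f g l m : ncvg F f l -> ncvg F g m -> ncvg F (fun t => f t * g t) (l * m).
Proof.
move=> hf hg; apply: (@ncvg_squeeze _ _
   (fun t => cnorm (f t - l) * cnorm (g t) + cnorm l * cnorm (g t - m))).
  apply: nearW => t; rewrite -(subrKA (l * g t)) -mulrBl -mulrBr.
  by apply: le_trans (cnormD _ _) _; apply: lerD; apply: cnormM.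
have -> : (0 : R) = 0 * cnorm m + cnorm l * 0 by rewrite mul0r mulr0 addr0.
apply: cvgD; first by apply: cvgM hf _; exact: ncvg_norm.
by apply: cvgM hg; exact: cvg_cst.
Qed.

Lemma ncvg_star f l : ncvg F f l -> ncvg F (fun t => star (f t)) (star l).
Proof.
move=> hf; apply: (ncvg_squeeze _ hf); apply: nearW => t.
by rewrite -starB cnorm_starE.
Qed.

Lemma ncvgN f l : ncvg F f l -> ncvg F (fun t => - f t) (- l).
Proof.
move=> hf; apply: (ncvg_squeeze _ hf); apply: nearW => t.
by rewrite -opprD cnormN.
Qed.

Lemma ncvgB f g l m : ncvg F f l -> ncvg F g m -> ncvg F (fun t => f t - g t) (l - m).
Proof. by move=> hf /ncvgN; exact: ncvgD. Qed.

Lemma ncvgZ (k : T -> R) (a : R) f l : k @ F --> a -> ncvg F f l ->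
  ncvg F (fun t => (k t)%:C *: f t) (a%:C *: l).
Proof.
move=> hk hf; apply: (@ncvg_squeeze _ _
   (fun t => `|k t - a| * cnorm (f t) + `|a| * cnorm (f t - l))).
  apply: nearW => t; rewrite -(subrKA (a%:C *: f t)) -scalerBl -scalerBr -rmorphB.
  by apply: le_trans (cnormD _ _) _; rewrite !cnormZR.
have -> : (0 : R) = 0 * cnorm l + `|a| * 0 by rewrite mul0r mulr0 addr0.
apply: cvgD; last by apply: cvgM hf; exact: cvg_cst.
apply: cvgM; last exact: ncvg_norm.
have -> : (0 : R) = `|a - a| by rewrite subrr normr0.
by apply: cvg_norm; apply: cvgB => //; exact: cvg_cst.
Qed.

Lemma ncvg_unique f l m : ncvg F f l -> ncvg F f m -> l = m.
Proof.
move=> hl hm; have := ncvg_norm (ncvgB hl hm).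
under eq_fun do rewrite subrr cnorm0.
move=> h; apply/eqP; rewrite -subr_eq0; apply/eqP; apply: cnorm0_eq0.
by apply: (cvg_unique _ h (cvg_cst 0)).
Qed.

Lemma ncvg_eq f g l : (forall t, f t = g t) -> ncvg F f l -> ncvg F g l.
Proof. by move=> /funext ->. Qed.

Lemma ncvg_le f l (c : R) : (\near F, cnorm (f F) <= c) -> ncvg F f l -> cnorm l <= c.
Proof. by move=> hc /ncvg_norm h; exact: (cvgr_to_le h). Qed.

Lemma ncvg_sum n (f : 'I_n -> T -> A) (l : 'I_n -> A) :
  (forall i, ncvg F (f i) (l i)) -> ncvg F (fun t => \sum_i f i t) (\sum_i l i).
Proof.
elim: n f l => [|n ih] f l h.
  by rewrite big_ord0; apply: ncvg_eq (ncvg_cst _) => t; rewrite big_ord0.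
rewrite big_ord_recl; apply: (@ncvg_eq (fun t => f ord0 t + \sum_i f (lift ord0 i) t)).
  by move=> t; rewrite big_ord_recl.
by apply: ncvgD => //; apply: ih.
Qed.

End Filtered.

Lemma complete_seq (u : nat -> A) (e : nat -> R) : e @ \oo --> (0 : R) ->
  (forall n m, (n <= m)%N -> cnorm (u m - u n) <= e n) ->
  exists2 l, ncvg \oo u l & forall n, cnorm (l - u n) <= e n.
Proof.
move=> e0 hu.
have /cnorm_complete[l hl] : cauchy (u @ \oo).
  move=> P /cnorm_entourage[d d0 hP].
  have [N _ hN] : \forall n \near \oo, e n < d / 2.
    have d2 : 0 < d / 2 by rewrite divr_gt0.
    by move/cvgrPdist_lt : e0 => /(_ _ d2); apply: filterS => n; rewrite sub0r normrN; exact: le_lt_trans (ler_norm _).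
  have hS : (u @ \oo) [set x | exists2 n, (N <= n)%N & x = u n].
    by exists N => // n /= Nn; exists n.
  exists ([set x | exists2 n, (N <= n)%N & x = u n], [set x | exists2 n, (N <= n)%N & x = u n]) => //.
  move=> [x y] /= [[n Nn ->] [m Nm ->]]; apply: hP.
  apply: le_lt_trans (cnorm_trans (u N) _ _) _.
  rewrite [d]splitr; apply: ltr_leD.
    by apply: le_lt_trans (hu _ _ Nn) (hN _ _) => /=.
  by rewrite cnormBC; apply/ltW/(le_lt_trans (hu _ _ Nm) (hN _ _)) => /=.
have {}hl : ncvg \oo u l by apply/cnorm_cvgP.
exists l => // n; apply: (@ncvg_le _ \oo _ (fun m => u m - u n)); last first.
  by apply: ncvgB => //; exact: ncvg_cst.
by exists n => // m /= nm; exact: hu.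
Qed.

End NormConvergence.

(** * Square roots and contractivity of homomorphisms *)

Lemma bernoulli (R : realFieldType) (d : R) n : 0 <= d -> 1 + n%:R * d <= (1 + d) ^+ n.
Proof.
move=> d0; elim: n => [|n ih]; first by rewrite mul0r addr0 expr0.
rewrite exprS -natr1; apply: le_trans (ler_wpM2l _ ih); last lra.
have : 0 <= n%:R * d * d by rewrite !mulr_ge0.
nra.
Qed.

(** If [X = (1 + d) * s] with [d > 0], Bernoulli's inequality at [2 ^ j], squared, bounds the power
    [2 ^ j.+1] of [1 + d] from below by [(2 ^ j * d) ^ 2]. This is quadratic in [2 ^ j] and
    overtakes the linear bound. It replaces the spectral radius formula. *)
Lemma le_of_pow2_bound (R : realType) (X s C : R) : 0 < s ->
  (forall j, X ^+ (2 ^ j) <= C * (2 ^ j)%:R * s ^+ (2 ^ j)) -> X <= s.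
Proof.
move=> s0 h; rewrite leNgt; apply/negP => sX.
pose d := X / s - 1.
have d0 : 0 < d by rewrite subr_gt0 ltr_pdivlMr // mul1r.
have {}h j : (1 + d) ^+ (2 ^ j) <= C * (2 ^ j)%:R.
  rewrite -(ler_pM2r (exprn_gt0 (2 ^ j) s0)) -exprMn; apply: le_trans (h j).
  by rewrite /d addrC subrK mulfVK // gt_eqF.
have C0 : 0 < C by have := h 0%N; rewrite expr1 mulr1; lra.
have hm j : (2 ^ j)%:R * d ^+ 2 <= 2 * C.
  have := h j.+1; rewrite expnSr exprM => h1.
  have h2 := bernoulli (2 ^ j) (ltW d0).
  have m0 : 0 < (2 ^ j)%:R :> R by rewrite ltr0n expn_gt0.
  have h3 : ((2 ^ j)%:R * d) ^+ 2 <= C * (2 ^ j * 2)%:R.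
    apply: le_trans h1; rewrite ler_sqr ?nnegrE; last 2 first.
    - by rewrite mulr_ge0 // ltW.
    - by rewrite exprn_ge0 // addr_ge0 // ltW.
    by apply: le_trans h2; rewrite lerDr.
  rewrite -(ler_pM2l m0); apply: le_trans (_ : ((2 ^ j)%:R * d) ^+ 2 <= _).
    by rewrite exprMn [X in _ <= X * _]expr2 mulrA.
  by apply: le_trans h3 _; rewrite natrM; lra.
have [n hn] : exists n, 2 * C / d ^+ 2 < n%:R.
  by exists (Num.bound (2 * C / d ^+ 2)); apply/archi_boundP; rewrite divr_ge0 ?exprn_ge0 ?mulr_ge0 // ltW.
move: hn; rewrite ltr_pdivrMr ?exprn_gt0 // ltNge => /negP; apply.
apply: le_trans (hm n); apply: ler_wpM2r; first by rewrite exprn_ge0 // ltW.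
by rewrite ler_nat; apply: ltnW; apply: ltn_expl.
Qed.

Section SquareRoots.
Variables (R : realType) (A : cstarAlgType R).
Implicit Types (x y z a h k : A) (t K u : R).

Definition rs (t : R) : A := t%:C *: 1.

Lemma rsD t u : rs (t + u) = rs t + rs u.
Proof. by rewrite /rs rmorphD scalerDl. Qed.
Lemma rsN t : rs (- t) = - rs t.
Proof. by rewrite /rs rmorphN scaleNr. Qed.
Lemma rsB t u : rs (t - u) = rs t - rs u.
Proof. by rewrite rsD rsN. Qed.
Lemma rs0 : rs 0 = 0. Proof. by rewrite /rs scale0r. Qed.
Lemma rs1 : rs 1 = 1. Proof. by rewrite /rs scale1r. Qed.
Lemma rsM t u : rs (t * u) = rs t * rs u.
Proof. by rewrite /rs rmorphM -scalerAl mul1r scalerA. Qed.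
Lemma rs_mull t x : rs t * x = t%:C *: x.
Proof. by rewrite /rs -scalerAl mul1r. Qed.
Lemma rs_mulr t x : x * rs t = t%:C *: x.
Proof. by rewrite /rs -scalerAr mulr1. Qed.
Lemma rsC t x : x * rs t = rs t * x.
Proof. by rewrite rs_mull rs_mulr. Qed.
Lemma star_rs t : star (rs t) = rs t.
Proof. by rewrite /rs starZR star1. Qed.
Lemma cnorm_rs t : cnorm (rs t) = `|t|.
Proof. exact: cnorm_scal. Qed.
Lemma scaleRrs t u : t%:C *: rs u = rs (t * u).
Proof. by rewrite /rs scalerA rmorphM. Qed.

(* [h = 1 - y] where [y] is the limit of the iteration [y := (z + y^2) / 2]. *)
Lemma sqrt_one_sub z : star z = z -> cnorm z < 1 -> exists h,
  [/\ star h = h, h * h = 1 - z, cnorm (1 - h) <= cnorm z &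
      forall w, w * z = z * w -> w * h = h * w].
Proof.
move=> sz z1; set q := cnorm z in z1 *; have q0 : 0 <= q by rewrite /q.
pose hf := (2^-1 : R)%:C.
pose y := fix y n : A := if n is n'.+1 then hf *: (z + y n' * y n') else 0.
have hfn x : cnorm (hf *: x) = 2^-1 * cnorm x by rewrite cnormZR ger0_norm.
have yq n : cnorm (y n) <= q.
  elim: n => [|n ih] /=; first by rewrite cnorm0.
  rewrite hfn; have := cnormD z (y n * y n); have := cnormM (y n) (y n).
  have := cnorm_ge0 (y n); rewrite -/q; nra.
(* All iterates stay in the ball of radius [q], where the iteration contracts distances by the
   factor [q]. *)
have yd n m : (n <= m)%N -> cnorm (y m - y n) <= q ^+ n.
  elim: n m => [|n ih] [|m] //; rewrite ?expr0 ?subr0.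
  - by rewrite cnorm0.
  - by move=> _; apply: le_trans (yq _) (ltW z1).
  rewrite ltnS => nm /=; rewrite -scalerBr hfn opprD addrACA subrr add0r.
  have -> : y m * y m - y n * y n = y m * (y m - y n) + (y m - y n) * y n.
    by rewrite mulrBr mulrBl subrKA.
  have h1 := cnormD (y m * (y m - y n)) ((y m - y n) * y n).
  have h2 := cnormM (y m) (y m - y n); have h3 := cnormM (y m - y n) (y n).
  have h4 := ih _ nm; have h5 := yq n; have h6 := yq m.
  have h7 := cnorm_ge0 (y m - y n).
  have : cnorm (y m) * cnorm (y m - y n) <= q * q ^+ n by apply: ler_pM.
  have : cnorm (y m - y n) * cnorm (y n) <= q ^+ n * q by apply: ler_pM.
  by rewrite exprS; lra.
have e0 : (fun n => q ^+ n) @ \oo --> (0 : R) by apply: cvg_expr; rewrite ger0_norm.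
have [l hl _] := complete_seq e0 yd.
have hl1 : ncvg \oo (fun n => y n.+1) l by rewrite /ncvg (cvg_shiftS (fun n => cnorm (y n - l))).
have lE : l = hf *: (z + l * l).
  apply: (ncvg_unique hl1); apply: ncvgZ; first exact: cvg_cst.
  by apply: ncvgD; [exact: ncvg_cst | exact: ncvgM].
have l2 : l + l = z + l * l.
  rewrite {1 2}lE -scalerDl -rmorphD; suff -> : (2^-1 + 2^-1 : R) = 1 by rewrite scale1r.
  lra.
exists (1 - l); split.
- rewrite starB star1; congr (_ - _); apply: (ncvg_unique (ncvg_star hl)).
  suff sy n : star (y n) = y n by apply: ncvg_eq hl => n; rewrite sy.
  by elim: n => [|n ih] /=; rewrite ?star0 // starZR starD starM sz ih.
- have zE : z = l + l - l * l by rewrite l2 addrK.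
  rewrite mulrBr mulr1 mulrBl mul1r zE !opprB opprD -!addrA; congr (_ + _).
  exact: addrCA.
- rewrite opprB addrC subrK; apply: ncvg_le hl; exact: nearW.
- move=> w wz; rewrite mulrBr mulrBl mulr1 mul1r; congr (_ - _).
  have wy n : w * y n = y n * w.
    elim: n => [|n ih] /=; first by rewrite mulr0 mul0r.
    by rewrite -scalerAr -scalerAl mulrDr mulrDl wz mulrA ih -mulrA ih mulrA.
  apply: (ncvg_unique (ncvgM (ncvg_cst w) hl)).
  by apply: ncvg_eq (ncvgM hl (ncvg_cst w)) => n.
Qed.

(** As [h] and [k] commute, [w = h + i k] satisfies [star w * w = h^2 + k^2], so
    [cnorm w ^ 2 = |t|]; and [h] is the real part of [w]. This is the form in which order arguments
    enter before positivity is available. *)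
Lemma normal_bound h k t : star h = h -> star k = k -> h * k = k * h ->
  h * h + k * k = rs t -> cnorm h ^+ 2 <= `|t|.
Proof.
move=> sh sk hk e; pose w := h + 'i%C *: k.
have sw : star w = h - 'i%C *: k.
  rewrite /w starD starZ sh sk; suff -> : ('i%C : R[i])^* = - 'i%C by rewrite scaleNr.
  by apply/eqP; rewrite eq_complex /= oppr0 !eqxx.
have ww : star w * w = rs t.
  have ii : 'i%C * 'i%C = -1 :> R[i] by rewrite -expr2 sqr_i.
  rewrite sw /w mulrDr !mulrBl -!scalerAl -!scalerAr hk scalerA ii scaleN1r.
  by rewrite opprK addrA subrK e.
have nw : cnorm w ^+ 2 = `|t| by rewrite -cnorm_star ww cnorm_rs.
rewrite -nw ler_sqr ?nnegrE //.
have -> : h = (2^-1 : R)%:C *: (w + star w).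
  rewrite sw /w addrACA subrr addr0 scalerDr -scalerDl -rmorphD.
  suff -> : (2^-1 + 2^-1 : R) = 1 by rewrite scale1r.
  lra.
rewrite cnormZR ger0_norm //; have := cnormD w (star w); rewrite cnorm_starE; lra.
Qed.

End SquareRoots.
Arguments rs {R A} t.

Section Contractive.
Variables (R : realType) (A B : cstarAlgType R) (f : {starhom A -> B}).

Lemma starhomM x y : f (x * y) = f x * f y.
Proof. exact: rmorphM. Qed.

(* If [cnorm y < 1] and [k] is a square root of [1 - y^2], then
   [f y ^ 2 + f k ^ 2 = 1] bounds [f y] without any spectral theory. *)
Lemma starhom_sa_le x : star x = x -> cnorm (f x) <= cnorm x.
Proof.
move=> sx; apply/ler_addgt0Pr => e e0; set t := cnorm x + e.
have t0 : 0 < t by rewrite ltr_wpDl.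
pose y := t^-1%:C *: x.
have sy : star y = y by rewrite starZR sx.
have y1 : cnorm y < 1.
  by rewrite cnormZR gtr0_norm ?invr_gt0 // mulrC ltr_pdivrMr // mul1r ltrDl.
have syy : star (y * y) = y * y by rewrite starM sy.
have [|k [sk kk _ ck]] := sqrt_one_sub syy.
  by rewrite cnorm_sa_sqr // exprn_ilt1.
have yk : y * k = k * y by apply: ck; rewrite mulrA.
have : cnorm (f y) ^+ 2 <= `|1|.
  apply: (@normal_bound _ _ (f y) (f k)); rewrite -?rmorphM -?star_morph ?sy ?sk ?yk //.
  by rewrite -rmorphD kk addrC subrK rmorph1 rs1.
rewrite normr1 -[X in _ <= X](expr1n _ 2) ler_sqr ?nnegrE // => fy.
have -> : x = t%:C *: y by rewrite scalerA -rmorphM divff ?gt_eqF // scale1r.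
by rewrite linearZ cnormZR gtr0_norm // -[X in _ <= X]mulr1 ler_pM2l.
Qed.

Lemma starhom_le x : cnorm (f x) <= cnorm x.
Proof.
rewrite -ler_sqr ?nnegrE // -!cnorm_star -star_morph -rmorphM.
by apply: starhom_sa_le; rewrite starM starK.
Qed.

End Contractive.

(** * Positivity *)

Section Positivity.
Variables (R : realType) (A : cstarAlgType R).
Implicit Types (x y z a c d h k : A) (t K u s : R).

(* The spectrum-free form of positivity. *)
Definition pos a : Prop :=
  star a = a /\ exists2 K : R, 0 <= K & cnorm (rs K - a) <= K.

Lemma pos_widen a K t : cnorm (rs K - a) <= K -> K <= t -> cnorm (rs t - a) <= t.
Proof.
move=> h Kt; have := cnormD (rs (t - K)) (rs K - a).
rewrite cnorm_rs ger0_norm ?subr_ge0 // rsB addrA subrK => h'; lra.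
Qed.

Lemma posD a b : pos a -> pos b -> pos (a + b).
Proof.
move=> [sa [K K0 hK]] [sb [t t0 ht]]; split; first by rewrite starD sa sb.
exists (K + t); first exact: addr_ge0.
by rewrite rsD opprD addrACA; apply: le_trans (cnormD _ _) (lerD hK ht).
Qed.

Lemma posZ t a : 0 <= t -> pos a -> pos (t%:C *: a).
Proof.
move=> t0 [sa [K K0 hK]]; split; first by rewrite starZR sa.
exists (t * K); first exact: mulr_ge0.
by rewrite -scaleRrs -scalerBr cnormZR ger0_norm // ler_wpM2l.
Qed.

Lemma pos_rs t : 0 <= t -> pos (rs t).
Proof. by move=> t0; split; [exact: star_rs | exists t => //; rewrite subrr cnorm0]. Qed.

Lemma pos_rs_ge0 t : pos (rs t : A) -> 0 <= t.
Proof.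
move=> [_ [K K0]]; rewrite -rsB cnorm_rs ler_norml => /andP[_]; lra.
Qed.

Lemma pos_norm_sub y : star y = y -> pos (rs (cnorm y) - y).
Proof.
move=> sy; split; first by rewrite starB star_rs sy.
by exists (cnorm y) => //; rewrite opprB addrC subrK.
Qed.

(** For [y = k / t], the element [1 - y^2] is a square [h^2] with [h] commuting with [y], and
    [h^2 + y^2 = 1] forces [cnorm h <= 1]. *)
Lemma sq_sub_le k t : star k = k -> cnorm k < t -> cnorm (rs (t ^+ 2) - k * k) <= t ^+ 2.
Proof.
move=> sk kt; have t0 : 0 < t := le_lt_trans (cnorm_ge0 _) kt.
pose y := t^-1%:C *: k.
have sy : star y = y by rewrite starZR sk.
have y1 : cnorm y < 1.
  by rewrite cnormZR gtr0_norm ?invr_gt0 // mulrC ltr_pdivrMr // mul1r.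
have syy : star (y * y) = y * y by rewrite starM sy.
have [|h [sh hh _ ch]] := sqrt_one_sub syy.
  by rewrite cnorm_sa_sqr // exprn_ilt1.
have yh : y * h = h * y by apply: ch; rewrite mulrA.
have h1 : cnorm h ^+ 2 <= `|1|.
  by apply: (@normal_bound _ _ h y) => //; rewrite hh subrK rs1.
have -> : rs (t ^+ 2) - k * k = (t ^+ 2)%:C *: (h * h).
  rewrite hh scalerBr -/(rs _); congr (_ - _).
  rewrite /y -scalerAl -scalerAr !scalerA -!rmorphM.
  suff -> : t ^+ 2 / t / t = 1 by rewrite scale1r.
  by field; rewrite gt_eqF.
rewrite cnormZR ger0_norm ?exprn_ge0 // ?(ltW t0) // cnorm_sa_sqr //.
by rewrite normr1 in h1; rewrite -[X in _ <= X]mulr1 ler_wpM2l // exprn_ge0 // ltW.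
Qed.

Lemma pos_sq k : star k = k -> pos (k * k).
Proof.
move=> sk; split; first by rewrite starM sk.
exists ((cnorm k + 1) ^+ 2); first by rewrite exprn_ge0 // addr_ge0.
by apply: sq_sub_le => //; rewrite ltrDl.
Qed.

(** The shift makes the bound strict: with [t = K + u], one has [a + rs u = t (1 - z)] where
    [cnorm z <= K / t < 1]. *)
Lemma pos_sqrt a u : pos a -> 0 < u -> exists h,
  [/\ star h = h, h * h = a + rs u & forall w, w * a = a * w -> w * h = h * w].
Proof.
move=> [sa [K K0 hK]] u0; set t := K + u.
have t0 : 0 < t by rewrite ltr_wpDl.
pose z := t^-1%:C *: (rs K - a).
have sz : star z = z by rewrite starZR starB star_rs sa.
have z1 : cnorm z < 1.
  rewrite cnormZR gtr0_norm ?invr_gt0 // mulrC ltr_pdivrMr // mul1r.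
  by apply: le_lt_trans hK _; rewrite ltrDl.
have [h [sh hh _ ch]] := sqrt_one_sub sz z1.
exists ((Num.sqrt t)%:C *: h); split.
- by rewrite starZR sh.
- rewrite -scalerAl -scalerAr scalerA -rmorphM -expr2 sqr_sqrtr ?(ltW t0) // hh.
  rewrite scalerBr scalerA -rmorphM divff ?gt_eqF // scale1r -/(rs t) opprB addrCA.
  by rewrite -rsB /t addrAC subrr add0r.
- move=> w wa; rewrite -scalerAr -scalerAl; congr (_ *: _); apply: ch.
  by rewrite /z -scalerAr -scalerAl mulrBr mulrBl rsC wa.
Qed.

Lemma le_of_sqr_le (x y : R) : 0 <= y -> (forall e, 0 < e -> x ^+ 2 <= (y + e) ^+ 2) -> x <= y.
Proof.
move=> y0 h; apply/ler_addgt0Pr => e e0; have := h e e0 => h1.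
rewrite leNgt; apply/negP => h2; have : y + e < x by [].
by move: h1; nra.
Qed.

(** The square roots [h], [g] of [u + e + d] and [u + e - d] commute with each other and with [d],
    so [d^2 + (h g)^2 = (u + e)^2] and [normal_bound] applies; then [e] tends to [0]. *)
Lemma pos_between d u : star d = d -> 0 <= u -> pos (rs u + d) -> pos (rs u - d) ->
  cnorm d <= u.
Proof.
move=> sd u0 p1 p2; apply: le_of_sqr_le => // e e0.
have [h [sh hh ch]] := pos_sqrt p1 e0.
have [g [sg gg cg]] := pos_sqrt p2 e0.
have dh : d * h = h * d by apply: ch; rewrite mulrDr mulrDl rsC.
have dg : d * g = g * d by apply: cg; rewrite mulrBr mulrBl rsC.
have hg : h * g = g * h by apply: cg; rewrite mulrBr mulrBl rsC dh.
rewrite -[X in _ <= X]ger0_norm ?exprn_ge0 ?addr_ge0 ?(ltW e0) //.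
apply: (@normal_bound _ _ d (h * g)) => //; first by rewrite starM sh sg hg.
  by rewrite mulrA dh -mulrA dg mulrA.
have -> : h * g * (h * g) = (h * h) * (g * g).
  by rewrite -mulrA [g * (h * g)]mulrA -hg -!mulrA.
rewrite hh gg [rs u + d + _]addrAC [rs u - d + _]addrAC -rsD addrC.
by rewrite [d + rs _]addrC mulrDl !mulrBr [d * rs _]rsC addrC !addrA !subrK -rsM.
Qed.

(* The powers of [M + c c^* ] are [M ^ n + c Y n c^* ], with [Y n] a polynomial in
   [M + c^* c]; taking [2 ^ j]-th roots removes the polynomial factors. *)
Lemma cnorm_swap_le c s M : 0 <= M -> M <= s -> 1 <= s ->
  cnorm (rs M + star c * c) <= s -> cnorm (rs M + c * star c) <= s.
Proof.
move=> M0 Ms s1 hs; set D := star c * c in hs *; set P := rs M + c * star c.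
have s0 : 0 <= s := le_trans M0 Ms.
pose Y := fix Y n : A := if n is n'.+1 then rs (M ^+ n') + Y n' * (rs M + D) else 0.
have cP : star c * P = (rs M + D) * star c.
  by rewrite /P /D mulrDr mulrDl rsC mulrA.
have PY n : P ^+ n = rs (M ^+ n) + c * Y n * star c.
  elim: n => [|n ih]; first by rewrite !expr0 /= mulr0 mul0r addr0 rs1.
  rewrite exprSr ih mulrDl {1}/P mulrDr -rsM -exprSr -addrA; congr (_ + _).
  have -> : Y n.+1 = rs (M ^+ n) + Y n * (rs M + D) by [].
  rewrite [c * _ in RHS]mulrDr [RHS]mulrDl; congr (_ + _); first by rewrite rsC mulrA.
  by rewrite -[c * _ * _ * P]mulrA cP !mulrA.
have nY n : cnorm (Y n.+1) <= n.+1%:R * s ^+ n.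
  elim: n => [|n ih]; first by rewrite /= mul0r addr0 !expr0 rs1 cnorm1 mul1r.
  rewrite [Y _]/=-/(Y n.+1); apply: le_trans (cnormD _ _) _.
  rewrite -[n.+2%:R]nat1r [_ * s ^+ _]mulrDl mul1r; apply: lerD.
    by rewrite cnorm_rs ger0_norm ?exprn_ge0 //; apply: lerXn2r.
  apply: le_trans (cnormM _ _) _; rewrite exprSr mulrA.
  by apply: ler_pM.
have sp : 0 < s := lt_le_trans ltr01 s1.
have sP : star P = P by rewrite starD star_rs starM starK.
(* With [n.+1 = 2 ^ j], the expansion is bounded by [s ^ n.+1 + cnorm c ^ 2 * n.+1 * s ^ n]; since
   [1 <= s], both terms fit into [(1 + cnorm c ^ 2) * n.+1 * s ^ n.+1]. *)
apply: (@le_of_pow2_bound _ _ _ (1 + cnorm c ^+ 2)) => // j.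
rewrite -cnorm_sa_pow2 // PY.
case: (2 ^ j)%N (expn_gt0 2 j) => // n _.
apply: le_trans (cnormD _ _) _; rewrite cnorm_rs ger0_norm ?exprn_ge0 //.
have h1 : M ^+ n.+1 <= s ^+ n.+1 by apply: lerXn2r.
have h2 : cnorm (c * Y n.+1 * star c) <= cnorm c ^+ 2 * (n.+1%:R * s ^+ n).
  apply: le_trans (cnormM _ _) _; rewrite cnorm_starE mulrC expr2 -mulrA.
  apply: ler_wpM2l => //; apply: le_trans (cnormM _ _) _.
  exact: ler_wpM2l (nY n).
have h3 : s ^+ n <= s ^+ n.+1 by rewrite exprS ler_peMl // exprn_ge0.
have n1 : 1 <= n.+1%:R :> R by rewrite ler1n.
have c0 : 0 <= cnorm c ^+ 2 by rewrite exprn_ge0.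
have s2 : 0 <= s ^+ n.+1 by rewrite exprn_ge0.
have h4 : n.+1%:R * s ^+ n <= n.+1%:R * s ^+ n.+1 by rewrite ler_pM2l ?ltr0n.
have h5 : cnorm c ^+ 2 * (n.+1%:R * s ^+ n) <= cnorm c ^+ 2 * (n.+1%:R * s ^+ n.+1).
  exact: ler_wpM2l.
have h6 : s ^+ n.+1 <= n.+1%:R * s ^+ n.+1 by rewrite ler_peMl.
by rewrite mulrDl mul1r mulrDl -[cnorm c ^+ 2 * _ * _]mulrA; lra.
Qed.

(** Stands in for the fact that [star c * c] and [c * star c] have the same nonzero spectrum. With
    the constant [K + 1] both positivity conditions read as norm bounds on [rs K + star c * c] and
    [rs K + c * star c], and [1 <= K + 1] as [cnorm_swap_le] demands. *)
Lemma pos_star_mul_swap c : pos (1 - star c * c) -> pos (1 - c * star c).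
Proof.
move=> [_ [K K0 hK]]; split; first by rewrite starB star1 starM starK.
have K1 : 1 <= K + 1 by rewrite lerDr.
exists (K + 1); first exact: le_trans ler01 K1.
have hE x : rs (K + 1) - (1 - x) = rs K + x.
  by rewrite opprB rsD rs1 [x - 1]addrC addrA addrK.
rewrite hE; apply: cnorm_swap_le => //; first by rewrite lerDl.
by rewrite -hE; apply: pos_widen hK _; rewrite lerDl.
Qed.

(** Up to factors, [p] and [q] are the real and imaginary parts of [c]; the terms [c * c] and
    [star c * star c] cancel in [p^2 + q^2]. *)
Lemma pos_star_mul_add c : pos (star c * c + c * star c).
Proof.
pose p := c + star c; pose q := 'i%C *: (c - star c).
have sp : star p = p by rewrite /p starD starK addrC.
have sq : star q = q.
  rewrite /q starZ starB starK (_ : ('i%C : R[i])^*%R = - 'i%C).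
    by rewrite scaleNr -scalerN opprB.
  by apply/eqP; rewrite eq_complex /= oppr0 !eqxx.
have -> : star c * c + c * star c = (2^-1 : R)%:C *: (p * p + q * q).
  have ii : 'i%C * 'i%C = -1 :> R[i] by rewrite -expr2 sqr_i.
  rewrite /q -scalerAl -scalerAr scalerA ii scaleN1r /p.
  rewrite !(mulrDr, mulrDl) !(mulrN, mulNr) opprK.
  set cc := c * c; set ss := star c * star c; set cs := c * star c; set sc := star c * c.
  have -> : cc + sc + (cs + ss) - (cc - sc + (- cs + ss)) = (sc + cs) + (sc + cs).
    have e1 : (cc + sc) - (cc - sc) = sc + sc by rewrite opprD opprK addrACA subrr add0r.
    have e2 : (cs + ss) - (- cs + ss) = cs + cs by rewrite opprD opprK addrACA subrr addr0.
    by rewrite opprD [LHS]addrACA e1 e2 addrACA.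
  rewrite scalerDr -scalerDl -rmorphD (_ : 2^-1 + 2^-1 = 1 :> R) ?scale1r //; lra.
apply: posZ; first by rewrite invr_ge0.
by apply: posD; exact: pos_sq.
Qed.

(* With [k ^ 2 = 1 - x^* x] and [c = x k ^ n], the element
   [c^* c = k ^ 2n (1 - k ^ 2)] is at most [1], hence so is [c c^* ]. As
   [c^* c + c c^* ] is positive, [c^* c] lies between [- 1] and [1]. So the powers of
   [k ^ 2] grow at most linearly, which forces [cnorm (k ^ 2) <= 1]. *)
Lemma pos_star_mul_small x : cnorm x < 1 -> pos (star x * x).
Proof.
move=> x1; set a := star x * x.
have sa : star a = a by rewrite /a starM starK.
have [|k [sk kk _ ck]] := @sqrt_one_sub _ _ a sa.
  by rewrite /a cnorm_star exprn_ilt1.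
pose b n : A := (k * k) ^+ n * (1 - k * k).
have kk1 : 1 - k * k = a by rewrite kk opprB addrC subrK.
have skk n : star ((k * k) ^+ n) = (k * k) ^+ n by rewrite starX starM sk.
have cb1 n : GRing.comm (k ^+ n) (1 - k * k).
  by apply: commr_sym; apply: commrX; apply: commr_sym; apply: commrB;
     [exact: commr1 | exact: commrM].
have kX n : (k * k) ^+ n = k ^+ n * k ^+ n by rewrite -expr2 -exprM mulnC exprM expr2.
have bE n : star (x * k ^+ n) * (x * k ^+ n) = b n.
  rewrite starM starX sk mulrA -[k ^+ n * star x * x]mulrA -/a -kk1 -mulrA -cb1 mulrA.
  by rewrite -kX.
have sb n : star (b n) = b n by rewrite -bE starM starK.
have p1 n : pos (1 - b n).
  elim: n => [|n ih].
    by rewrite /b expr0 mul1r opprB addrC subrK; exact: pos_sq.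
  (* The decrement [b n - b n.+1 = b n * (1 - k^2)] is the square of a self-adjoint element, so
     positivity of [1 - b n] propagates from [1 - b 0 = k^2]. *)
  have -> : 1 - b n.+1 = 1 - b n + (k ^+ n * (1 - k * k)) * (k ^+ n * (1 - k * k)).
    have -> : k ^+ n * (1 - k * k) * (k ^+ n * (1 - k * k)) = b n * (1 - k * k).
      by rewrite -mulrA [(1 - k * k) * (_ * _)]mulrA -cb1 /b kX !mulrA.
    have -> : b n.+1 = b n * (k * k).
      rewrite /b exprSr -[LHS]mulrA -[RHS]mulrA; congr (_ * _).
      by rewrite mulrBl mulrBr mul1r mulr1.
    by rewrite mulrBr mulr1 addrA subrK.
  apply: posD ih _; apply: pos_sq.
  by rewrite starM starX sk starB star1 starM sk -cb1.
have p2 n : pos (1 + b n).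
  rewrite -bE; set c := x * k ^+ n.
  have -> : 1 + star c * c = (1 - c * star c) + (star c * c + c * star c).
    by rewrite [star c * c + _]addrC addrA subrK.
  apply: posD; last exact: pos_star_mul_add.
  by apply: pos_star_mul_swap; rewrite bE; exact: p1.
have nb n : cnorm (b n) <= 1.
  by apply: pos_between => //; rewrite rs1.
have nk n : cnorm ((k * k) ^+ n) <= n.+1%:R.
  elim: n => [|n ih]; first by rewrite expr0 cnorm1.
  have -> : (k * k) ^+ n.+1 = (k * k) ^+ n - b n.
    by rewrite /b mulrBr mulr1 opprB addrC subrK exprSr.
  apply: le_trans (cnormB _ _) _; rewrite -[n.+2%:R]natr1; apply: lerD => //; exact: nb.
split => //; exists 1 => //; rewrite rs1 -kk.
(* The constant [2] absorbs the successor: [(2 ^ j).+1 <= 2 * 2 ^ j]. *)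
apply: (@le_of_pow2_bound _ _ _ 2) => // j; rewrite -cnorm_sa_pow2 ?starM ?sk //.
apply: le_trans (nk _) _; rewrite expr1n mulr1 -natrM ler_nat mul2n -addnn -addn1 leq_add2l.
by rewrite expn_gt0.
Qed.

Lemma pos_star_mul x : pos (star x * x).
Proof.
set t := cnorm x + 1.
have t0 : 0 < t by rewrite ltr_wpDl.
have -> : star x * x = (t ^+ 2)%:C *: (star (t^-1%:C *: x) * (t^-1%:C *: x)).
  rewrite starZR -scalerAl -scalerAr !scalerA -!rmorphM.
  suff -> : t ^+ 2 / t / t = 1 by rewrite scale1r.
  by field; rewrite gt_eqF.
apply: posZ; first by rewrite exprn_ge0 // ltW.
apply: pos_star_mul_small.
by rewrite cnormZR gtr0_norm ?invr_gt0 // mulrC ltr_pdivrMr // mul1r ltrDl.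
Qed.

End Positivity.

(** * States *)

Section HahnBanach.
Variables (R : realType) (V : lmodType R[i]).
Implicit Types (p q f : V -> R) (x y : V).

(** Only real scalars occur: the functionals are real valued and [exists_state] complexifies the
    result. The inequality for [t > 0] already gives equality, by applying it to [t^-1]. *)
Definition sublinear p : Prop :=
  (forall x y, p (x + y) <= p x + p y) /\
  (forall (t : R) x, 0 < t -> p (t%:C *: x) <= t * p x).

Lemma sublinearZ p (t : R) x : sublinear p -> 0 < t -> p (t%:C *: x) = t * p x.
Proof.
move=> [_ h] t0; apply/le_anti; rewrite h //=.
have := h t^-1 (t%:C *: x); rewrite invr_gt0 t0 scalerA -rmorphM mulVf ?gt_eqF // scale1r.
by move=> /(_ isT); rewrite -(ler_pM2l t0) mulrA divff ?gt_eqF // mul1r.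
Qed.

Lemma sublinear0 p : sublinear p -> p 0 = 0.
Proof.
move=> hp; have := @sublinearZ p 2 0 hp (ltr0Sn _ _); rewrite scaler0; lra.
Qed.

Lemma sublinear_lb p x : sublinear p -> - p (- x) <= p x.
Proof.
by move=> hp; have := hp.1 x (- x); rewrite subrr sublinear0 //; lra.
Qed.

Lemma sublinear_sub_lb p x y : sublinear p -> p y - p (- x) <= p (x + y).
Proof. by move=> hp; have := hp.1 (- x) (x + y); rewrite addKr; lra. Qed.

(* For sublinear [q] this is sublinear, below [q], and at most [- q y] at [- y]. *)
Definition tilt q y : V -> R :=
  fun x => inf [set r | exists2 t : R, 0 <= t & r = q (x + t%:C *: y) - t * q y].

Section Tilt.
Variables (q : V -> R) (y : V).
Hypothesis hq : sublinear q.

Let has_inf_tilt x :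
  has_inf [set r | exists2 t : R, 0 <= t & r = q (x + t%:C *: y) - t * q y].
Proof.
split; first by exists (q (x + 0%:C *: y) - 0 * q y); exists 0.
exists (- q (- x)) => _ [t t0 ->]; have := sublinear_sub_lb x (t%:C *: y) hq.
move: t0; rewrite [0 <= t]le_eqVlt => /orP[/eqP<-|t0].
  by rewrite scale0r sublinear0 // mul0r; lra.
by rewrite (sublinearZ y hq t0); lra.
Qed.

Lemma tilt_le_at x t : 0 <= t -> tilt q y x <= q (x + t%:C *: y) - t * q y.
Proof. by move=> t0; apply: ge_inf; [exact: (has_inf_tilt x).2 | exists t]. Qed.

Lemma le_tilt x (c : R) : (forall t, 0 <= t -> c <= q (x + t%:C *: y) - t * q y) -> c <= tilt q y x.
Proof.
by move=> h; apply: lb_le_inf; [exact: (has_inf_tilt x).1 | move=> _ [t t0 ->]; exact: h].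
Qed.

Lemma tilt_le x : tilt q y x <= q x.
Proof. by have := @tilt_le_at x 0 (lexx _); rewrite scale0r addr0 mul0r subr0. Qed.

Lemma sublinear_tilt : sublinear (tilt q y).
Proof.
split=> [x x'|t x t0].
  rewrite -lerBlDr; apply: le_tilt => t t0; rewrite lerBlDr -lerBlDl; apply: le_tilt => s s0.
  have := @tilt_le_at (x + x') (t + s) (addr_ge0 t0 s0).
  have := hq.1 (x + t%:C *: y) (x' + s%:C *: y).
  by rewrite rmorphD scalerDl addrACA; lra.
rewrite mulrC -ler_pdivrMr //; apply: le_tilt => s s0; rewrite ler_pdivrMr //.
have := @tilt_le_at (t%:C *: x) (t * s) (mulr_ge0 (ltW t0) s0).
have := @sublinearZ q t (x + s%:C *: y) hq t0.
by rewrite scalerDr scalerA -rmorphM; lra.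
Qed.

End Tilt.

(** Zorn's lemma for the pointwise order. Chains have infima because every sublinear [q <= p] is
    bounded below at [x] by [- p (- x)]. *)
Lemma sublinear_minimal p : sublinear p -> exists2 q, sublinear q &
  (forall x, q x <= p x) /\
  forall q', sublinear q' -> (forall x, q' x <= q x) -> q' = q.
Proof.
move=> hp.
pose T := {q : V -> R | sublinear q /\ forall x, q x <= p x}.
(* The order is reversed, so that a maximal element is a minimal functional. *)
pose le (a b : T) := `[< forall x, sval b x <= sval a x >].
have [||||[q [hq qp]] hmax] := @Zorn T le.
- by move=> a; apply/asboolP.
- by move=> a b c /asboolP h1 /asboolP h2; apply/asboolP => x; apply: le_trans (h2 x) (h1 x).
- move=> [a ha] [b hb] /asboolP h1 /asboolP h2.
  have e : a = b by apply/funext => x; apply/le_anti; rewrite h1 h2.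
  by subst b; congr exist; exact: Prop_irrelevance.
- move=> C tC.
  have [[c0 C0]|C0] := pselect (C !=set0); last first.
    by exists (exist _ p (conj hp (fun x => lexx _))) => s Cs; case: C0; exists s.
  pose g x : R := inf [set sval c x | c in C].
  have hi x : has_inf [set sval c x | c in C].
    split; first by exists (sval c0 x), c0.
    exists (- p (- x)) => _ [c Cc <-]; have [hc cp] := svalP c.
    by apply: le_trans (sublinear_lb x hc); rewrite lerN2.
  have gle c x : C c -> g x <= sval c x.
    by move=> Cc; apply: ge_inf; [exact: (hi x).2 | exists c].
  have leg x r : (forall c, C c -> r <= sval c x) -> r <= g x.
    by move=> h; apply: lb_le_inf; [exact: (hi x).1 | move=> _ [c Cc <-]; exact: h].
  have hg : sublinear g.
    split=> [x y|t x t0].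
      (* Of two comparable members [c], [d] of the chain, the smaller one is used at [x + y]. *)
      rewrite -lerBlDr; apply: (leg _ _) => c Cc; rewrite lerBlDr -lerBlDl; apply: (leg _ _) => d Cd.
      rewrite lerBlDl; have [/asboolP h|/asboolP h] := tC _ _ Cc Cd.
        apply: le_trans (gle d _ Cd) _; apply: le_trans ((svalP d).1.1 _ _) _.
        by rewrite lerD2r h.
      apply: le_trans (gle c _ Cc) _; apply: le_trans ((svalP c).1.1 _ _) _.
      by rewrite lerD2l h.
    rewrite mulrC -ler_pdivrMr //; apply: (leg _ _) => c Cc; rewrite ler_pdivrMr // mulrC.
    by apply: le_trans (gle c _ Cc) _; exact: (svalP c).1.2.
  have gp x : g x <= p x by apply: le_trans (gle c0 _ C0) _; exact: (svalP c0).2.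
  by exists (exist _ g (conj hg gp)) => c Cc; apply/asboolP => x; exact: gle.
exists q => //; split=> // q' hq' h.
have q'p x : q' x <= p x := le_trans (h x) (qp x).
by have /(congr1 sval) := hmax (exist _ q' (conj hq' q'p)) (asboolT h).
Qed.

(* A minimal sublinear functional equals all its tilts, hence is additive. *)
Theorem hahn_banach p a : sublinear p -> exists f,
  [/\ forall x y, f (x + y) = f x + f y, forall (t : R) x, f (t%:C *: x) = t * f x,
      forall x, f x <= p x & f a = p a].
Proof.
(* Minimizing below the tilt at [a] rather than below [p] secures the value at [a]: the tilt is at
   most [- p a] at [- a], so an additive [f] below it has [p a <= f a]. *)
move=> hp; have ht := sublinear_tilt a hp.
have [f hf [fp fmin]] := sublinear_minimal ht.
have fD x y : f (x + y) = f x + f y.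
  apply/le_anti; rewrite hf.1 /=.
  have <- : tilt f y = f := fmin _ (sublinear_tilt y hf) (tilt_le y hf).
  rewrite -lerBrDr.
  have {2}-> : tilt f y = f := fmin _ (sublinear_tilt y hf) (tilt_le y hf).
  have := @tilt_le_at f y hf x 1 ler01; rewrite scale1r mul1r => h.
  apply: le_trans h _.
  by have -> : tilt f y = f := fmin _ (sublinear_tilt y hf) (tilt_le y hf).
have fN x : f (- x) = - f x by have := fD x (- x); rewrite subrr sublinear0 //; lra.
exists f; split=> //.
- move=> t x; have [t0|t0|->] := ltgtP t 0; last by rewrite scale0r sublinear0 // mul0r.
  + rewrite -[t]opprK rmorphN scaleNr fN sublinearZ ?oppr_gt0 //; lra.
  + exact: sublinearZ.
- by move=> x; apply: le_trans (fp x) (tilt_le a hp x).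
apply/le_anti; rewrite (le_trans (fp a) (tilt_le a hp a)) /=.
have := fp (- a); have := @tilt_le_at p a hp (- a) 1 ler01.
rewrite scale1r addNr sublinear0 // mul1r fN; lra.
Qed.

End HahnBanach.

Section States.
Variables (R : realType) (A : cstarAlgType R).
Implicit Types (x y b : A) (c : R[i]) (t u : R).

Definition state (F : A -> R[i]) : Prop :=
  [/\ forall c x y, F (c *: x + y) = c * F x + F y,
      forall x, 0 <= F (star x * x) & F 1 = 1].

Definition herm x : A := (2^-1 : R)%:C *: (x + star x).

Lemma herm_sa x : star (herm x) = herm x.
Proof. by rewrite /herm starZR starD starK addrC. Qed.

Lemma herm_id x : star x = x -> herm x = x.
Proof.
move=> sx; rewrite /herm sx scalerDr -scalerDl -rmorphD.
suff -> : (2^-1 + 2^-1 : R) = 1 by rewrite scale1r.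
lra.
Qed.

Lemma hermD x y : herm (x + y) = herm x + herm y.
Proof. by rewrite /herm starD addrACA scalerDr. Qed.

Lemma hermZ t x : herm (t%:C *: x) = t%:C *: herm x.
Proof. by rewrite /herm starZR -scalerDr !scalerA mulrC. Qed.

(* The supremum of the spectrum of the real part of [x]. *)
Definition spec_sup x : R := inf [set u | pos (rs u - herm x)].

Lemma has_inf_spec_sup x : has_inf [set u | pos (rs u - herm x)].
Proof.
split; first by exists (cnorm (herm x)); exact: pos_norm_sub (herm_sa x).
exists (- cnorm (herm x)) => u /= hu.
have := pos_norm_sub (y := - herm x); rewrite starN herm_sa => /(_ erefl).
move=> /(posD hu); rewrite opprK addrACA cnormN addNr addr0 -rsD => /pos_rs_ge0; lra.
Qed.

Lemma spec_sup_le x u : pos (rs u - herm x) -> spec_sup x <= u.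
Proof. by move=> h; apply: ge_inf => //; exact: (has_inf_spec_sup x).2. Qed.

Lemma le_spec_sup x t : (forall u, pos (rs u - herm x) -> t <= u) -> t <= spec_sup x.
Proof. by move=> h; apply: lb_le_inf => //; exact: (has_inf_spec_sup x).1. Qed.

Lemma sublinear_spec_sup : sublinear spec_sup.
Proof.
split=> [x y|t x t0].
  rewrite -lerBlDr; apply: le_spec_sup => u hu; rewrite lerBlDr -lerBlDl.
  apply: le_spec_sup => v hv; rewrite lerBlDl; apply: spec_sup_le.
  by rewrite rsD hermD opprD addrACA; exact: posD.
rewrite mulrC -ler_pdivrMr //; apply: le_spec_sup => u hu; rewrite ler_pdivrMr // mulrC.
apply: spec_sup_le; rewrite hermZ -scaleRrs -scalerBr; apply: posZ => //; exact: ltW.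
Qed.

Lemma spec_sup_pos x : pos x -> spec_sup x = cnorm x.
Proof.
move=> px; have sx := px.1; apply/le_anti/andP; split.
  by apply: spec_sup_le; rewrite herm_id //; exact: pos_norm_sub.
apply: le_spec_sup => u; rewrite herm_id // => hu.
have u0 : 0 <= u by have := posD hu px; rewrite subrK => /pos_rs_ge0.
by apply: pos_between => //; apply: posD => //; exact: pos_rs.
Qed.

(** Hahn-Banach for [spec_sup] gives a real functional [f] with the right value at [star b * b].
    Domination by [spec_sup] kills elements with zero real part, makes [f] nonnegative on each
    [star x * x], and normalizes [f 1]. *)
Theorem exists_state b : exists2 F, state F & F (star b * b) = (cnorm b ^+ 2)%:C.
Proof.
have [f [fD fZ fp fb]] := hahn_banach (star b * b) sublinear_spec_sup.
have f0 x : herm x = 0 -> f x = 0.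
  move=> hx; have le0 y : herm y = 0 -> f y <= 0.
    move=> hy; apply: le_trans (fp y) _; apply: spec_sup_le.
    by rewrite hy subr0; exact: pos_rs.
  apply/le_anti; rewrite le0 //=.
  have := fZ (-1) x; rewrite mulN1r => h; rewrite -oppr_le0 -h; apply: le0.
  by rewrite hermZ hx scaler0.
have fpos x : 0 <= f (star x * x).
  have := fZ (-1) (star x * x); rewrite mulN1r => h; rewrite -oppr_le0 -h.
  apply: le_trans (fp _) _; apply: spec_sup_le.
  have px := pos_star_mul x; rewrite hermZ herm_id; last exact: px.1.
  by rewrite rmorphN1 scaleN1r opprK rs0 add0r.
have ci : ('i%C : R[i])^*%R = - 'i%C by apply/eqP; rewrite eq_complex /= oppr0 !eqxx.
have fi x : star x = x -> f ('i%C *: x) = 0.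
  move=> sx; apply: f0; rewrite /herm starZ ci sx -scalerDl subrr scale0r scaler0 //.
have cE c : c = (complex.Re c)%:C + 'i%C * (complex.Im c)%:C by exact: complexE.
have fzc c x : f (c *: x) = complex.Re c * f x + complex.Im c * f ('i%C *: x).
  by rewrite {1}[c]cE scalerDl fD fZ ['i%C * _]mulrC -scalerA fZ.
have ii : 'i%C * 'i%C = -1 :> R[i] by rewrite -expr2 sqr_i.
have fii x : f ('i%C *: ('i%C *: x)) = - f x.
  by rewrite scalerA ii; have := fZ (-1) x; rewrite rmorphN1 mulN1r.
(* The complex linear functional whose real part is [f]. *)
exists (fun x => f x +i* (- f ('i%C *: x)))%C; last first.
  rewrite fi; last by rewrite starM starK.
  by rewrite oppr0 fb spec_sup_pos ?cnorm_star //; exact: pos_star_mul.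
split.
- move=> c x y; rewrite scalerDr !fD fzc.
  have -> : 'i%C *: (c *: x) = c *: ('i%C *: x) by rewrite !scalerA (mulrC c).
  rewrite fzc fii; move: (f x) (f y) (f ('i%C *: x)) (f ('i%C *: y)) => a e u v.
  by case: c => r d; simpc; congr Complex; rewrite /=; ring.
- move=> x; rewrite fi; last by rewrite starM starK.
  by rewrite oppr0 ler0c.
rewrite fi ?star1 // oppr0.
suff -> : f 1 = 1 by [].
have s1 : herm 1 = 1 by rewrite herm_id // star1.
apply/le_anti/andP; split.
  by apply: le_trans (fp _) _; apply: spec_sup_le; rewrite s1 rs1 subrr -rs0; exact: pos_rs.
have := fZ (-1) 1; rewrite mulN1r => h; rewrite -lerN2 -h.
apply: le_trans (fp _) _; apply: spec_sup_le.
by rewrite hermZ s1 rmorphN1 scaleN1r opprK rsN rs1 addNr -rs0; exact: pos_rs.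
Qed.

End States.

(** * Ultraproducts *)

Record freeultra (R : realType) := FreeUltra {
  ufilter : set_system R;
  ufilter_ultra : UltraFilter ufilter;
  ufilter_pinfty : pinfty_nbhs R `<=` ufilter
}.

Section UltraLimits.
Variables (R : realType) (w : freeultra R).

#[global] Instance ufilter_proper : ProperFilter (ufilter w).
Proof. exact: (@ultra_proper _ _ (ufilter_ultra w)). Qed.

Lemma ufilter_ge (n : R) : ufilter w [set t | n <= t].
Proof. by apply: ufilter_pinfty; exists n; split; [exact: num_real | move=> t /= /ltW]. Qed.

Lemma ulim_exists (h : R -> R) (M : R) : (forall t, `|h t| <= M) ->
  exists l : R, h @ ufilter w --> l.
Proof.
move=> hM.
have hF : (h @ ufilter w) `[- M, M]%classic.
  apply: (@filterE _ (ufilter w)) => t; have := hM t; rewrite ler_norml.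
  by rewrite /= in_itv.
have [l [_ cl]] := @segment_compact R (- M) M (h @ ufilter w) _ hF.
exists l => U Ul.
have := in_ultra_setVsetC (h @^-1` U) (ufilter_ultra w) => -[//|hC].
by have [x [nx Ux]] := cl (~` U) U hC Ul.
Qed.

End UltraLimits.

Lemma freeultra_exists (R : realType) : inhabited (freeultra R).
Proof.
have [G [uG sG]] := ultraFilterLemma (@proper_pinfty_nbhs R).
by exists; exact: (FreeUltra uG sG).
Qed.

(** The way back from ultrapowers to [+oo]. If [S] were not a neighbourhood of [+oo], the complement
    of [S] and the neighbourhoods of [+oo] would generate a proper filter, and an ultrafilter above
    it would contain both [S] and its complement. *)
Lemma freeultra_near (R : realType) (S : set R) :
  (forall w : freeultra R, ufilter w S) -> pinfty_nbhs R S.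
Proof.
move=> hS; apply: contrapT => nS.
pose F : set_system R := [set P | exists2 Q, pinfty_nbhs R Q & Q `&` ~` S `<=` P].
have FF : ProperFilter F.
  split.
    move=> [Q hQ QS]; apply: nS; apply: filterS hQ => t Qt.
    by apply: contrapT => nSt; exact: (QS t).
  split.
  - by exists setT => //; exact: filterT.
  - move=> P P' [Q hQ QP] [Q' hQ' QP']; exists (Q `&` Q'); first exact: filterI.
    by move=> t [[Qt Q't] nt]; split; [apply: QP | apply: QP'].
  - by move=> P P' PP' [Q hQ QP]; exists Q => // t /QP /PP'.
have [G [uG sG]] := ultraFilterLemma FF.
have pG : pinfty_nbhs R `<=` G by move=> Q hQ; apply: sG; exists Q => // t [].
have GS := hS (FreeUltra uG pG).
have GnS : G (~` S) by apply: sG; exists setT; [exact: filterT | move=> t []].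
have pf : ProperFilter G := @ultra_proper _ _ uG.
by have [t [St nSt]] := filter_ex (filterI GS GnS).
Qed.

(** A seminorm passed as data lets one ultraproduct construction serve pre-Hilbert spaces, operators
    on them and [A] itself; null vectors vanish in the quotient. *)
Record seminorm (R : realType) (V : lmodType R[i]) := Seminorm {
  sn :> V -> R;
  snD : forall x y, sn (x + y) <= sn x + sn y;
  snZ : forall (c : R[i]) x, (sn (c *: x))%:C = `|c| * (sn x)%:C
}.

Section SeminormTheory.
Variables (R : realType) (V : lmodType R[i]) (N : seminorm V).
Implicit Types (x y : V).

Lemma sn0 : N 0 = 0.
Proof. by apply: complexI; have := snZ N 0 0; rewrite scaler0 normr0 mul0r. Qed.

Lemma snN x : N (- x) = N x.
Proof. by apply: complexI; have := snZ N (-1) x; rewrite scaleN1r normrN1 mul1r. Qed.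

Lemma sn_ge0 x : 0 <= N x.
Proof. by have := snD N x (- x); rewrite subrr sn0 snN -mulr2n pmulrn_lge0. Qed.

Lemma snBC x y : N (x - y) = N (y - x).
Proof. by rewrite -snN opprB. Qed.

Lemma ler_snB x y : `|N x - N y| <= N (x - y).
Proof.
rewrite ler_norml; apply/andP; split.
  have := snD N (y - x) x; rewrite subrK snBC => h; lra.
by have := snD N (x - y) y; rewrite subrK => h; lra.
Qed.

End SeminormTheory.

Definition complex_norm (R : realType) (c : R[i]) : R := complex.Re `|c|.

Lemma complex_normE (R : realType) (c : R[i]) : (complex_norm c)%:C = `|c|.
Proof. by rewrite /complex_norm normc_def. Qed.

Section BoundedFunctions.
Variables (R : realType) (V : lmodType R[i]) (N : seminorm V).

Definition ubnd : {pred (R -> V)} := fun f => `[< exists M : R, forall t, N (f t) <= M >].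

Lemma ubndP (f : R -> V) : reflect (exists M : R, forall t, N (f t) <= M) (f \in ubnd).
Proof. exact: asboolP. Qed.

Lemma ubnd_submod : submod_closed ubnd.
Proof.
split; first by apply/ubndP; exists 0 => t; rewrite sn0.
move=> c f g /ubndP[M hM] /ubndP[M' hM']; apply/ubndP.
exists (complex_norm c * M + M') => t; apply: le_trans (snD _ _ _) _; apply: lerD => //.
rewrite -lecR snZ rmorphM /= complex_normE; apply: ler_wpM2l => //.
by rewrite lecR.
Qed.
HB.instance Definition _ := GRing.isSubmodClosed.Build R[i] (R -> V) ubnd ubnd_submod.

Record bfun := BFun { bval :> R -> V; _ : bval \in ubnd }.
HB.instance Definition _ := [isSub for bval].
HB.instance Definition _ := [Choice of bfun by <:].
HB.instance Definition _ := [SubChoice_isSubLmodule of bfun by <:].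

Variable w : freeultra R.

Definition unull : {pred bfun} := fun f => `[< N (bval f t) @[t --> ufilter w] --> (0 : R) >].

Lemma unull_submod : submod_closed unull.
Proof.
split.
  apply/asboolP; have -> : (fun t => N (bval 0 t)) = (fun=> 0).
    by apply/funext => t; rewrite sn0.
  exact: cvg_cst.
move=> c f g /asboolP hf /asboolP hg; apply/asboolP.
have h0 : complex_norm c * N (bval f t) + N (bval g t) @[t --> ufilter w] --> (0 : R).
  have -> : (0 : R) = complex_norm c * 0 + 0 by rewrite mulr0 addr0.
  by apply: cvgD => //; apply: cvgM => //; exact: cvg_cst.
apply: (squeeze_cvgr _ (cvg_cst 0) h0); apply: nearW => t; rewrite sn_ge0 /=.
apply: le_trans (snD _ _ _) _; rewrite lerD2r.
by rewrite -lecR snZ rmorphM /= complex_normE.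
Qed.
HB.instance Definition _ := GRing.isSubmodClosed.Build R[i] bfun unull unull_submod.

Definition uprod := Quotient.quot unull.
HB.instance Definition _ := GRing.Zmodule.on uprod.
HB.instance Definition _ := EqQuotient.on uprod.

End BoundedFunctions.

Section UltraproductModule.
Variables (R : realType) (V : lmodType R[i]) (N : seminorm V) (w : freeultra R).
Local Open Scope quotient_scope.
Notation U := (uprod N w).
Implicit Types (f g : R -> V) (x y : U).

(** Unbounded functions are sent to [0], which makes the class [ucl] a total function. *)
Definition bfun_of f : bfun N := insubd (0 : bfun N) f.

Lemma bfun_ofE f : f \in ubnd N -> bval (bfun_of f) = f.
Proof. by move=> hf; rewrite /bfun_of insubdK. Qed.

Definition ucl f : U := \pi_U (bfun_of f).
Definition urep x : R -> V := bval (repr x).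

Lemma urep_bnd x : urep x \in ubnd N.
Proof. exact: (valP (repr x)). Qed.

Lemma ureprK x : ucl (urep x) = x.
Proof.
rewrite /ucl /urep -[RHS]reprK; congr (\pi_U _); apply: val_inj.
by rewrite /= bfun_ofE //; exact: (valP (repr x)).
Qed.

Lemma ucl_eq f g : f \in ubnd N -> g \in ubnd N ->
  N (f t - g t) @[t --> ufilter w] --> (0 : R) -> ucl f = ucl g.
Proof.
move=> hf hg h; apply/eqP; rewrite /ucl piE; apply/asboolP.
by rewrite /= !bfun_ofE.
Qed.

Lemma ucl_eq_cvg f g : f \in ubnd N -> g \in ubnd N ->
  ucl f = ucl g -> N (f t - g t) @[t --> ufilter w] --> (0 : R).
Proof.
move=> hf hg /eqP; rewrite /ucl piE => /asboolP.
by rewrite /= !bfun_ofE.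
Qed.

Lemma ubndD f g : f \in ubnd N -> g \in ubnd N -> (fun t => f t + g t) \in ubnd N.
Proof. exact: rpredD. Qed.

Lemma ubndB f g : f \in ubnd N -> g \in ubnd N -> (fun t => f t - g t) \in ubnd N.
Proof. exact: rpredB. Qed.

Lemma ubndZ (c : R[i]) f : f \in ubnd N -> (fun t => c *: f t) \in ubnd N.
Proof. exact: rpredZ. Qed.

Lemma ubnd_cst (v : V) : (fun=> v) \in ubnd N.
Proof. by apply/ubndP; exists (N v). Qed.

Lemma ucl_add f g : f \in ubnd N -> g \in ubnd N ->
  ucl (fun t => f t + g t) = ucl f + ucl g.
Proof.
move=> hf hg; transitivity (\pi_U (bfun_of f + bfun_of g)); last exact: Quotient.pi_add.
congr (\pi_U _); apply: val_inj.
by rewrite /= !bfun_ofE //; exact: ubndD.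
Qed.

Lemma ucl_opp f : f \in ubnd N -> ucl (fun t => - f t) = - ucl f.
Proof.
move=> hf; transitivity (\pi_U (- bfun_of f)); last exact: Quotient.pi_opp.
congr (\pi_U _); apply: val_inj.
by rewrite /= !bfun_ofE //; rewrite -[X in X \in _]/(- f) rpredN.
Qed.

Lemma ucl0 : ucl (fun=> 0) = 0.
Proof.
have h := ubnd_cst 0; apply: (addrI (ucl (fun=> 0))); rewrite addr0 -ucl_add //.
by congr ucl; apply/funext => t; rewrite addr0.
Qed.

Definition uscale (c : R[i]) x : U := ucl (fun t => c *: urep x t).

Lemma ucl_urep f : f \in ubnd N ->
  N (urep (ucl f) t - f t) @[t --> ufilter w] --> (0 : R).
Proof.
by move=> hf; apply: ucl_eq_cvg => //; [exact: urep_bnd | exact: ureprK].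
Qed.

Lemma ucl_scale (c : R[i]) f : f \in ubnd N -> ucl (fun t => c *: f t) = uscale c (ucl f).
Proof.
move=> hf; apply: ucl_eq; rewrite ?ubndZ ?urep_bnd //.
have -> : (fun t => N (c *: f t - c *: urep (ucl f) t)) =
          (fun t => complex_norm c * N (urep (ucl f) t - f t)).
  apply/funext => t; rewrite -scalerBr snBC; apply: complexI.
  by rewrite snZ rmorphM /= complex_normE.
have -> : (0 : R) = complex_norm c * 0 by rewrite mulr0.
by apply: cvgM; [exact: cvg_cst | exact: ucl_urep].
Qed.

Lemma uscaleA a b x : uscale a (uscale b x) = uscale (a * b) x.
Proof.
rewrite -[x]ureprK -!ucl_scale ?ubndZ ?urep_bnd //.
by congr ucl; apply/funext => t; rewrite scalerA.
Qed.

Lemma uscale1 : left_id 1 uscale.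
Proof.
move=> x; rewrite -[x]ureprK -ucl_scale ?urep_bnd //.
by congr ucl; apply/funext => t; rewrite scale1r.
Qed.

Lemma uscaleDr : right_distributive uscale +%R.
Proof.
move=> c x y; rewrite -[x]ureprK -[y]ureprK.
rewrite -!(ucl_scale, ucl_add) ?(ubndZ, ubndD, urep_bnd) //.
by congr ucl; apply/funext => t; rewrite scalerDr.
Qed.

Lemma uscaleDl x : {morph uscale^~ x : a b / a + b}.
Proof.
move=> a b; rewrite -[x]ureprK -!(ucl_scale, ucl_add) ?(ubndZ, ubndD, urep_bnd) //.
by congr ucl; apply/funext => t; rewrite scalerDl.
Qed.

HB.instance Definition _ := GRing.Zmodule_isLmodule.Build R[i] U
  uscaleA uscale1 uscaleDr uscaleDl.

Lemma uclZ (c : R[i]) f : f \in ubnd N -> ucl (fun t => c *: f t) = c *: ucl f.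
Proof. exact: ucl_scale. Qed.

Lemma unorm_exists f : f \in ubnd N -> exists l : R, N (f t) @[t --> ufilter w] --> l.
Proof.
move=> /ubndP[M hM]; apply: (@ulim_exists _ w _ M) => t.
by rewrite ger0_norm ?sn_ge0.
Qed.

(** The default [0] is never taken, since a bounded real function has a limit along an
    ultrafilter. *)
Definition unorm x : R := xget 0 [set l : R | N (urep x t) @[t --> ufilter w] --> l].

Lemma unorm_urep x : N (urep x t) @[t --> ufilter w] --> unorm x.
Proof.
have [l hl] := unorm_exists (urep_bnd x).
exact: (@xgetPex R 0 [set l : R | N (urep x t) @[t --> ufilter w] --> l] (ex_intro _ l hl)).
Qed.
Arguments unorm_urep x : clear implicits.

Lemma unorm_cvg f : f \in ubnd N -> N (f t) @[t --> ufilter w] --> unorm (ucl f).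
Proof.
move=> hf; have h0 := ucl_urep hf; have h1 := unorm_urep (ucl f).
have [l hl] := unorm_exists hf.
suff -> : unorm (ucl f) = l by [].
apply/eqP; rewrite -subr_eq0 -normr_eq0; apply/eqP.
have h2 : `|N (urep (ucl f) t) - N (f t)| @[t --> ufilter w] --> `|unorm (ucl f) - l|.
  by apply: cvg_norm; exact: cvgB.
have h3 : `|N (urep (ucl f) t) - N (f t)| @[t --> ufilter w] --> (0 : R).
  apply: (squeeze_cvgr _ (cvg_cst 0) h0).
  by apply: nearW => t; rewrite normr_ge0 ler_snB.
exact: (cvg_unique _ h2 h3).
Qed.

Lemma unormP f (l : R) : f \in ubnd N -> N (f t) @[t --> ufilter w] --> l -> unorm (ucl f) = l.
Proof. by move=> /unorm_cvg h hl; exact: (cvg_unique _ h hl). Qed.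

Lemma unorm_le f (c : R) : f \in ubnd N -> (\forall t \near ufilter w, N (f t) <= c) ->
  unorm (ucl f) <= c.
Proof. by move=> /unorm_cvg h hc; exact: (cvgr_to_le h). Qed.

Lemma unormD x y : unorm (x + y) <= unorm x + unorm y.
Proof.
rewrite -{1}[x]ureprK -{1}[y]ureprK -ucl_add ?urep_bnd //.
have h := unorm_cvg (ubndD (urep_bnd x) (urep_bnd y)).
apply: (ler_cvg_to h (cvgD (unorm_urep x) (unorm_urep y))).
by apply: nearW => t; exact: snD.
Qed.

Lemma unormZ (c : R[i]) x : (unorm (c *: x))%:C = `|c| * (unorm x)%:C.
Proof.
rewrite -complex_normE -rmorphM; congr (_%:C).
rewrite -{1}[x]ureprK -uclZ ?urep_bnd //; apply: unormP; first by rewrite ubndZ ?urep_bnd.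
have -> : (fun t => N (c *: urep x t)) = (fun t => complex_norm c * N (urep x t)).
  by apply/funext => t; apply: complexI; rewrite snZ rmorphM /= complex_normE.
by apply: cvgM; [exact: cvg_cst | exact: unorm_urep].
Qed.

Lemma unorm0_eq0 x : unorm x = 0 -> x = 0.
Proof.
move=> h; rewrite -[x]ureprK -ucl0; apply: ucl_eq; rewrite ?urep_bnd ?ubnd_cst //.
by have := unorm_urep x; rewrite h; under eq_fun do rewrite -[urep x _]subr0.
Qed.

Definition unormC x : R[i] := (unorm x)%:C.

Lemma unormCD x y : unormC (x + y) <= unormC x + unormC y.
Proof. by rewrite -rmorphD lecR unormD. Qed.

Lemma unormCZ (c : R[i]) x : unormC (c *: x) = `|c| * unormC x.
Proof. exact: unormZ. Qed.

Lemma unormC0_eq0 x : unormC x = 0 -> x = 0.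
Proof. by move=> /complexI /unorm0_eq0. Qed.

HB.instance Definition _ := Lmodule_isNormed.Build R[i] U unormCD unormCZ unormC0_eq0.

Lemma uprod_normE x : `|x| = (unorm x)%:C.
Proof. by []. Qed.

End UltraproductModule.

Lemma filter_forall_lt (T : Type) (F : set_system T) n (P : nat -> set T) : Filter F ->
  (forall i, (i < n)%N -> F (P i)) -> F [set t | forall i, (i < n)%N -> P i t].
Proof.
move=> FF; elim: n => [|n ih] h; first by apply: filterE => t i.
apply: filterS2 (ih _) (h n (ltnSn n)) => [t h1 h2 i|i ni].
  by rewrite ltnS leq_eqVlt => /orP[/eqP->|/h1].
by apply: h; exact: ltnW.
Qed.

Section UltraproductComplete.
Variables (R : realType) (V : lmodType R[i]) (N : seminorm V) (w : freeultra R).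
Notation U := (uprod N w).
Implicit Types (x y : U).

Lemma unorm_trans y x z : unorm (x - z) <= unorm (x - y) + unorm (y - z).
Proof. by rewrite -[x - z](subrKA y); exact: unormD. Qed.

Lemma uprod_entourageP (P : set (U * U)) : entourage P <->
  exists2 e : R, 0 < e & forall x y, unorm (x - y) < e -> P (x, y).
Proof.
rewrite -entourage_ballE; split.
  move=> [e /= e0 he].
  have eE : e = (complex.Re e)%:C by rewrite RRe_real // realE ltW.
  exists (complex.Re e) => [|x y h]; first by rewrite -ltcR -eE.
  apply: he; rewrite /= -ball_normE /ball_ /= uprod_normE eE ltcR //.
move=> [e e0 he]; exists e%:C => /=; first by rewrite ltcR.
by move=> [x y] /=; rewrite -ball_normE /ball_ /= uprod_normE ltcR => /he.
Qed.

(* Diagonal argument: the limit of a fast Cauchy sequence is represented by the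
   function that follows the n-th representative from time [T n] on. *)
Lemma uprod_fast_cvg (x : nat -> U) :
  (forall n m, (n <= m)%N -> unorm (x m - x n) < 2^-1 ^+ n) ->
  exists l : U, forall n, unorm (l - x n) <= 2^-1 ^+ n.
Proof.
move=> hx; pose f n := urep (x n).
(* The condition [n%:R <= t] leaves each [t] in finitely many [S n] only; the largest such index is
   the [k t] chosen below. *)
pose S n := [set t : R | n%:R <= t /\
   forall i j, (i <= j)%N -> (j <= n)%N -> N (f j t - f i t) <= 2^-1 ^+ i].
have wS n : ufilter w (S n).
  apply: filterI; first exact: ufilter_ge.
  have hij i j : (i <= j)%N -> ufilter w [set t | N (f j t - f i t) <= 2^-1 ^+ i].
    move=> ij; have h := @unorm_cvg _ _ _ w _ (ubndB (urep_bnd (x j)) (urep_bnd (x i))).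
    have hl : unorm (ucl N w (fun t => urep (x j) t - urep (x i) t)) < 2^-1 ^+ i.
      apply: le_lt_trans (hx i j ij).
      have -> // : ucl N w (fun t => urep (x j) t - urep (x i) t) = x j - x i.
      rewrite ucl_add ?urep_bnd //; last by rewrite -[X in X \in _]/(- urep (x i)) rpredN urep_bnd.
      by rewrite ucl_opp ?urep_bnd // !ureprK.
    by move/cvgr_lt: h => /(_ _ hl); apply: filterS => t /ltW.
  have h : ufilter w [set t | forall i, (i < n.+1)%N ->
      forall j, (j < n.+1)%N -> (i <= j)%N -> N (f j t - f i t) <= 2^-1 ^+ i].
    apply: filter_forall_lt => i _; apply: filter_forall_lt => j _.
    have [ij|ij] := boolP (i <= j)%N; last by apply: filterE => t.
    by apply: filterS (hij i j ij).
  apply: filterS h => t h i j ij jn; apply: h => //; exact: leq_ltn_trans ij _.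
have Sdec n m t : (n <= m)%N -> S m t -> S n t.
  move=> nm [mt h]; split; first by apply: le_trans mt; rewrite ler_nat.
  by move=> i j ij jn; apply: h => //; exact: leq_trans nm.
have exK t : exists K : nat, forall n, S n t -> (n <= K)%N.
  exists (Num.bound `|t|) => n [nt _].
  rewrite -(ler_nat R); apply: (le_trans nt); apply: (le_trans (ler_norm t)).
  by apply/ltW/archi_boundP.
have exm t : exists k : nat, (S 0%N t -> S k t) /\ forall n, S n t -> (n <= k)%N.
  have [K hK] := exK t; have [S0|nS0] := pselect (S 0%N t); last first.
    by exists 0%N; split => // n Sn; case: nS0; apply: Sdec Sn.
  have hb : forall n, `[< S n t >] -> (n <= K)%N by move=> n /asboolP /hK.
  have [k /asboolP Sk hk] := ex_maxnP (ex_intro _ 0%N (asboolT S0)) hb.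
  by exists k; split=> // n Sn; apply: hk; apply/asboolP.
have [k hk] := choice exm.
pose g t : V := f (k t) t.
have gP n t : S n t -> N (g t - f n t) <= 2^-1 ^+ n.
  move=> Sn; have [h0 h1] := hk t; have Sk : S (k t) t by apply: h0; apply: Sdec Sn.
  by have [_] := Sk; apply => //; exact: h1.
have [M0 hM0] := elimT (ubndP _ _) (urep_bnd (x 0%N)).
(* On [S 0] the function stays within [1] of a bounded representative of [x 0]; elsewhere [0] keeps
   it bounded. *)
pose g0 t := if `[< S 0%N t >] then g t else 0.
have g0b : g0 \in ubnd N.
  apply/ubndP; exists (1 + `|M0|) => t; rewrite /g0; case: asboolP => [S0|_]; last first.
    by rewrite sn0 addr_ge0.
  rewrite -[g t](subrK (f 0%N t)); apply: le_trans (snD _ _ _) _; apply: lerD.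
    by apply: le_trans (gP _ _ S0) _; rewrite expr0.
  exact: le_trans (hM0 t) (ler_norm _).
exists (ucl N w g0) => n; rewrite -{1}[x n]ureprK -ucl_opp ?urep_bnd //.
have nb : (fun t => - urep (x n) t) \in ubnd N.
  by rewrite -[X in X \in _]/(- urep (x n)) rpredN urep_bnd.
rewrite -ucl_add //; apply: unorm_le; first exact: ubndD.
apply: filterS (wS n) => t Sn; rewrite /g0; case: asboolP => [_|nS0].
  exact: gP.
by case: nS0; exact: Sdec Sn.
Qed.

Lemma uprod_complete (F : set_system U) : ProperFilter F -> cauchy F -> exists l : U, F --> l.
Proof.
move=> FF cF.
have hn n : exists P : set U, F P /\ forall x y, P x -> P y -> unorm (x - y) < 2^-1 ^+ n.
  have /cF[[P Q] /= [FP FQ] PQ] : entourage [set xy : U * U | unorm (xy.1 - xy.2) < 2^-1 ^+ n].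
    by apply/uprod_entourageP; exists (2^-1 ^+ n) => //; rewrite exprn_gt0 // invr_gt0.
  exists (P `&` Q); split; first exact: filterI.
  by move=> x y [Px _] [_ Qy]; exact: (PQ (x, y)).
have [P hP] := choice hn.
(* Finite intersections make a point chosen at stage [m] lie in every earlier [P n], so the chosen
   points form a fast Cauchy sequence. *)
pose Q n := [set y | forall i, (i < n.+1)%N -> P i y].
have FQ n : F (Q n).
  by apply: filter_forall_lt => i _; exact: (hP i).1.
have [x hx] := choice (fun n => filter_ex (FQ n)).
have xd n m : (n <= m)%N -> unorm (x m - x n) < 2^-1 ^+ n.
  move=> nm; apply: (hP n).2; first by apply: (hx m n); rewrite ltnS.
  by apply: (hx n n) => /=.
have [l hl] := uprod_fast_cvg xd.
exists l => A; rewrite -nbhs_entourageE => -[E /uprod_entourageP[e e0 hE] hA].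
have [n he] : exists n, 2 * 2^-1 ^+ n < e.
  have : (fun n => 2 * (2^-1 : R) ^+ n) @ \oo --> (0 : R).
    have -> : (0 : R) = 2 * 0 by rewrite mulr0.
    apply: cvgM; [exact: cvg_cst | apply: cvg_expr].
    by rewrite ger0_norm // invf_lt1 // ltr1n.
  move/cvgr_lt => /(_ _ e0) [n _ hn']; exists n; exact: (hn' n (leqnn n)).
apply: filterS (FQ n) => y Qy; apply: hA; apply/xsectionP; apply: hE.
apply: le_lt_trans (unorm_trans (x n) _ _) _; apply: le_lt_trans he.
rewrite mulrDl mul1r; apply: lerD => //; apply: ltW; apply: (hP n).2.
  by apply: (hx n n) => /=.
by apply: (Qy n) => /=.
Qed.

Lemma uprod_cauchy_cvg (F : set_system U) : ProperFilter F -> cauchy F -> cvg F.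
Proof. by move=> FF /uprod_complete[l hl]; apply/cvg_ex; exists l. Qed.

HB.instance Definition _ := Uniform_isComplete.Build U uprod_cauchy_cvg.

End UltraproductComplete.

Section ComplexUltraLimits.
Variables (R : realType) (w : freeultra R).
Implicit Types (h g : R -> R[i]) (c : R[i]).

Definition cbnd h := exists M : R, forall t, `|h t| <= M%:C.

Definition ulim (h : R -> R) : R := xget 0 [set l : R | h @ ufilter w --> l].
Definition ulimC h : R[i] :=
  (ulim (fun t => complex.Re (h t)) +i* ulim (fun t => complex.Im (h t)))%C.

Lemma ulimP (h : R -> R) (l : R) : h @ ufilter w --> l -> ulim h = l.
Proof.
move=> hl; have := @xgetPex R 0 [set l : R | h @ ufilter w --> l] (ex_intro _ l hl).
by move=> hl'; exact: (cvg_unique _ hl' hl).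
Qed.

Lemma ulimCP h c : (fun t => complex.Re (h t)) @ ufilter w --> complex.Re c ->
  (fun t => complex.Im (h t)) @ ufilter w --> complex.Im c -> ulimC h = c.
Proof. by move=> /ulimP h1 /ulimP h2; rewrite /ulimC h1 h2; case: c {h1 h2}. Qed.

Lemma normc_ge_Im c : `|complex.Im c|%:C <= `|c|.
Proof.
case: c => a b; rewrite normc_def /= lecR -sqrtr_sqr ler_sqrt ?addr_ge0 ?sqr_ge0 //.
by rewrite lerDr sqr_ge0.
Qed.

Lemma complex_ReB c (d : R[i]) : complex.Re (c - d) = complex.Re c - complex.Re d.
Proof. by case: c d => a b []. Qed.

Lemma complex_ImB c (d : R[i]) : complex.Im (c - d) = complex.Im c - complex.Im d.
Proof. by case: c d => a b []. Qed.

Lemma cvg_ulimRe h : cbnd h -> (fun t => complex.Re (h t)) @ ufilter w --> complex.Re (ulimC h).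
Proof.
move=> [M hM]; have [|l hl] := @ulim_exists _ w (fun t => complex.Re (h t)) M.
  by move=> t; rewrite -lecR; apply: le_trans (hM t); exact: normc_ge_Re.
by rewrite /ulimC /= (ulimP hl).
Qed.

Lemma cvg_ulimIm h : cbnd h -> (fun t => complex.Im (h t)) @ ufilter w --> complex.Im (ulimC h).
Proof.
move=> [M hM]; have [|l hl] := @ulim_exists _ w (fun t => complex.Im (h t)) M.
  by move=> t; rewrite -lecR; apply: le_trans (hM t); exact: normc_ge_Im.
by rewrite /ulimC /= (ulimP hl).
Qed.

Lemma ulimC_linear c h g : cbnd h -> cbnd g ->
  ulimC (fun t => c * h t + g t) = c * ulimC h + ulimC g.
Proof.
move=> bh bg.
have hr := cvg_ulimRe bh; have hi := cvg_ulimIm bh.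
have gr := cvg_ulimRe bg; have gi := cvg_ulimIm bg.
have cst (r : R) : (fun=> r) @ ufilter w --> r by exact: cvg_cst.
apply: ulimCP.
  have -> : (fun t => complex.Re (c * h t + g t)) =
    (fun t => complex.Re c * complex.Re (h t) - complex.Im c * complex.Im (h t) + complex.Re (g t)).
    by apply/funext => t; case: c (h t) (g t) => a b [a' b'] [a'' b'']; simpc.
  have -> : complex.Re (c * ulimC h + ulimC g) =
      complex.Re c * complex.Re (ulimC h) - complex.Im c * complex.Im (ulimC h) + complex.Re (ulimC g).
    by case: c (ulimC h) (ulimC g) => a b [a' b'] [a'' b'']; simpc.
  by apply: cvgD gr; apply: cvgB; apply: cvgM.
have -> : (fun t => complex.Im (c * h t + g t)) =
    (fun t => complex.Re c * complex.Im (h t) + complex.Im c * complex.Re (h t) + complex.Im (g t)).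
  by apply/funext => t; case: c (h t) (g t) => a b [a' b'] [a'' b'']; simpc.
have -> : complex.Im (c * ulimC h + ulimC g) =
      complex.Re c * complex.Im (ulimC h) + complex.Im c * complex.Re (ulimC h) + complex.Im (ulimC g).
  by case: c (ulimC h) (ulimC g) => a b [a' b'] [a'' b'']; simpc.
by apply: cvgD gi; apply: cvgD; apply: cvgM.
Qed.

Lemma ulimC_conj h : cbnd h -> ulimC (fun t => (h t)^*) = (ulimC h)^*.
Proof.
move=> bh; have hr := cvg_ulimRe bh; have hi := cvg_ulimIm bh.
apply: ulimCP.
  have -> : (fun t => complex.Re (h t)^*) = (fun t => complex.Re (h t)).
    by apply/funext => t; case: (h t).
  by move: hr; case: (ulimC h).
have -> : (fun t => complex.Im (h t)^*) = (fun t => - complex.Im (h t)).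
  by apply/funext => t; case: (h t).
have -> : complex.Im (ulimC h)^* = - complex.Im (ulimC h) by case: (ulimC h).
exact: cvgN.
Qed.

Lemma ulimC_real (r : R -> R) (l : R) : r @ ufilter w --> l -> ulimC (fun t => (r t)%:C) = l%:C.
Proof. by move=> hr; apply: ulimCP => //=; exact: cvg_cst. Qed.

Lemma ulimC_ge0 h : cbnd h -> (forall t, 0 <= h t) -> 0 <= ulimC h.
Proof.
move=> bh h0; have hE : h = (fun t => (complex.Re (h t))%:C).
  by apply/funext => t; rewrite RRe_real // realE h0.
rewrite hE (ulimC_real (cvg_ulimRe bh)) ler0c.
apply: (cvgr_to_ge (cvg_ulimRe bh)); apply: nearW => t.
by rewrite -ler0c RRe_real // realE h0.
Qed.

Lemma ulimC_eq h g (r : R -> R) : cbnd h -> cbnd g -> (forall t, `|h t - g t| <= (r t)%:C) ->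
  r @ ufilter w --> (0 : R) -> ulimC h = ulimC g.
Proof.
move=> bh bg hr r0.
have z (k : R -> R) (l : R) : k @ ufilter w --> l -> (forall t, `|k t| <= r t) -> l = 0.
  move=> kl kr; have k0 : k @ ufilter w --> (0 : R).
    apply/cvgr0Pnorm_lt => e e0; move/cvgr0Pnorm_lt : r0 => /(_ e e0).
    by apply: filterS => t; apply: le_lt_trans; apply: le_trans (kr t) (ler_norm _).
  exact: (cvg_unique _ kl k0).
apply/eqP; rewrite eq_complex; apply/andP; split; rewrite -subr_eq0; apply/eqP.
  apply: (z _ _ (cvgB (cvg_ulimRe bh) (cvg_ulimRe bg))) => t.
  rewrite -lecR; apply: le_trans (hr t); apply: le_trans (normc_ge_Re _).
  by rewrite complex_ReB.
apply: (z _ _ (cvgB (cvg_ulimIm bh) (cvg_ulimIm bg))) => t.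
rewrite -lecR; apply: le_trans (hr t); apply: le_trans (normc_ge_Im _).
by rewrite complex_ImB.
Qed.

End ComplexUltraLimits.

Record preinner (R : realType) (V : lmodType R[i]) := PreInner {
  pin :> V -> V -> R[i];
  pin_linear : forall (c : R[i]) x y z, pin (c *: x + y) z = c * pin x z + pin y z;
  pin_conj : forall x y, pin y x = (pin x y)^*;
  pin_ge0 : forall x, 0 <= pin x x
}.

Section PreInnerTheory.
Variables (R : realType) (V : lmodType R[i]) (I : preinner V).
Implicit Types (x y z : V) (c : R[i]).

Lemma pinDl x y z : I (x + y) z = I x z + I y z.
Proof. by have := pin_linear I 1 x y z; rewrite scale1r mul1r. Qed.

Lemma pin0l z : I 0 z = 0.
Proof. by apply: (addrI (I 0 z)); rewrite addr0 -pinDl addr0. Qed.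

Lemma pinZl c x z : I (c *: x) z = c * I x z.
Proof. by have := pin_linear I c x 0 z; rewrite addr0 pin0l addr0. Qed.

Lemma pinNl x z : I (- x) z = - I x z.
Proof. by rewrite -scaleN1r pinZl mulN1r. Qed.

Lemma pinBl x y z : I (x - y) z = I x z - I y z.
Proof. by rewrite pinDl pinNl. Qed.

Lemma pinDr x y z : I z (x + y) = I z x + I z y.
Proof. by rewrite pin_conj pinDl rmorphD /= -!pin_conj. Qed.

Lemma pinZr c x z : I z (c *: x) = c^* * I z x.
Proof. by rewrite pin_conj pinZl rmorphM /= -pin_conj. Qed.

Lemma pinNr x z : I z (- x) = - I z x.
Proof. by rewrite pin_conj pinNl rmorphN /= -pin_conj. Qed.

Lemma pinBr x y z : I z (x - y) = I z x - I z y.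
Proof. by rewrite pinDr pinNr. Qed.

Definition pnorm x : R := Num.sqrt (complex.Re (I x x)).

Lemma pinE x : I x x = (complex.Re (I x x))%:C.
Proof. by rewrite RRe_real // realE pin_ge0. Qed.

Lemma Re_pin_ge0 x : 0 <= complex.Re (I x x).
Proof. by rewrite -ler0c -pinE pin_ge0. Qed.

Lemma pnorm_sqr x : (pnorm x ^+ 2)%:C = I x x.
Proof. by rewrite /pnorm sqr_sqrtr ?Re_pin_ge0 // -pinE. Qed.

Lemma pnorm_ge0 x : 0 <= pnorm x.
Proof. exact: sqrtr_ge0. Qed.

(** The form may be degenerate, so [pnorm y = 0] is a case of its own. *)
Lemma cauchy_schwarz x y : `|I x y| <= (pnorm x * pnorm y)%:C.
Proof.
set a := complex.Re (I x x); set b := complex.Re (I y y).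
set k := complex_norm (I x y) ^+ 2.
have kE : I x y * (I x y)^* = k%:C by rewrite -normCK -complex_normE -rmorphXn.
have k0 : 0 <= k by rewrite sqr_ge0.
have rM3 (p q r : R) : (p ^+ 2 * q * r)%:C = p%:C * p%:C * q%:C * r%:C.
  by rewrite expr2 !rmorphM.
(* This is the form evaluated on [x - s <x, y> y]; the optimal choice is [s = b^-1]. *)
have h (s : R) : 0 <= a - 2 * s * k + s ^+ 2 * k * b.
  have := pin_ge0 I (x - (s%:C * I x y) *: y).
  rewrite pinBl !pinBr pinZl !pinZr [I y x]pin_conj rmorphM /=.
  rewrite !pinZl (conjc_real s : (s%:C)^*%R = _).
  rewrite [I x x]pinE [I y y]pinE -/a -/b.
  have -> : s%:C * (I x y)^* * I x y = (s * k)%:C.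
    by rewrite rmorphM /= -kE -mulrA [_^* * _]mulrC.
  have -> : s%:C * I x y * (I x y)^* = (s * k)%:C by rewrite rmorphM /= -kE -mulrA.
  have -> : s%:C * (I x y)^* * (s%:C * I x y * b%:C) = (s ^+ 2 * k * b)%:C.
    by rewrite rM3 -kE; ring.
  rewrite -!rmorphB ler0c => h; apply: le_trans h _; rewrite le_eqVlt; apply/orP; left.
  by apply/eqP; ring.
have a0 : 0 <= a by exact: Re_pin_ge0.
have b0 : 0 <= b by exact: Re_pin_ge0.
have kab : k <= a * b.
  have [bp|b0'] := ltrP 0 b.
    have := h b^-1; rewrite exprVn -(pmulr_lge0 _ bp).
    rewrite mulrDl mulrBl.
    have -> : 2 * b^-1 * k * b = 2 * k by field; rewrite gt_eqF.
    have -> : (b ^+ 2)^-1 * k * b * b = k by field; rewrite gt_eqF.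
    lra.
  have bE : b = 0 by apply/le_anti; rewrite b0 b0'.
  rewrite bE mulr0 leNgt; apply/negP => kp.
  (* For [b = 0] the bound is affine in [s]; this [s] makes it [a - 2 (a + 1)], which is
     negative. *)
  have := h ((a + 1) / k); rewrite bE mulr0 addr0.
  have -> : 2 * ((a + 1) / k) * k = 2 * (a + 1) by field; rewrite gt_eqF.
  lra.
rewrite -complex_normE lecR -ler_sqr ?nnegrE.
- by rewrite exprMn !sqr_sqrtr.
- by rewrite -ler0c complex_normE normr_ge0.
- by rewrite mulr_ge0 ?pnorm_ge0.
Qed.

Lemma pnormD x y : pnorm (x + y) <= pnorm x + pnorm y.
Proof.
rewrite -ler_sqr ?nnegrE ?addr_ge0 ?pnorm_ge0 // -lecR pnorm_sqr.
rewrite pinDl !pinDr -!pnorm_sqr [I y x]pin_conj sqrrD !rmorphD /= -!addrA lerD2l !addrA.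
rewrite lerD2r; have -> : I x y + (I x y)^* = (2 * complex.Re (I x y))%:C.
  by rewrite rmorphM rmorph_nat; exact: addcJ.
rewrite -rmorphD lecR -mulr2n -[X in _ <= X]mulr_natl ler_pM2l //.
apply: le_trans (ler_norm _) _.
by rewrite -lecR; apply: le_trans (normc_ge_Re _) (cauchy_schwarz _ _).
Qed.

Lemma pnormZ c x : (pnorm (c *: x))%:C = `|c| * (pnorm x)%:C.
Proof.
rewrite -complex_normE -rmorphM; congr (_%:C); apply/eqP.
have n0 : 0 <= complex_norm c by rewrite -ler0c complex_normE normr_ge0.
rewrite -(@eqrXn2 _ 2) ?mulr_ge0 ?pnorm_ge0 //; apply/eqP; apply: complexI.
by rewrite pnorm_sqr pinZl pinZr mulrA -normCK exprMn rmorphM /= pnorm_sqr rmorphXn /= complex_normE.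
Qed.

Definition pin_seminorm : seminorm V := Seminorm pnormD pnormZ.

End PreInnerTheory.

(** * Hilbert ultraproducts and the GNS representation *)

Section HilbertUltraproduct.
Variables (R : realType) (V : lmodType R[i]) (I : preinner V) (w : freeultra R).

(** The ultrapower is complete and free of null vectors, so it does the work of separation followed
    by completion in the GNS construction. *)
Definition hprod : Type := uprod (pin_seminorm I) w.
HB.instance Definition _ := CompleteNormedModule.on hprod.

Notation N := (pin_seminorm I).
Implicit Types (x y z : hprod) (f g : R -> V).

Lemma cbnd_pin f g : f \in ubnd N -> g \in ubnd N -> cbnd (fun t => I (f t) (g t)).
Proof.
move=> /ubndP[M hM] /ubndP[M' hM']; exists (`|M| * `|M'|) => t.
apply: le_trans (cauchy_schwarz _ _ _) _; rewrite lecR; apply: ler_pM.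
- exact: pnorm_ge0.
- exact: pnorm_ge0.
- exact: le_trans (hM t) (ler_norm _).
- exact: le_trans (hM' t) (ler_norm _).
Qed.

Definition hinner x y : R[i] := ulimC w (fun t => I (urep x t) (urep y t)).

Lemma hinner_ucl_l f x : f \in ubnd N ->
  hinner (ucl N w f) x = ulimC w (fun t => I (f t) (urep x t)).
Proof.
move=> hf; have hx := urep_bnd x; have [M hM] := elimT (ubndP _ _) hx.
have hu := urep_bnd (ucl N w f).
apply: (@ulimC_eq _ _ _ _ (fun t => N (urep (ucl N w f) t - f t) * `|M|)).
- exact: cbnd_pin.
- exact: cbnd_pin.
- move=> t; rewrite -pinBl; apply: le_trans (cauchy_schwarz _ _ _) _; rewrite lecR.
  by apply: ler_wpM2l; [exact: pnorm_ge0 | exact: le_trans (hM t) (ler_norm _)].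
have -> : (0 : R) = 0 * `|M| by rewrite mul0r.
by apply: cvgM; [exact: ucl_urep | exact: cvg_cst].
Qed.

Lemma hinner_conj x y : hinner y x = (hinner x y)^*.
Proof.
rewrite /hinner -ulimC_conj; last by apply: cbnd_pin; exact: urep_bnd.
by congr ulimC; apply/funext => t; rewrite pin_conj.
Qed.

Lemma hinner_linear (c : R[i]) x y z :
  hinner (c *: x + y) z = c * hinner x z + hinner y z.
Proof.
have hx := urep_bnd x; have hy := urep_bnd y.
rewrite -{1}[x]ureprK -{1}[y]ureprK -uclZ // -ucl_add ?ubndZ //.
rewrite hinner_ucl_l; last by rewrite ubndD ?ubndZ.
rewrite /hinner -ulimC_linear; try by apply: cbnd_pin; rewrite ?urep_bnd.
by congr ulimC; apply/funext => t; rewrite pin_linear.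
Qed.

Lemma hinner_norm x : hinner x x = `|x| ^+ 2.
Proof.
rewrite uprod_normE -rmorphXn /= -(@ulimC_real _ w (fun t => N (urep x t) ^+ 2)).
  by rewrite /hinner; congr ulimC; apply/funext => t; rewrite pnorm_sqr.
rewrite expr2; have h := @unorm_urep _ _ _ _ x.
by under eq_fun do rewrite expr2; apply: cvgM.
Qed.

HB.instance Definition _ := isHilbert.Build R hprod hinner_linear hinner_conj hinner_norm.

Lemma inner_ucl f g : f \in ubnd N -> g \in ubnd N ->
  inner (ucl N w f : hprod) (ucl N w g : hprod) = ulimC w (fun t => I (f t) (g t)).
Proof.
move=> hf hg; rewrite [LHS]hinner_ucl_l //.
have hu := urep_bnd (ucl N w g); have [M hM] := elimT (ubndP _ _) hf.
apply: (@ulimC_eq _ _ _ _ (fun t => `|M| * N (urep (ucl N w g) t - g t))).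
- exact: cbnd_pin.
- exact: cbnd_pin.
- move=> t; rewrite -pinBr; apply: le_trans (cauchy_schwarz _ _ _) _; rewrite lecR.
  by apply: ler_wpM2r; [exact: pnorm_ge0 | exact: le_trans (hM t) (ler_norm _)].
have -> : (0 : R) = `|M| * 0 by rewrite mulr0.
by apply: cvgM; [exact: cvg_cst | exact: ucl_urep].
Qed.

Lemma inner_ucl_cst (u v : V) :
  inner (ucl N w (fun=> u) : hprod) (ucl N w (fun=> v) : hprod) = I u v.
Proof.
rewrite inner_ucl ?ubnd_cst //.
by apply: ulimCP; exact: cvg_cst.
Qed.

End HilbertUltraproduct.

(* The GNS representation of a state, on the ultrapower of the pre-Hilbert space
   [A] with [<x, y> = F (y^* x)]. *)
Section GNS.
Variables (R : realType) (A : cstarAlgType R) (F : A -> R[i]) (hF : state F).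
Variable w : freeultra R.
Implicit Types (x y z a b : A) (c : R[i]).

Let FD x y : F (x + y) = F x + F y.
Proof. by have [h _ _] := hF; have := h 1 x y; rewrite scale1r mul1r. Qed.

Let F0 : F 0 = 0.
Proof. by apply: (addrI (F 0)); rewrite -FD !addr0. Qed.

Let FZ c x : F (c *: x) = c * F x.
Proof. by have [h _ _] := hF; have := h c x 0; rewrite F0 !addr0. Qed.

Let Fge0 x : 0 <= F (star x * x). Proof. by have [] := hF. Qed.

(* Polarization: [F] is real on [x^* x], on [y^* y] and on both sums below. *)
Lemma state_conj x y : F (star x * y) = (F (star y * x))^*.
Proof.
set p := F (star x * y); set q := F (star y * x).
have real z : (F (star z * z))^* = F (star z * z).
  by apply: conj_Creal; rewrite realE Fge0.
have h1 : (p + q)^* = p + q.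
  have := real (x + y); rewrite starD mulrDl !mulrDr !FD -/p -/q.
  set a := F (star x * x); set b := F (star y * y).
  have ra : a^* = a by exact: real.
  have rb : b^* = b by exact: real.
  have -> : a + p + (q + b) = (p + q) + (a + b) by ring.
  have -> (u : R[i]) : (u + (a + b))^* = u^* + (a + b).
    by rewrite rmorphD /=; congr (_ + _); rewrite rmorphD /= ra rb.
  by move=> /addIr.
have ii : 'i%C * 'i%C = -1 :> R[i] by rewrite -expr2 sqr_i.
have ci : ('i%C : R[i])^*%R = - 'i%C by apply/eqP; rewrite eq_complex /= oppr0 !eqxx.
have h2 : ('i%C * (p - q))^* = 'i%C * (p - q).
  have := real (x + 'i%C *: y); rewrite starD starZ ci mulrDl !mulrDr !FD.
  rewrite -!scalerAr -!scalerAl !FZ -/p -/q.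
  set a := F (star x * x); set b := F (star y * y).
  have ra : a^* = a by exact: real.
  have rb : b^* = b by exact: real.
  have -> : a + 'i%C * p + (- 'i%C * q + 'i%C * (- 'i%C * b)) = 'i%C * (p - q) + (a + b).
    by rewrite mulrA mulrN ii; ring.
  have -> (u : R[i]) : (u + (a + b))^* = u^* + (a + b).
    by rewrite rmorphD /=; congr (_ + _); rewrite rmorphD /= ra rb.
  by move=> /addIr; rewrite mulrDr.
have {}h2 : (p - q)^* = - (p - q).
  have i0 : 'i%C != 0 :> R[i] by rewrite eq_complex /= oner_eq0 andbF.
  apply: (mulfI i0); apply: oppr_inj; rewrite mulrN opprK -mulNr.
  by move: h2; rewrite rmorphM /= ci.
have : (p + q)^* - (p - q)^* = (p + q) + (p - q) by rewrite h1 h2 opprK.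
rewrite !(rmorphD, rmorphN) /=.
have -> : p^* + q^* - (p^* - q^*) = 2 * q^* by ring.
have -> : p + q + (p - q) = 2 * p by ring.
by move=> /mulfI -> //; rewrite pnatr_eq0.
Qed.

Definition gns_form x y : R[i] := F (star y * x).

Lemma gns_linear c x y z : gns_form (c *: x + y) z = c * gns_form x z + gns_form y z.
Proof. by rewrite /gns_form mulrDr -scalerAr FD FZ. Qed.

Lemma gns_conj x y : gns_form y x = (gns_form x y)^*.
Proof. exact: state_conj. Qed.

Definition gns_preinner : preinner A := PreInner gns_linear gns_conj Fge0.
Local Notation N := (pin_seminorm gns_preinner).
Local Notation H := (hprod gns_preinner w).

(** For [t = cnorm b ^ 2 + e], the element [1 - t^-1 star b * b] is a square [h^2], and the
    difference of the two sides with [t] in place of [cnorm b ^ 2] is [t F (star (h x) * (h x))]. *)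
Lemma state_mul_le b x : F (star (b * x) * (b * x)) <= (cnorm b ^+ 2)%:C * F (star x * x).
Proof.
have h e : 0 < e -> 0 <= (cnorm b ^+ 2 + e)%:C * F (star x * x) - F (star (b * x) * (b * x)).
  move=> e0; set t := cnorm b ^+ 2 + e.
  have t0 : 0 < t by rewrite ltr_wpDl ?sqr_ge0.
  have sz : star (t^-1%:C *: (star b * b)) = t^-1%:C *: (star b * b) by rewrite starZR starM starK.
  have [|h [sh hh _ _]] := sqrt_one_sub sz.
    rewrite cnormZR gtr0_norm ?invr_gt0 // mulrC ltr_pdivrMr // mul1r cnorm_star.
    by rewrite ltrDl.
  have -> : t%:C * F (star x * x) - F (star (b * x) * (b * x)) = t%:C * F (star (h * x) * (h * x)).
    have -> : star (h * x) * (h * x) = star x * x - t^-1%:C *: (star (b * x) * (b * x)).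
      rewrite !starM sh -mulrA [h * (h * x)]mulrA hh mulrBl mul1r mulrBr; congr (_ - _).
      by rewrite -scalerAl -scalerAr !mulrA.
    rewrite -[- (_ *: _)]scaleN1r FD FZ mulN1r FZ mulrBr; congr (_ - _).
    by rewrite [t%:C * _]mulrA -rmorphM divff ?gt_eqF // mul1r.
  by rewrite mulr_ge0 // ler0c ltW.
have xr : F (star x * x) = (complex.Re (F (star x * x)))%:C.
  by rewrite RRe_real // realE Fge0.
have br : F (star (b * x) * (b * x)) = (complex.Re (F (star (b * x) * (b * x))))%:C.
  by rewrite RRe_real // realE Fge0.
rewrite xr br -rmorphM lecR; apply/ler_addgt0Pr => e e0.
set u := complex.Re _; set v := complex.Re (F (star x * x)).
have v0 : 0 <= v by rewrite -ler0c -xr.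
have v1 : 0 < v + 1 by rewrite ltr_wpDl.
have := h (e / (v + 1)); rewrite divr_gt0 // => /(_ isT).
rewrite xr br -rmorphM -rmorphB ler0c -/u -/v mulrDl.
have : e / (v + 1) * v <= e.
  rewrite -mulrA -[X in _ <= X]mulr1 ler_pM2l // mulrC ler_pdivrMr // mul1r.
  by rewrite lerDl.
lra.
Qed.

Lemma gns_bound b x : N (b * x) <= cnorm b * N x.
Proof.
rewrite -ler_sqr ?nnegrE ?mulr_ge0 ?pnorm_ge0 // exprMn -lecR [X in _ <= X]rmorphM /=.
by rewrite !pnorm_sqr; exact: state_mul_le.
Qed.

Lemma gns_ubnd b (f : R -> A) : f \in ubnd N -> (fun t => b * f t) \in ubnd N.
Proof.
move=> /ubndP[M hM]; apply/ubndP; exists (cnorm b * M) => t.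
by apply: le_trans (gns_bound _ _) _; exact: ler_wpM2l.
Qed.

Definition gns b (x : H) : H := ucl N w (fun t => b * urep x t).

Lemma gns_ucl b (f : R -> A) : f \in ubnd N -> gns b (ucl N w f) = ucl N w (fun t => b * f t).
Proof.
move=> hf; apply: ucl_eq; rewrite ?gns_ubnd ?urep_bnd //.
have h : cnorm b * N (urep (ucl N w f) t - f t) @[t --> ufilter w] --> (0 : R).
  have -> : (0 : R) = cnorm b * 0 by rewrite mulr0.
  by apply: cvgM; [exact: cvg_cst | exact: ucl_urep].
apply: (squeeze_cvgr _ (cvg_cst 0) h); apply: nearW => t.
by rewrite sn_ge0 -mulrBr gns_bound.
Qed.

Lemma gns_rep : hilbert_rep gns.
Proof.
split.
- move=> a c x y; have hx := urep_bnd x; have hy := urep_bnd y.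
  rewrite -{1}[x]ureprK -{1}[y]ureprK -uclZ // -ucl_add ?ubndZ //.
  rewrite gns_ucl; last by rewrite ubndD ?ubndZ.
  rewrite /gns -uclZ ?gns_ubnd // -ucl_add ?ubndZ ?gns_ubnd //.
  by congr ucl; apply/funext => t; rewrite mulrDr -scalerAr.
- move=> a; exists (cnorm a)%:C => x; rewrite !uprod_normE -rmorphM lecR.
  have hx := urep_bnd x; have ha := gns_ubnd a hx.
  have h1 := @unorm_cvg _ _ _ w _ ha.
  have h2 : cnorm a * N (urep x t) @[t --> ufilter w] --> cnorm a * unorm x.
    by apply: cvgM; [exact: cvg_cst | exact: unorm_urep].
  by apply: (ler_cvg_to h1 h2); apply: nearW => t; exact: gns_bound.
- move=> c a b x; have hx := urep_bnd x.
  rewrite /gns -uclZ ?gns_ubnd // -ucl_add ?ubndZ ?gns_ubnd //.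
  by congr ucl; apply/funext => t; rewrite mulrDl -scalerAl.
- split=> [x|a b x].
    rewrite /gns -[RHS]ureprK; congr ucl; apply/funext => t; exact: mul1r.
  rewrite {3}/gns gns_ucl ?gns_ubnd ?urep_bnd // /gns.
  by congr ucl; apply/funext => t; rewrite mulrA.
- move=> a x y; rewrite /gns -[y in LHS]ureprK -[x in RHS]ureprK.
  rewrite !inner_ucl ?gns_ubnd ?urep_bnd //.
  by congr ulimC; apply/funext => t; rewrite /= /gns_form starM starK mulrA.
Qed.

Definition gns_vec : H := ucl N w (fun=> 1).

Lemma gns_vec_inner a b : inner (gns a gns_vec) (gns b gns_vec) = F (star b * a).
Proof.
rewrite /gns_vec !gns_ucl ?ubnd_cst // inner_ucl_cst.
by rewrite /= /gns_form !mulr1.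
Qed.

End GNS.

(** * Ultraproducts of C*-algebras *)

(** Everything a C*-algebra has except definiteness and completeness, both of which the ultraproduct
    supplies. The last field keeps [1] from becoming [0] there. *)
Record cstar_seminorm (R : realType) (V : algType R[i]) := CStarSeminorm {
  cs_seminorm :> seminorm V;
  cs_star : V -> V;
  cs_starD : forall x y, cs_star (x + y) = cs_star x + cs_star y;
  cs_starZ : forall (c : R[i]) x, cs_star (c *: x) = c^* *: cs_star x;
  cs_starM : forall x y, cs_star (x * y) = cs_star y * cs_star x;
  cs_starK : forall x, cs_star (cs_star x) = x;
  cs_normM : forall x y, cs_seminorm (x * y) <= cs_seminorm x * cs_seminorm y;
  cs_norm_star : forall x, cs_seminorm (cs_star x * x) = cs_seminorm x ^+ 2;
  cs_norm1 : cs_seminorm 1 != 0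
}.

Section CStarUltraproduct.
Variables (R : realType) (V : algType R[i]) (S : cstar_seminorm V) (w : freeultra R).

Definition cprod : Type := uprod S w.
HB.instance Definition _ := CompleteNormedModule.on cprod.
Implicit Types (x y z : cprod) (f g : R -> V).

Definition cl f : cprod := ucl S w f.

Lemma clP x : exists2 f, f \in ubnd S & x = cl f.
Proof. by exists (urep x); [exact: urep_bnd | rewrite /cl ureprK]. Qed.

Lemma cs_norm_starE a : S (cs_star S a) = S a.
Proof.
suff h b : S b <= S (cs_star S b).
  by apply/le_anti; rewrite h -{2}[a](cs_starK S) h.
have [b0|b0] := eqVneq (S b) 0; first by rewrite b0 sn_ge0.
have := cs_normM S (cs_star S b) b; rewrite cs_norm_star expr2 ler_pM2r //.
by rewrite lt_def b0 sn_ge0.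
Qed.

Lemma ubndM f g : f \in ubnd S -> g \in ubnd S -> (fun t => f t * g t) \in ubnd S.
Proof.
move=> /ubndP[M hM] /ubndP[M' hM']; apply/ubndP; exists (M * M') => t.
by apply: le_trans (cs_normM _ _ _) _; apply: ler_pM; rewrite ?sn_ge0.
Qed.

Lemma ubnd_star f : f \in ubnd S -> (fun t => cs_star S (f t)) \in ubnd S.
Proof. by move=> /ubndP[M hM]; apply/ubndP; exists M => t; rewrite cs_norm_starE. Qed.

Definition cprod_mul x y : cprod := cl (fun t => urep x t * urep y t).
Definition cprod_star x : cprod := cl (fun t => cs_star S (urep x t)).

Lemma cl_mul f g : f \in ubnd S -> g \in ubnd S ->
  cl (fun t => f t * g t) = cprod_mul (cl f) (cl g).
Proof.
move=> hf hg; apply: ucl_eq; rewrite ?ubndM ?urep_bnd //.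
have [M hM] := elimT (ubndP _ _) hg.
have [M' hM'] := elimT (ubndP _ _) (urep_bnd (cl f)).
have h : S (urep (cl f) t - f t) * `|M| + `|M'| * S (urep (cl g) t - g t)
    @[t --> ufilter w] --> (0 : R).
  have -> : (0 : R) = 0 * `|M| + `|M'| * 0 by rewrite mul0r mulr0 addr0.
  by apply: cvgD; apply: cvgM; try exact: cvg_cst; exact: ucl_urep.
apply: (squeeze_cvgr _ (cvg_cst 0) h); apply: nearW => t; rewrite sn_ge0 /=.
rewrite -(subrKA (urep (cl f) t * g t)) -mulrBl -mulrBr.
apply: le_trans (snD _ _ _) _; apply: lerD; apply: le_trans (cs_normM _ _ _) _.
  rewrite snBC; apply: ler_wpM2l; first exact: sn_ge0.
  exact: le_trans (hM t) (ler_norm _).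
rewrite [S (g t - _)]snBC; apply: ler_wpM2r; first exact: sn_ge0.
exact: le_trans (hM' t) (ler_norm _).
Qed.

Lemma cs_starB a b : cs_star S (a - b) = cs_star S a - cs_star S b.
Proof. by rewrite cs_starD -scaleN1r cs_starZ rmorphN1 scaleN1r. Qed.

Lemma cl_star f : f \in ubnd S -> cl (fun t => cs_star S (f t)) = cprod_star (cl f).
Proof.
move=> hf; apply: ucl_eq; rewrite ?ubnd_star ?urep_bnd //.
by under eq_fun do rewrite -cs_starB cs_norm_starE snBC; exact: ucl_urep.
Qed.

Lemma cprod_mulA : associative cprod_mul.
Proof.
move=> x y z; have [f hf ->] := clP x; have [g hg ->] := clP y; have [h hh ->] := clP z.
by rewrite -!cl_mul ?ubndM //; congr cl; apply/funext => t; rewrite mulrA.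
Qed.

Lemma cprod_mul1r : left_id (cl (fun=> 1)) cprod_mul.
Proof.
move=> x; rewrite -[x]ureprK -cl_mul ?urep_bnd ?ubnd_cst //.
by congr cl; apply/funext => t; rewrite mul1r.
Qed.

Lemma cprod_mulr1 : right_id (cl (fun=> 1)) cprod_mul.
Proof.
move=> x; rewrite -[x]ureprK -cl_mul ?urep_bnd ?ubnd_cst //.
by congr cl; apply/funext => t; rewrite mulr1.
Qed.

Lemma cprod_mulDl : left_distributive cprod_mul +%R.
Proof.
move=> x y z; rewrite -[x]ureprK -[y]ureprK -[z]ureprK -ucl_add ?urep_bnd //.
rewrite -!cl_mul ?ubndD ?urep_bnd // -ucl_add ?ubndM ?urep_bnd //.
by congr cl; apply/funext => t; rewrite mulrDl.
Qed.

Lemma cprod_mulDr : right_distributive cprod_mul +%R.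
Proof.
move=> x y z; rewrite -[x]ureprK -[y]ureprK -[z]ureprK -ucl_add ?urep_bnd //.
rewrite -!cl_mul ?ubndD ?urep_bnd // -ucl_add ?ubndM ?urep_bnd //.
by congr cl; apply/funext => t; rewrite mulrDr.
Qed.

Lemma cprod_1neq0 : cl (fun=> 1) != 0 :> cprod.
Proof.
apply/eqP => h; have h1 := @unorm_cvg _ _ _ w _ (ubnd_cst S 1).
have h2 : unorm (ucl S w (fun=> 1)) = 0.
  by rewrite -[ucl _ _ _]/(cl (fun=> 1)) h; apply: complexI; rewrite -uprod_normE normr0.
rewrite h2 in h1; have := cs_norm1 S; rewrite (_ : S 1 = 0) ?eqxx //.
exact: (cvg_unique _ (cvg_cst (S 1)) h1).
Qed.

HB.instance Definition _ := GRing.Zmodule_isNzRing.Build cprod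
  cprod_mulA cprod_mul1r cprod_mulr1 cprod_mulDl cprod_mulDr cprod_1neq0.

Lemma clM f g : f \in ubnd S -> g \in ubnd S -> cl (fun t => f t * g t) = cl f * cl g.
Proof. exact: cl_mul. Qed.

Lemma cprod_scaleAl (c : R[i]) x y : c *: (x * y) = c *: x * y.
Proof.
rewrite -[x]ureprK -[y]ureprK -[ucl S w _]/(cl _) -[ucl S w (urep y)]/(cl _).
rewrite -clM ?urep_bnd // -!uclZ ?ubndM ?urep_bnd // -[ucl S w (fun t => c *: urep x t)]/(cl _).
rewrite -clM ?ubndZ ?urep_bnd //.
by congr cl; apply/funext => t; rewrite scalerAl.
Qed.

HB.instance Definition _ := GRing.Lmodule_isLalgebra.Build R[i] cprod cprod_scaleAl.

Lemma cprod_scaleAr (c : R[i]) x y : c *: (x * y) = x * (c *: y).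
Proof.
rewrite -[x]ureprK -[y]ureprK -[ucl S w _]/(cl _) -[ucl S w (urep y)]/(cl _).
rewrite -clM ?urep_bnd // -!uclZ ?ubndM ?urep_bnd // -[ucl S w (fun t => c *: urep y t)]/(cl _).
rewrite -clM ?ubndZ ?urep_bnd //.
by congr cl; apply/funext => t; rewrite scalerAr.
Qed.

HB.instance Definition _ := GRing.Lalgebra_isAlgebra.Build R[i] cprod cprod_scaleAr.

Lemma cprod_starD x y : cprod_star (x + y) = cprod_star x + cprod_star y.
Proof.
rewrite -[x]ureprK -[y]ureprK -ucl_add ?urep_bnd //.
rewrite -!cl_star ?ubndD ?urep_bnd // -ucl_add ?ubnd_star ?urep_bnd //.
by congr cl; apply/funext => t; rewrite cs_starD.
Qed.

Lemma cprod_starZ (c : R[i]) x : cprod_star (c *: x) = c^* *: cprod_star x.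
Proof.
rewrite -[x]ureprK -uclZ ?urep_bnd // -!cl_star ?ubndZ ?urep_bnd // -uclZ ?ubnd_star ?urep_bnd //.
by congr cl; apply/funext => t; rewrite cs_starZ.
Qed.

Lemma cprod_starM x y : cprod_star (x * y) = cprod_star y * cprod_star x.
Proof.
rewrite -[x]ureprK -[y]ureprK -clM ?urep_bnd //.
rewrite -!cl_star ?ubndM ?urep_bnd // -clM ?ubnd_star ?urep_bnd //.
by congr cl; apply/funext => t; rewrite cs_starM.
Qed.

Lemma cprod_starK x : cprod_star (cprod_star x) = x.
Proof.
have [f hf ->] := clP x; rewrite -!cl_star ?ubnd_star //.
by congr cl; apply/funext => t; rewrite cs_starK.
Qed.

Lemma cprod_normM x y : unorm (x * y) <= unorm x * unorm y.
Proof.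
rewrite -{1}[x]ureprK -{1}[y]ureprK -clM ?urep_bnd //.
have h := @unorm_cvg _ _ _ w _ (ubndM (urep_bnd x) (urep_bnd y)).
apply: (ler_cvg_to h (cvgM (@unorm_urep _ _ _ _ x) (@unorm_urep _ _ _ _ y))).
by apply: nearW => t; exact: cs_normM.
Qed.

Lemma cprod_norm_star x : unorm (cprod_star x * x) = unorm x ^+ 2.
Proof.
rewrite -{1 2}[x]ureprK -cl_star ?urep_bnd // -clM ?ubnd_star ?urep_bnd //.
apply: unormP; first by rewrite ubndM ?ubnd_star ?urep_bnd.
have h := @unorm_urep _ _ _ _ x.
by under eq_fun do rewrite cs_norm_star expr2; rewrite expr2; exact: cvgM.
Qed.

HB.instance Definition _ := isCStarAlgebra.Build R cprod
  cprod_starD cprod_starZ cprod_starM cprod_starK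
  (@unormD _ _ _ w) (@unormZ _ _ _ w) (@unorm0_eq0 _ _ _ w) cprod_normM cprod_norm_star
  (@uprod_entourageP _ _ S w) (@uprod_complete _ _ S w).

Lemma clD f g : f \in ubnd S -> g \in ubnd S -> cl (fun t => f t + g t) = cl f + cl g.
Proof. exact: ucl_add. Qed.

Lemma cl_starE f : f \in ubnd S -> cl (fun t => cs_star S (f t)) = star (cl f).
Proof. exact: cl_star. Qed.

Lemma clZ (c : R[i]) f : f \in ubnd S -> cl (fun t => c *: f t) = c *: cl f.
Proof. exact: uclZ. Qed.

Lemma cnorm_cl_cvg f : f \in ubnd S -> S (f t) @[t --> ufilter w] --> cnorm (cl f).
Proof. exact: unorm_cvg. Qed.

Lemma cl_eq f g : f \in ubnd S -> g \in ubnd S ->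
  S (f t - g t) @[t --> ufilter w] --> (0 : R) -> cl f = cl g.
Proof. exact: ucl_eq. Qed.

End CStarUltraproduct.

(** * Adjointable operators and the canonical trace *)

Section AdjointableOperators.
Variables (R : realType) (V : lmodType R[i]) (I : preinner V).
Local Notation N := (pin_seminorm I).

Definition adjointable (p : (V -> V) * (V -> V)) : Prop :=
  [/\ forall (c : R[i]) x y, p.1 (c *: x + y) = c *: p.1 x + p.1 y,
      forall (c : R[i]) x y, p.2 (c *: x + y) = c *: p.2 x + p.2 y,
      forall x y, I (p.1 x) y = I x (p.2 y) &
      exists M : R, forall x, N (p.1 x) <= M * N x].

(* Pairs of mutually adjoint operators: the adjoint is part of the data because
   the form may be degenerate. *)
Record adjop := AdjOp { adjpair :> (V -> V) * (V -> V); _ : `[< adjointable adjpair >] }.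
HB.instance Definition _ := [isSub for adjpair].
HB.instance Definition _ := [Choice of adjop by <:].
Implicit Types (T S U : adjop).

Lemma adjopP T : adjointable T.
Proof. exact/asboolP/(valP T). Qed.

Lemma adjop_eq T S : T.1 =1 S.1 -> T.2 =1 S.2 -> T = S.
Proof.
move=> /funext h1 /funext h2; apply: val_inj => /=.
by rewrite [LHS]surjective_pairing [RHS]surjective_pairing h1 h2.
Qed.

Lemma adj_adj T x y : I (T.1 x) y = I x (T.2 y).
Proof. by have [_ _ h _] := adjopP T. Qed.

Lemma adj_adj2 T x y : I (T.2 x) y = I x (T.1 y).
Proof. by rewrite pin_conj -adj_adj -pin_conj. Qed.

Lemma adjointableD T S : adjointable (fun x => T.1 x + S.1 x, fun x => T.2 x + S.2 x).
Proof.
have [h1 h2 h3 [M h4]] := adjopP T; have [k1 k2 k3 [K k4]] := adjopP S; split.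
- by move=> c x y /=; rewrite h1 k1 scalerDr addrACA.
- by move=> c x y /=; rewrite h2 k2 scalerDr addrACA.
- by move=> x y /=; rewrite pinDl pinDr h3 k3.
- exists (M + K) => x; apply: le_trans (snD _ _ _) _; rewrite mulrDl.
  exact: lerD.
Qed.

Lemma adjointableZ (a : R[i]) T : adjointable (fun x => a *: T.1 x, fun x => a^* *: T.2 x).
Proof.
have [h1 h2 h3 [M h4]] := adjopP T; split.
- by move=> c x y /=; rewrite h1 scalerDr !scalerA mulrC.
- by move=> c x y /=; rewrite h2 scalerDr !scalerA mulrC.
- by move=> x y /=; rewrite pinZl pinZr h3 conjCK.
- exists (complex_norm a * M) => x; rewrite -lecR snZ -mulrA rmorphM /= complex_normE.
  by apply: ler_wpM2l => //; rewrite lecR; exact: h4.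
Qed.

Lemma adjointable0 : adjointable (fun=> 0, fun=> 0).
Proof.
split.
- by move=> c x y /=; rewrite scaler0 addr0.
- by move=> c x y /=; rewrite scaler0 addr0.
- by move=> x y /=; rewrite [RHS]pin_conj !pin0l rmorph0.
- by exists 0 => x; rewrite sn0 mul0r.
Qed.

Lemma adjointable1 : adjointable (id, id).
Proof. by split => //; exists 1 => x; rewrite mul1r. Qed.

Lemma adjointableM T S : adjointable (fun x => T.1 (S.1 x), fun x => S.2 (T.2 x)).
Proof.
have [h1 h2 h3 [M h4]] := adjopP T; have [k1 k2 k3 [K k4]] := adjopP S; split.
- by move=> c x y /=; rewrite k1 h1.
- by move=> c x y /=; rewrite h2 k2.
- by move=> x y /=; rewrite h3 k3.
exists (`|M| * `|K|) => x; apply: le_trans (h4 _) _.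
apply: le_trans (_ : `|M| * N (S.1 x) <= _).
  by apply: ler_wpM2r; [exact: sn_ge0 | exact: ler_norm].
rewrite -mulrA; apply: ler_wpM2l => //; apply: le_trans (k4 _) _.
by apply: ler_wpM2r; [exact: sn_ge0 | exact: ler_norm].
Qed.

(** From [N (q x) ^ 2 = I (p (q x)) x <= M * N (q x) * N x], cancel [N (q x)]. *)
Lemma adj_bound (p q : V -> V) (M : R) : (forall x y, I (p x) y = I x (q y)) ->
  (forall x, N (p x) <= M * N x) -> forall x, N (q x) <= `|M| * N x.
Proof.
move=> h hM x; have [q0|q0] := eqVneq (N (q x)) 0.
  by rewrite q0 mulr_ge0 // sn_ge0.
have qp : 0 < N (q x) by rewrite lt_def q0 sn_ge0.
rewrite -(ler_pM2l qp) -expr2 -lecR pnorm_sqr -h.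
have := cauchy_schwarz I (p (q x)) x.
have r : I (p (q x)) x \is Num.real by rewrite h realE pin_ge0.
move=> hc; apply: le_trans (real_ler_norm r) _; apply: le_trans hc _; rewrite lecR.
rewrite mulrCA mulrA; apply: ler_wpM2r; first exact: pnorm_ge0.
apply: le_trans (hM _) _.
by apply: ler_wpM2r; [exact: sn_ge0 | exact: ler_norm].
Qed.

Lemma adjointable_star T : adjointable (T.2, T.1).
Proof.
have [h1 h2 h3 [M h4]] := adjopP T; split => //= [x y|]; first exact: adj_adj2.
by exists `|M|; exact: adj_bound h3 h4.
Qed.

Definition adjopD T S := AdjOp (asboolT (adjointableD T S)).
Definition adjopZ (a : R[i]) T := AdjOp (asboolT (adjointableZ a T)).
Definition adjop0 := AdjOp (asboolT adjointable0).
Definition adjop1 := AdjOp (asboolT adjointable1).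
Definition adjopM T S := AdjOp (asboolT (adjointableM T S)).
Definition adjop_star T := AdjOp (asboolT (adjointable_star T)).
Definition adjopN T := adjopZ (-1) T.

Lemma adjopDA : associative adjopD.
Proof. by move=> T S U; apply: adjop_eq => x /=; rewrite addrA. Qed.
Lemma adjopDC : commutative adjopD.
Proof. by move=> T S; apply: adjop_eq => x /=; rewrite addrC. Qed.
Lemma adjop0D : left_id adjop0 adjopD.
Proof. by move=> T; apply: adjop_eq => x /=; rewrite add0r. Qed.
Lemma adjopND : left_inverse adjop0 adjopN adjopD.
Proof. by move=> T; apply: adjop_eq => x /=; rewrite ?rmorphN1 scaleN1r addNr. Qed.
HB.instance Definition _ := GRing.isZmodule.Build adjop adjopDA adjopDC adjop0D adjopND.

Lemma adjop_lin1 T (c : R[i]) x y : T.1 (c *: x + y) = c *: T.1 x + T.1 y.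
Proof. by have [] := adjopP T. Qed.
Lemma adjop_lin2 T (c : R[i]) x y : T.2 (c *: x + y) = c *: T.2 x + T.2 y.
Proof. by have [] := adjopP T. Qed.
Lemma adjop_add1 T x y : T.1 (x + y) = T.1 x + T.1 y.
Proof. by have := adjop_lin1 T 1 x y; rewrite !scale1r. Qed.
Lemma adjop_add2 T x y : T.2 (x + y) = T.2 x + T.2 y.
Proof. by have := adjop_lin2 T 1 x y; rewrite !scale1r. Qed.
Lemma adjop_scale1 T (c : R[i]) x : T.1 (c *: x) = c *: T.1 x.
Proof.
have h0 : T.1 0 = 0 by apply: (addrI (T.1 0)); rewrite -adjop_add1 !addr0.
by have := adjop_lin1 T c x 0; rewrite h0 !addr0.
Qed.
Lemma adjop_scale2 T (c : R[i]) x : T.2 (c *: x) = c *: T.2 x.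
Proof.
have h0 : T.2 0 = 0 by apply: (addrI (T.2 0)); rewrite -adjop_add2 !addr0.
by have := adjop_lin2 T c x 0; rewrite h0 !addr0.
Qed.

Lemma adjopMA : associative adjopM.
Proof. by move=> T S U; apply: adjop_eq => x. Qed.
Lemma adjop1M : left_id adjop1 adjopM.
Proof. by move=> T; apply: adjop_eq => x. Qed.
Lemma adjopM1 : right_id adjop1 adjopM.
Proof. by move=> T; apply: adjop_eq => x. Qed.
Lemma adjopMDl : left_distributive adjopM +%R.
Proof. by move=> T S U; apply: adjop_eq => x //=; rewrite adjop_add2. Qed.
Lemma adjopMDr : right_distributive adjopM +%R.
Proof. by move=> T S U; apply: adjop_eq => x //=; rewrite adjop_add1. Qed.

Lemma adjopZA (a b : R[i]) T : adjopZ a (adjopZ b T) = adjopZ (a * b) T.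
Proof. by apply: adjop_eq => x /=; rewrite scalerA // rmorphM. Qed.
Lemma adjopZ1 : left_id 1 adjopZ.
Proof. by move=> T; apply: adjop_eq => x /=; rewrite ?rmorph1 scale1r. Qed.
Lemma adjopZDr : right_distributive adjopZ +%R.
Proof. by move=> a T S; apply: adjop_eq => x /=; rewrite scalerDr. Qed.
Lemma adjopZDl T : {morph adjopZ^~ T : a b / a + b}.
Proof. by move=> a b; apply: adjop_eq => x /=; rewrite ?rmorphD /= scalerDl. Qed.
HB.instance Definition _ := GRing.Zmodule_isLmodule.Build R[i] adjop
  adjopZA adjopZ1 adjopZDr adjopZDl.

Definition opnorm T : R := inf [set M : R | 0 <= M /\ forall x, N (T.1 x) <= M * N x].

Lemma has_inf_opnorm T : has_inf [set M : R | 0 <= M /\ forall x, N (T.1 x) <= M * N x].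
Proof.
have [_ _ _ [M hM]] := adjopP T; split; last by exists 0 => K [].
exists `|M|; split => // x; apply: le_trans (hM x) _.
by apply: ler_wpM2r; [exact: sn_ge0 | exact: ler_norm].
Qed.

Lemma opnorm_ge0 T : 0 <= opnorm T.
Proof. by apply: lb_le_inf; [exact: (has_inf_opnorm T).1 | move=> M []]. Qed.

Lemma opnorm_min T M : 0 <= M -> (forall x, N (T.1 x) <= M * N x) -> opnorm T <= M.
Proof. by move=> M0 hM; apply: ge_inf; [exact: (has_inf_opnorm T).2 | split]. Qed.

Lemma opnormP T x : N (T.1 x) <= opnorm T * N x.
Proof.
have [n0|n0] := eqVneq (N x) 0.
  have [M [M0 hM]] := (has_inf_opnorm T).1.
  by have := hM x; rewrite n0 !mulr0.
have np : 0 < N x by rewrite lt_def n0 sn_ge0.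
rewrite -ler_pdivrMr //; apply: lb_le_inf; first exact: (has_inf_opnorm T).1.
by move=> M [M0 hM]; rewrite ler_pdivrMr.
Qed.

Lemma opnormD T S : opnorm (T + S) <= opnorm T + opnorm S.
Proof.
apply: opnorm_min => [|x]; first by rewrite addr_ge0 ?opnorm_ge0.
apply: le_trans (snD _ _ _) _; rewrite mulrDl.
by apply: lerD; exact: opnormP.
Qed.

Lemma opnormZ_le (c : R[i]) T : opnorm (c *: T) <= complex_norm c * opnorm T.
Proof.
have c0 : 0 <= complex_norm c by rewrite -ler0c complex_normE normr_ge0.
apply: opnorm_min => [|x]; first by rewrite mulr_ge0 ?opnorm_ge0.
rewrite -mulrA; apply: le_trans (_ : complex_norm c * N (T.1 x) <= _).
  by rewrite -lecR snZ rmorphM /= complex_normE.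
by apply: ler_wpM2l => //; exact: opnormP.
Qed.

Lemma opnormZ (c : R[i]) T : (opnorm (c *: T))%:C = `|c| * (opnorm T)%:C.
Proof.
rewrite -complex_normE -rmorphM; congr (_%:C); apply/le_anti; rewrite opnormZ_le /=.
have [->|c0] := eqVneq c 0.
  by rewrite /complex_norm normr0 /= mul0r opnorm_ge0.
have cp : 0 < complex_norm c by rewrite -ltcR complex_normE normr_gt0.
have := opnormZ_le c^-1 (c *: T); rewrite scalerA mulVf // scale1r.
have -> : complex_norm c^-1 = (complex_norm c)^-1.
  by apply: complexI; rewrite complex_normE fmorphV /= complex_normE normfV.
by rewrite [_^-1 * _]mulrC ler_pdivlMr // mulrC.
Qed.

Definition opnorm_seminorm : seminorm adjop := Seminorm opnormD opnormZ.

Lemma opnormM T S : opnorm (adjopM T S) <= opnorm T * opnorm S.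
Proof.
apply: opnorm_min => [|x]; first by rewrite mulr_ge0 ?opnorm_ge0.
apply: le_trans (opnormP T _) _; rewrite -mulrA.
by apply: ler_wpM2l; [exact: opnorm_ge0 | exact: opnormP].
Qed.

Lemma opnorm_star_le T : opnorm (adjop_star T) <= opnorm T.
Proof.
apply: opnorm_min (opnorm_ge0 _) _ => x; rewrite -[X in X * _]ger0_norm ?opnorm_ge0 //.
exact: adj_bound (adj_adj T) (opnormP T) x.
Qed.

(** The nontrivial inequality is Cauchy-Schwarz applied to [N (T x) ^ 2 = I x (T^* T x)]. *)
Lemma opnorm_star_mul T : opnorm (adjopM (adjop_star T) T) = opnorm T ^+ 2.
Proof.
apply/le_anti/andP; split.
  apply: le_trans (opnormM _ _) _; rewrite expr2.
  by apply: ler_wpM2r; [exact: opnorm_ge0 | exact: opnorm_star_le].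
set M := opnorm (adjopM _ _); have M0 : 0 <= M by exact: opnorm_ge0.
rewrite -[M]sqr_sqrtr // ler_sqr ?nnegrE ?sqrtr_ge0 ?opnorm_ge0 //.
apply: opnorm_min (sqrtr_ge0 _) _ => x.
rewrite -ler_sqr ?nnegrE ?mulr_ge0 ?sqrtr_ge0 ?sn_ge0 // exprMn [Num.sqrt M ^+ 2]sqr_sqrtr //.
rewrite -lecR pnorm_sqr adj_adj.
have r : I x (T.2 (T.1 x)) \is Num.real by rewrite -adj_adj realE pin_ge0.
apply: le_trans (real_ler_norm r) _; apply: le_trans (cauchy_schwarz _ _ _) _; rewrite lecR.
rewrite expr2 mulrA mulrC; apply: ler_wpM2r; first exact: pnorm_ge0.
exact: (opnormP (adjopM (adjop_star T) T)).
Qed.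

Variables (e0 : V) (he0 : I e0 e0 = 1).

Lemma pnorm_e0 : N e0 = 1.
Proof. by apply/eqP; rewrite -(@eqrXn2 _ 2) ?pnorm_ge0 // expr1n; apply/eqP/complexI; rewrite pnorm_sqr he0. Qed.

Lemma opnorm1 : opnorm adjop1 != 0.
Proof.
by apply/eqP => h; have := opnormP adjop1 e0; rewrite h mul0r [X in X <= _]pnorm_e0 ler10.
Qed.

End AdjointableOperators.

(* The ring structure needs a nonzero operator, hence a copy of [adjop] that
   remembers a unit vector. *)
Definition adjop_of (R : realType) (V : lmodType R[i]) (I : preinner V)
  (e0 : V) (he0 : I e0 e0 = 1) : Type := adjop I.

Section AdjopAlgebra.
Variables (R : realType) (V : lmodType R[i]) (I : preinner V) (e0 : V) (he0 : I e0 e0 = 1).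
Local Notation L := (adjop_of he0).
HB.instance Definition _ := GRing.Lmodule.on L.

Lemma adjop1_neq0 : (adjop1 I : L) != 0.
Proof.
apply/eqP => h; have := opnorm1 he0; have -> : adjop1 I = 0 := h.
by rewrite (sn0 (opnorm_seminorm I) : opnorm 0 = 0) eqxx.
Qed.

HB.instance Definition _ := GRing.Zmodule_isNzRing.Build L
  (@adjopMA _ _ I) (@adjop1M _ _ I) (@adjopM1 _ _ I) (@adjopMDl _ _ I) (@adjopMDr _ _ I)
  adjop1_neq0.

Lemma adjop_scaleAl (c : R[i]) (T S : L) : c *: (T * S) = c *: T * S.
Proof. by apply: adjop_eq => x //=; rewrite adjop_scale2. Qed.
HB.instance Definition _ := GRing.Lmodule_isLalgebra.Build R[i] L adjop_scaleAl.

Lemma adjop_scaleAr (c : R[i]) (T S : L) : c *: (T * S) = T * (c *: S).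
Proof. by apply: adjop_eq => x //=; rewrite adjop_scale1. Qed.
HB.instance Definition _ := GRing.Lalgebra_isAlgebra.Build R[i] L adjop_scaleAr.

Lemma adjop_starD (T S : L) : adjop_star (T + S) = adjop_star T + adjop_star S :> L.
Proof. exact: adjop_eq. Qed.
Lemma adjop_starZ (c : R[i]) (T : L) : adjop_star (c *: T) = c^* *: (adjop_star T : L) :> L.
Proof. by apply: adjop_eq => x //=; rewrite conjCK. Qed.
Lemma adjop_starM (T S : L) : adjop_star (T * S) = (adjop_star S : L) * (adjop_star T : L) :> L.
Proof. exact: adjop_eq. Qed.
Lemma adjop_starK (T : L) : adjop_star (adjop_star T) = T :> L.
Proof. exact: adjop_eq. Qed.

Definition adjop_cstar : cstar_seminorm L :=
  @CStarSeminorm R L (opnorm_seminorm I) (@adjop_star _ _ I)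
    adjop_starD adjop_starZ adjop_starM adjop_starK (@opnormM _ _ I) (@opnorm_star_mul _ _ I)
    (opnorm1 he0).

End AdjopAlgebra.

(** * The left regular representation on finitely supported functions *)

Section FinitelySupported.
Variables (R : realType) (G : groupType).
Local Open Scope group_scope.
Local Open Scope ring_scope.

Definition finsupp : {pred (G -> R[i])} :=
  fun f => `[< exists s : seq G, forall g, g \notin s -> f g = 0 >].

Lemma finsupp_submod : submod_closed finsupp.
Proof.
split; first by apply/asboolP; exists [::].
move=> c f h /asboolP[s hs] /asboolP[s' hs']; apply/asboolP; exists (s ++ s') => g.
rewrite mem_cat negb_or => /andP[gs gs'].
by rewrite -[LHS]/(c *: f g + h g) hs // hs' // scaler0 addr0.
Qed.
HB.instance Definition _ := GRing.isSubmodClosed.Build R[i] (G -> R[i]) finsupp finsupp_submod.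

Record fsfun := FsFun { fsval :> G -> R[i]; _ : fsval \in finsupp }.
HB.instance Definition _ := [isSub for fsval].
HB.instance Definition _ := [Choice of fsfun by <:].
HB.instance Definition _ := [SubChoice_isSubLmodule of fsfun by <:].
Implicit Types (x y z : fsfun).

Lemma fsval_lin (c : R[i]) x y g : fsval (c *: x + y) g = c * x g + y g.
Proof. by []. Qed.

Definition fs_inner x y : R[i] := \sum_(g \in [set: G]) x g * (y g)^*.

Lemma fs_supp x : exists2 s : seq G, uniq s & forall g, g \notin s -> x g = 0.
Proof.
have /asboolP[s hs] := valP x; exists (undup s); first exact: undup_uniq.
by move=> g; rewrite mem_undup; exact: hs.
Qed.

Lemma fs_innerE x y (s : seq G) : uniq s -> (forall g, g \notin s -> x g = 0) ->
  fs_inner x y = \sum_(g <- s) x g * (y g)^*.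
Proof.
move=> us hs; rewrite /fs_inner (@fsbigE _ _ _ _ _ s) //.
  by apply: eq_bigl => g; rewrite in_setT.
by move=> g _ /hs ->; rewrite mul0r.
Qed.

Lemma fs_supp2 x y : exists2 s : seq G, uniq s &
  forall g, g \notin s -> x g = 0 /\ y g = 0.
Proof.
have [s us hs] := fs_supp x; have [s' us' hs'] := fs_supp y.
exists (undup (s ++ s')); first exact: undup_uniq.
by move=> g; rewrite mem_undup mem_cat negb_or => /andP[/hs-> /hs'->].
Qed.

Lemma fs_inner_linear (c : R[i]) x y z :
  fs_inner (c *: x + y) z = c * fs_inner x z + fs_inner y z.
Proof.
have [s us hs] := fs_supp2 x y.
have hx g : g \notin s -> x g = 0 by case/hs.
have hy g : g \notin s -> y g = 0 by case/hs.
rewrite !(@fs_innerE _ _ s) //; last by move=> g gs; rewrite fsval_lin hx // hy // mulr0 addr0.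
rewrite mulr_sumr -big_split /=; apply: eq_bigr => g _.
by rewrite -[LHS]/((c * x g + y g) * (z g)^*) mulrDl mulrA.
Qed.

Lemma fs_inner_conj x y : fs_inner y x = (fs_inner x y)^*.
Proof.
have [s us hs] := fs_supp2 x y.
rewrite !(@fs_innerE _ _ s) //; try by move=> g /hs[].
rewrite rmorph_sum; apply: eq_bigr => g _ /=.
by rewrite rmorphM /= conjCK mulrC.
Qed.

Lemma fs_inner_ge0 x : 0 <= fs_inner x x.
Proof.
have [s us hs] := fs_supp x; rewrite (fs_innerE _ us hs).
by apply: sumr_ge0 => g _; rewrite -normCK exprn_ge0.
Qed.

Definition fs_preinner : preinner fsfun := PreInner fs_inner_linear fs_inner_conj fs_inner_ge0.

Lemma delta_finsupp (a : G) : (fun g => (g == a)%:R : R[i]) \in finsupp.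
Proof.
by apply/asboolP; exists [:: a] => g; rewrite inE => /negPf ->.
Qed.
Definition fs_delta (a : G) : fsfun := FsFun (delta_finsupp a).

Lemma fs_inner_delta (a b : G) : fs_inner (fs_delta a) (fs_delta b) = (a == b)%:R.
Proof.
rewrite (@fs_innerE _ _ [:: a]) //; last by move=> g; rewrite inE /= => /negPf ->.
by rewrite big_seq1 /= eqxx mul1r rmorph_nat.
Qed.

Lemma shift_finsupp (a : G) x : (fun g => x (a^-1 * g)%g) \in finsupp.
Proof.
have [s us hs] := fs_supp x; apply/asboolP; exists [seq (a * g)%g | g <- s] => g.
move=> gs; apply: hs; apply: contra gs => gs; apply/mapP; exists (a^-1 * g)%g => //.
by rewrite mulgA mulgV mul1g.
Qed.
Definition fs_shift (a : G) x : fsfun := FsFun (shift_finsupp a x).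

Lemma fsfun_eq x y : fsval x =1 fsval y -> x = y.
Proof. by move=> /funext h; apply: val_inj. Qed.

Lemma fs_shift_adj (a : G) x y : fs_inner (fs_shift a x) y = fs_inner x (fs_shift a^-1%g y).
Proof.
have bij : bijective (fun g : G => (a * g)%g).
  by exists (fun g => (a^-1 * g)%g) => g; rewrite mulgA ?mulVg ?mulgV mul1g.
rewrite /fs_inner (@reindex_fsbigT _ _ _ _ _ _ _ bij); apply: eq_fsbigr => g _ /=.
by rewrite invgK mulgA mulVg mul1g.
Qed.

Lemma fs_shift_norm (a : G) x : fs_inner (fs_shift a x) (fs_shift a x) = fs_inner x x.
Proof.
rewrite fs_shift_adj; congr fs_inner; apply: fsfun_eq => g /=.
by rewrite invgK mulgA mulVg mul1g.
Qed.

Lemma fs_shift_adjointable (a : G) : adjointable fs_preinner (fs_shift a, fs_shift a^-1%g).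
Proof.
split.
- by move=> c x y; apply: fsfun_eq => g.
- by move=> c x y; apply: fsfun_eq => g.
- exact: fs_shift_adj.
exists 1 => x; rewrite mul1r /= /pnorm le_eqVlt; apply/orP; left; apply/eqP; congr Num.sqrt.
by congr (complex.Re _); exact: fs_shift_norm.
Qed.

Definition fs_regular (a : G) : adjop fs_preinner := AdjOp (asboolT (fs_shift_adjointable a)).

Lemma fs_delta1 : fs_preinner (fs_delta 1%g) (fs_delta 1%g) = 1.
Proof. by rewrite [LHS]fs_inner_delta eqxx. Qed.

End FinitelySupported.

Section CanonicalTrace.
Variables (R : realType) (G : groupType) (CG : group_cstar R G).
Local Notation L := (adjop_of (@fs_delta1 R G)).
Local Notation S := (adjop_cstar (@fs_delta1 R G)).
Local Notation I := (@fs_preinner R G).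
Local Notation e0 := (@fs_delta R G 1%g).

(** The universal property of [CG] asks for a complete target, so the regular representation is
    placed in the ultrapower of the operator algebra as constant families. *)
Lemma fs_regular_rep (w : freeultra R) :
  unitary_rep (fun g => cl S w (fun=> (fs_regular R g : L))).
Proof.
have rM g h : (fs_regular R (g * h)%g : L) = (fs_regular R g : L) * (fs_regular R h : L).
  by apply: adjop_eq => x; apply: fsfun_eq => k /=; rewrite ?invgM ?invgK mulgA.
have rstar g : cs_star S (fs_regular R g : L) = (fs_regular R g^-1%g : L).
  by apply: adjop_eq => x; apply: fsfun_eq => k /=; rewrite ?invgK.
have r1 : (fs_regular R (1 : G)%g : L) = 1.
  by apply: adjop_eq => x; apply: fsfun_eq => k /=; rewrite ?invg1 mul1g.
split=> [g|g h]; last by rewrite -clM ?ubnd_cst //; congr cl; apply/funext => t; exact: rM.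
by split; rewrite -cl_starE ?ubnd_cst // -clM ?ubnd_cst //;
  have -> : 1 = cl S w (fun=> 1) by []; congr cl; apply/funext => t;
  rewrite rstar -rM ?mulVg ?mulgV r1.
Qed.

(** The vector state of the regular representation at the point mass [e0] of the identity, carried
    to the ultrapower as the ultralimit of [q]. The shift by [g] moves [e0] to the orthogonal point
    mass at [g] unless [g] is the identity. *)
Theorem canonical_trace : exists2 tau : CG -> R[i], state tau &
  forall g, tau (gc_unit CG g) = (g == 1%g)%:R.
Proof.
have [w] := freeultra_exists R.
have [Phi hPhi] := gc_universal CG (fs_regular_rep w).
pose q (T : L) : R[i] := I ((T : adjop I).1 e0) e0.
have ne0 : pin_seminorm I e0 = 1 by exact: pnorm_e0 (@fs_delta1 R G).
have qb (T : L) : `|q T| <= (S T)%:C.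
  apply: le_trans (cauchy_schwarz _ _ _) _; rewrite lecR.
  have -> : pnorm I e0 = 1 by exact: ne0.
  by rewrite mulr1; apply: le_trans (opnormP _ _) _; rewrite ne0 mulr1.
have qlin (c : R[i]) (T U : L) : q (c *: T + U) = c * q T + q U.
  rewrite -[LHS]/(I (c *: (T : adjop I).1 e0 + (U : adjop I).1 e0) e0).
  by rewrite pinDl pinZl.
have qB (T U : L) : q (T - U) = q T - q U.
  by have := qlin (-1) U T; rewrite scaleN1r mulN1r addrC [- q U + _]addrC.
have bq f : f \in ubnd S -> cbnd (fun t => q (f t)).
  by move=> /ubndP[M hM]; exists M => t; apply: le_trans (qb _) _; rewrite lecR.
pose tw (x : cprod S w) := ulimC w (fun t => q (urep x t)).
have twE f : f \in ubnd S -> tw (cl S w f) = ulimC w (fun t => q (f t)).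
  move=> hf; apply: (@ulimC_eq _ _ _ _ (fun t => S (urep (cl S w f) t - f t))).
  - exact: bq (urep_bnd _).
  - exact: bq.
  - by move=> t; rewrite -qB.
  - exact: ucl_urep.
have twlin (c : R[i]) x y : tw (c *: x + y) = c * tw x + tw y.
  have [f hf ->] := clP x; have [g hg ->] := clP y.
  rewrite -clZ // -clD ?ubndZ // !twE ?ubndD ?ubndZ //.
  by rewrite -ulimC_linear; [congr ulimC; apply/funext => t | exact: bq | exact: bq].
have twge0 x : 0 <= tw (star x * x).
  have [f hf ->] := clP x.
  rewrite -cl_starE // -clM ?ubnd_star // twE ?ubndM ?ubnd_star //.
  apply: ulimC_ge0; first by apply: bq; rewrite ubndM ?ubnd_star.
  move=> t; have -> : q (cs_star S (f t) * f t) = I ((f t : adjop I).1 e0) ((f t : adjop I).1 e0).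
    exact: adj_adj2.
  exact: pin_ge0.
have twc (T : L) : tw (cl S w (fun=> T)) = q T.
  by rewrite twE ?ubnd_cst //; apply: ulimCP; exact: cvg_cst.
exists (fun x => tw (Phi x)); first split.
- by move=> c x y; rewrite linearP twlin.
- move=> x; have -> : Phi (star x * x) = star (Phi x) * Phi x.
    by rewrite -star_morph -rmorphM.
  exact: twge0.
- rewrite rmorph1; have -> : 1 = cl S w (fun=> 1) by [].
  by rewrite twc /q /= [LHS]fs_inner_delta eqxx.
move=> g; rewrite hPhi twc /q.
have -> : (fs_regular R g : adjop I).1 e0 = fs_delta R g.
  by apply: fsfun_eq => k /=; rewrite -(inj_eq (mulgI g)) mulgA mulgV mul1g mulg1.
by rewrite [LHS]fs_inner_delta.
Qed.

End CanonicalTrace.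

(** * Fixed points of the dual coaction *)

Section DenseApproximation.
Variables (R : realType).

Lemma dense_approx (A : cstarAlgType R) (S : set A) (b : A) (e : R) : dense S -> 0 < e ->
  exists2 y, S y & cnorm (b - y) < e.
Proof.
move=> hS e0; pose O := interior [set y : A | cnorm (b - y) < e].
have Ob : O b.
  rewrite /O /interior /= -nbhs_entourageE.
  exists [set xy : A * A | cnorm (xy.1 - xy.2) < e]; last by move=> y /xsectionP.
  by apply/cnorm_entourage; exists e.
have [y [Oy Sy]] := hS O (ex_intro _ b Ob) (open_interior _).
by exists y => //; exact: (interior_subset Oy).
Qed.

(** Isometry makes the preimages of a convergent sequence of approximants Cauchy. *)
Lemma isometric_range_closed (A B : cstarAlgType R) (f : {starhom A -> B}) (b : B) :
  (forall a, cnorm (f a) = cnorm a) ->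
  (forall e : R, 0 < e -> exists a, cnorm (b - f a) < e) -> exists a, b = f a.
Proof.
move=> iso h.
have hp n : 0 < (2^-1 : R) ^+ n by rewrite exprn_gt0 // invr_gt0.
have [a ha] := choice (fun n => h _ (hp n)).
have e0 : (fun n => 2 * (2^-1 : R) ^+ n) @ \oo --> (0 : R).
  have -> : (0 : R) = 2 * 0 by rewrite mulr0.
  apply: cvgM; [exact: cvg_cst | apply: cvg_expr].
  by rewrite ger0_norm // invf_lt1 // ltr1n.
have ca n m : (n <= m)%N -> cnorm (a m - a n) <= 2 * 2^-1 ^+ n.
  move=> nm; rewrite -iso rmorphB; apply: le_trans (cnorm_trans b _ _) _.
  rewrite mulrDl mul1r; apply: lerD; last exact: ltW (ha n).
  rewrite cnormBC; apply: le_trans (ltW (ha m)) _.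
  by apply: ler_wiXn2l => //; rewrite invf_le1 // ler1n.
have [l hl hn] := complete_seq e0 ca.
exists l; apply: (@ncvg_unique R B nat \oo _ (fun n => f (a n))).
  apply: (@ncvg_squeeze _ _ _ _ _ _ _ (fun n => 2 * (2^-1 : R) ^+ n)) => //.
  apply: nearW => n; rewrite cnormBC; apply: le_trans (ltW (ha n)) _.
  by rewrite ler_peMl ?ler1n // ltW.
apply: ncvg_squeeze hl; apply: nearW => n.
by rewrite -rmorphB iso.
Qed.

End DenseApproximation.

Section GroupUnitaries.
Variables (R : realType) (G : groupType) (A : cstarAlgType R) (u : G -> A).
Hypothesis hu : unitary_rep u.

Lemma rep1 : u 1%g = 1.
Proof.
have [hU hM] := hu; have [h _] := hU 1%g.
have : star (u 1%g) * u (1 * 1)%g = star (u 1%g) * (u 1%g * u 1%g) by rewrite hM.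
by rewrite mulg1 mulrA h mul1r.
Qed.

Lemma repV g : star (u g) = u g^-1%g.
Proof.
have [hU hM] := hu; have [h _] := hU g.
by rewrite -[LHS]mulr1 -rep1 -(mulgV g) hM mulrA h mul1r.
Qed.

End GroupUnitaries.

Section Coaction.
Variables (R : realType) (G : groupType) (CG : group_cstar R G).

Lemma state_lincomb (A : cstarAlgType R) (F : A -> R[i]) m (c : 'I_m -> R[i]) (b : 'I_m -> A) :
  state F ->
  F (star (\sum_p c p *: b p) * (\sum_p c p *: b p)) =
  \sum_p \sum_q c p * (c q)^* * F (star (b q) * b p).
Proof.
move=> [hl _ _].
have F0 : F 0 = 0.
  have := hl 1 0 0; rewrite scaler0 addr0 mul1r => h.
  by apply: (addrI (F 0)); rewrite -h addr0.
have FZ k x : F (k *: x) = k * F x by have := hl k x 0; rewrite F0 !addr0.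
have FD x y : F (x + y) = F x + F y by have := hl 1 x y; rewrite scale1r mul1r.
have Fsum (I : finType) (f : I -> A) : F (\sum_p f p) = \sum_p F (f p).
  by elim/big_rec2: _ => // p y1 y2 _ <-; rewrite FD.
rewrite mulr_sumr Fsum; apply: eq_bigr => p _.
rewrite star_sum mulr_suml Fsum; apply: eq_bigr => q _.
by rewrite starZ -scalerAr -scalerAl scalerA FZ.
Qed.

(** The Gram matrix of the vectors [gc_unit CG g - 1]: expanded it is [[g = h] - [g = 1] - [h = 1] +
    1]. Its constant part off the identity is what lets [slice_bound] see the full sum of the
    [b i]. *)
Lemma trace_kernel (tau : CG -> R[i]) (g h : G) : state tau ->
  (forall k, tau (gc_unit CG k) = (k == 1%g)%:R) ->
  tau (star (gc_unit CG h - 1) * (gc_unit CG g - 1)) =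
  (g != 1%g)%:R * (h != 1%g)%:R * (1 + (g == h)%:R).
Proof.
move=> [hl _ h1] ht.
have F0 : tau 0 = 0.
  have := hl 1 0 0; rewrite scaler0 addr0 mul1r => k.
  by apply: (addrI (tau 0)); rewrite -k addr0.
have FD x y : tau (x + y) = tau x + tau y by have := hl 1 x y; rewrite scale1r mul1r.
have FN x : tau (- x) = - tau x by have := hl (-1) x 0; rewrite F0 !addr0 scaleN1r mulN1r.
have ru := gc_rep CG.
rewrite starB star1 (repV ru) mulrBl mul1r mulrBr mulr1 -(ru.2) !(FD, FN) !ht h1.
have -> : (h^-1 * g == 1)%g = (g == h).
  apply/eqP/eqP => [k|->]; last exact: mulVg.
  by rewrite -[g]mul1g -(mulgV h) -mulgA k mulg1.
have -> : (h^-1 == 1)%g = (h == 1)%g by rewrite -(inj_eq invg_inj) invgK invg1.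
case: (altP (g =P 1%g)) => [->|g1]; case: (altP (h =P 1%g)) => [->|hh1]; rewrite ?eqxx /=.
- by ring.
- by rewrite eq_sym (negPf hh1) /=; ring.
- by rewrite (negPf g1) /=; ring.
- by ring.
Qed.

(* The spatial norm is tested on the GNS representations of a state that norms the
   left hand side and of the canonical trace; the [gc_unit CG g] are orthonormal in
   the latter, so that the remaining terms contribute a sum of squares. *)
Lemma slice_bound (B : cstarAlgType R) (BG : cstar_tensor B CG) m (b : 'I_m -> B) (g : 'I_m -> G) :
  cnorm (\sum_(i | g i != 1%g) b i) <=
  cnorm (\sum_i ct_left BG (b i) * ct_right BG (gc_unit CG (g i) - 1)).
Proof.
set q := \sum_(i | _) b i; set c := cnorm (\sum_i _).
move: (lexx c); rewrite {1}/c => /ct_norm[_ hc].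
have [F hF Fq] := exists_state q.
have [tau htau tauE] := canonical_trace CG.
have [w] := freeultra_exists R.
have := hc _ _ _ _ (gns_rep hF w) (gns_rep htau w) 1%N
  (fun=> gns_vec hF w) (fun=> gns_vec htau w).
have pos1 (T : cstarAlgType R) (f : T -> R[i]) (hf : state f) :
    inner (gns_vec hf w) (gns_vec hf w) = 1.
  rewrite /gns_vec inner_ucl_cst /= /gns_form star1 mulr1.
  by have [_ _ ->] := hf.
have -> : tensor_norm2 (fun=> gns_vec hF w) (fun _ : 'I_1 => gns_vec htau w) = 1.
  by rewrite /tensor_norm2 !big_ord1 !pos1 mulr1.
rewrite mulr1 /tensor_norm2.
have reind (f : 'I_m * 'I_1 -> R[i]) : \sum_p f p = \sum_(i < m) f (i, ord0).
  rewrite (reindex (fun i : 'I_m => (i, ord0 : 'I_1))) //=.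
  by exists (fun p => p.1) => [i _|[i j] _] //=; rewrite [j]ord1.
rewrite reind; under eq_bigr do rewrite reind /=.
pose e i : R[i] := (g i != 1%g)%:R.
have ec i : (e i)^* = e i by rewrite rmorph_nat.
have kE i j : inner (gns (b i) (gns_vec hF w)) (gns (b j) (gns_vec hF w)) *
    (* The two summands of the kernel are separated: the first assembles to [F (star q * q)], the
       second is diagonal in the group elements. *)
    inner (gns (gc_unit CG (g i) - 1) (gns_vec htau w))
          (gns (gc_unit CG (g j) - 1) (gns_vec htau w)) =
    e i * (e j)^* * F (star (b j) * b i) + e i * (e j)^* * (g i == g j)%:R * F (star (b j) * b i).
  rewrite !gns_vec_inner trace_kernel // ec /e; ring.
under eq_bigr do under eq_bigr do rewrite kE.
under eq_bigr do rewrite big_split /=.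
rewrite big_split /= -state_lincomb //.
have qE : \sum_i e i *: b i = q.
  rewrite /q [RHS]big_mkcond; apply: eq_bigr => i _; rewrite /e.
  by case: eqP => _; rewrite ?scale0r ?scale1r.
rewrite qE Fq.
(* The [g i] may repeat, so the diagonal part is grouped by the distinct values [k]; each group
   contributes [F] of some [star z * z]. *)
pose s := undup [seq g i | i <- enum 'I_m].
have diagE : \sum_i \sum_j e i * (e j)^* * (g i == g j)%:R * F (star (b j) * b i) =
   \sum_(k <- s) F (star (\sum_i (e i * (g i == k)%:R) *: b i) * (\sum_i (e i * (g i == k)%:R) *: b i)).
  under [RHS]eq_bigr do rewrite state_lincomb //.
  rewrite [RHS]exchange_big; apply: eq_bigr => i _; rewrite [RHS]exchange_big; apply: eq_bigr => j _ /=.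
  have gi : g i \in s by rewrite mem_undup map_f // mem_enum.
  rewrite (bigD1_seq (g i)) ?undup_uniq //= big1 ?addr0.
    by rewrite eqxx mulr1 rmorphM /= !ec rmorph_nat mulrA [g j == _]eq_sym.
  by move=> k /negPf ki; rewrite eq_sym ki mulr0 !mul0r.
rewrite diagE => hle.
have d0 : 0 <= \sum_(k <- s) F (star (\sum_i (e i * (g i == k)%:R) *: b i) * (\sum_i (e i * (g i == k)%:R) *: b i)).
  by apply: sumr_ge0 => k _; have [_ h _] := hF.
have : (cnorm q ^+ 2)%:C <= (c ^+ 2)%:C by apply: le_trans hle; rewrite lerDl.
by rewrite lecR ler_sqr // nnegrE; exact: cnorm_ge0.
Qed.

Variables (A : cstarAlgType R) (alpha : action G A) (B : crossed_product alpha).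
Variables (BG : cstar_tensor B CG) (delta : {starhom B -> BG}).
Hypothesis hdelta : dual_coaction delta.

(** For a polynomial [p] near a fixed [b], the difference [delta p - ct_left BG p] has norm at most
    [2 cnorm (b - p)]. By [slice_bound] it dominates the sum of all terms of [p] off the identity;
    what remains lies in [A]. The three errors are each below [e / 3]. *)
Lemma coaction_fixed_approx b e : delta b = ct_left BG b -> 0 < e ->
  exists a, cnorm (b - cp_emb B a) < e.
Proof.
move=> hb e0; have e3 : 0 < e / 3 by rewrite divr_gt0.
have [_ [n [a [g ->]]] hp] := @dense_approx R B _ b (e / 3) (cp_dense (c := B)) e3.
set p := \sum_i _ in hp.
have dp : delta p - ct_left BG p =
    \sum_i ct_left BG (cp_emb B (a i) * cp_unit B (g i)) * ct_right BG (gc_unit CG (g i) - 1).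
  rewrite /p !rmorph_sum -sumrB; apply: eq_bigr => i _ /=.
  rewrite starhomM hdelta.1 hdelta.2 /ct_tens !rmorph1 mulr1 rmorphB rmorph1 mulrBr mulr1.
  by rewrite mulrA -rmorphM.
have := slice_bound BG (fun i => cp_emb B (a i) * cp_unit B (g i)) g; rewrite -dp => hq.
exists (\sum_(i | g i == 1%g) a i).
set q := \sum_(i | _) _ in hq.
have pE : p = cp_emb B (\sum_(i | g i == 1%g) a i) + q.
  rewrite /p (bigID (fun i => g i == 1%g)) /=; congr (_ + _).
  rewrite rmorph_sum; apply: eq_bigr => i /eqP ->.
  by rewrite (rep1 (cp_covariant B).1) mulr1.
have -> : b - cp_emb B (\sum_(i | g i == 1%g) a i) = b - p + q.
  by rewrite pE opprD addrA subrK.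
have h1 : cnorm (delta p - ct_left BG p) <= cnorm (delta (b - p)) + cnorm (ct_left BG (b - p)).
  have -> : delta p - ct_left BG p = ct_left BG (b - p) - delta (b - p).
    by rewrite !rmorphB /= hb opprB [RHS]addrC subrKA.
  by rewrite [X in _ <= X]addrC; exact: cnormB.
have h2 := starhom_le delta (b - p); have h3 := starhom_le (ct_left BG) (b - p).
have h4 := cnormD (b - p) q.
have : e / 3 + e / 3 + e / 3 = e by field.
lra.
Qed.

Hypothesis emb_iso : forall a, cnorm (cp_emb B a) = cnorm a.

Lemma coaction_fixed b : delta b = ct_left BG b -> exists a, b = cp_emb B a.
Proof.
move=> hb; apply: isometric_range_closed => // e e0; exact: coaction_fixed_approx.
Qed.

Variables (C : cstarAlgType R) (gamma : action G C) (D : crossed_product gamma).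
Variables (DG : cstar_tensor D CG) (deltaD : {starhom D -> DG}).
Hypothesis hdeltaD : dual_coaction deltaD.
Variable rho : {starhom D -> B}.
Hypothesis hrho : equivariant_hom deltaD delta rho.

Lemma equivariant_emb c : exists a, rho (cp_emb D c) = cp_emb B a.
Proof.
have [rho_id [h1 h2]] := hrho; apply: coaction_fixed.
by rewrite -h2 hdeltaD.1 h1 /ct_tens rmorph1 mulr1.
Qed.

(** Under the coaction [rho (cp_unit D g)] picks up [gc_unit CG g] and [star (cp_unit B g)] picks up
    its adjoint, so their product is fixed. *)
Lemma equivariant_unit g : exists a, rho (cp_unit D g) = cp_emb B a * cp_unit B g.
Proof.
have [rho_id [h1 h2]] := hrho.
have [hU _] := (cp_covariant B).1; have [u1 u2] := hU g.
have [a ha] : exists a, rho (cp_unit D g) * star (cp_unit B g) = cp_emb B a.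
  apply: coaction_fixed.
  rewrite starhomM star_morph hdelta.2 -h2 hdeltaD.2 h1 /ct_tens.
  rewrite starM -!star_morph -mulrA [ct_right _ _ * (_ * _)]mulrA -rmorphM.
  by rewrite ((gc_rep CG).1 g).2 rmorph1 mul1r -rmorphM.
by exists a; rewrite -ha -mulrA u1 mulr1.
Qed.

End Coaction.

(** * Lifting the crossed product along an asymptotic representation *)

Section Lifts.
Variables (R : realType) (A : cstarAlgType R).

Definition cnorm_seminorm : seminorm A := Seminorm (@cnormD R A) (@cnormZ R A).

Lemma cnorm1_neq0 : cnorm_seminorm 1 != 0.
Proof. by rewrite /= cnorm1 oner_neq0. Qed.

Definition cstar_self : cstar_seminorm A :=
  CStarSeminorm (@starD R A) (@starZ R A) (@starM R A) (@starK R A)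
    (cs_seminorm := cnorm_seminorm) (@cnormM R A) (@cnorm_star R A) cnorm1_neq0.

Local Notation S := cstar_self.

Section ConstantEmbedding.
Variable w : freeultra R.

Definition cst_emb (a : A) : cprod S w := cl S w (fun=> a).

Lemma cst_emb_linear : linear cst_emb.
Proof.
move=> c a b; rewrite /cst_emb -clZ ?ubnd_cst // -clD ?ubndZ ?ubnd_cst //.
Qed.

Lemma cst_emb_mul : monoid_morphism cst_emb.
Proof. by split=> // a b; rewrite /cst_emb -clM ?ubnd_cst. Qed.

Lemma cst_emb_star a : cst_emb (star a) = star (cst_emb a).
Proof. by rewrite /cst_emb -cl_starE ?ubnd_cst. Qed.

HB.instance Definition _ := GRing.isLinear.Build R[i] A (cprod S w) *:%R cst_emb cst_emb_linear.
HB.instance Definition _ := GRing.isMonoidMorphism.Build A (cprod S w) cst_emb cst_emb_mul.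
HB.instance Definition _ := isStarMorphism.Build R A (cprod S w) cst_emb cst_emb_star.

Lemma cnorm_cst_emb a : cnorm (cst_emb a) = cnorm a.
Proof. by apply: unormP; [exact: ubnd_cst | exact: cvg_cst]. Qed.

End ConstantEmbedding.

Variables (G : groupType) (alpha : action G A) (B : crossed_product alpha).
Variable v : G -> R -> A.
Hypothesis v_unitary : forall g t, unitary (v g t).
Hypothesis v_mul : forall g h,
  cnorm (v g t * v h t - v (g * h)%g t) @[t --> +oo] --> (0 : R).
Hypothesis v_conj : forall g h,
  cnorm (alpha g (v h t) - v (g * h * g^-1)%g t) @[t --> +oo] --> (0 : R).
Hypothesis v_act : forall g a,
  cnorm (v g t * a * star (v g t) - alpha g a) @[t --> +oo] --> (0 : R).

Let cvg_w (w : freeultra R) (h : R -> R) (l : R) :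
  h @ +oo --> l -> h @ ufilter w --> l.
Proof. by move=> hl P /hl; exact: ufilter_pinfty. Qed.

Lemma v_bnd g : v g \in ubnd S.
Proof. by apply/ubndP; exists 1 => t /=; rewrite cnorm_unitary. Qed.

Definition evaluates (w : freeultra R) (Phi : {starhom B -> cprod S w}) : Prop :=
  (forall a, Phi (cp_emb B a) = cst_emb w a) /\ (forall g, Phi (cp_unit B g) = cl S w (v g)).

Lemma evaluates_exists w : exists Phi : {starhom B -> cprod S w}, evaluates Phi.
Proof.
have vb := v_bnd; have vsb g := ubnd_star (v_bnd g).
have [|Phi [h1 h2]] := @cp_universal _ _ _ _ B (cprod S w) (cst_emb w) (fun g => cl S w (v g)).
  split.
    split=> [g|g h].
      split; rewrite -cl_starE // -clM //; have -> : 1 = cl S w (fun=> 1) by [].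
        by congr cl; apply/funext => t; have [] := v_unitary g t.
      by congr cl; apply/funext => t; have [] := v_unitary g t.
    rewrite -clM //; apply/esym; apply: cl_eq; [exact: ubndM | exact: vb | ].
    exact: cvg_w (v_mul g h).
  move=> g a.
  suff h : cl S w (v g) * cl S w (fun=> a) * cl S w (fun t => cs_star S (v g t)) =
      cl S w (fun=> alpha g a) by rewrite -cl_starE.
  rewrite -!clM ?ubndM ?ubnd_cst //.
  apply: cl_eq; [| exact: ubnd_cst | exact: cvg_w (v_act g a)].
  by rewrite ?ubndM ?ubnd_cst.
by exists Phi.
Qed.

(** The universal property alone does not bound norms in [B] from below; an evaluation does, as it
    sends [cp_emb B a] to the constant family [a], of norm [cnorm a]. *)
Lemma cp_emb_isometric a : cnorm (cp_emb B a) = cnorm a.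
Proof.
apply/le_anti; rewrite starhom_le /=.
have [w] := freeultra_exists R; have [Phi [h _]] := evaluates_exists w.
by rewrite -(cnorm_cst_emb w) -h; exact: starhom_le.
Qed.

(** A relation, since [b] determines [f] only asymptotically. Ranging over all ultrafilters is what
    allows [freeultra_near] to turn norms in [B] into eventual bounds on [f]. *)
Definition islift (b : B) (f : R -> A) : Prop := f \in ubnd S /\
  forall w (Phi : {starhom B -> cprod S w}), evaluates Phi -> cl S w f = Phi b.

Lemma islift_near b f (e : R) : islift b f -> 0 < e ->
  \forall t \near +oo, cnorm (f t) < cnorm b + e.
Proof.
move=> [bf hf] e0; apply: freeultra_near => w.
have [Phi hPhi] := evaluates_exists w.
have h : cnorm (cl S w f) < cnorm b + e.
  by rewrite (hf _ _ hPhi); apply: le_lt_trans (starhom_le Phi b) _; rewrite ltrDl.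
by have /cvgr_lt /(_ _ h) := @cnorm_cl_cvg _ _ S w _ bf.
Qed.

Lemma islift_emb a : islift (cp_emb B a) (fun=> a).
Proof. by split=> [|w Phi [h _]]; [exact: ubnd_cst | rewrite h]. Qed.

Lemma islift_unit g : islift (cp_unit B g) (v g).
Proof. by split=> [|w Phi [_ h]]; [exact: v_bnd | rewrite h]. Qed.

Lemma islift1 : islift 1 (fun=> 1).
Proof. by split=> [|w Phi _]; [exact: ubnd_cst | rewrite rmorph1]. Qed.

Lemma isliftD b c f h : islift b f -> islift c h -> islift (b + c) (fun t => f t + h t).
Proof.
move=> [bf hf] [bh hh]; split=> [|w Phi hP]; first exact: ubndD.
by rewrite clD // (hf _ _ hP) (hh _ _ hP) -rmorphD.
Qed.

Lemma isliftB b c f h : islift b f -> islift c h -> islift (b - c) (fun t => f t - h t).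
Proof.
move=> [bf hf] [bh hh]; split=> [|w Phi hP]; first exact: ubndB.
rewrite rmorphB /= -(hf _ _ hP) -(hh _ _ hP); apply/eqP; rewrite -subr_eq opprK -clD //.
  by apply/eqP; congr cl; apply/funext => t; rewrite subrK.
exact: ubndB.
Qed.

Lemma isliftM b c f h : islift b f -> islift c h -> islift (b * c) (fun t => f t * h t).
Proof.
move=> [bf hf] [bh hh]; split=> [|w Phi hP]; first exact: ubndM.
by rewrite clM // (hf _ _ hP) (hh _ _ hP) -rmorphM.
Qed.

Lemma islift_star b f : islift b f -> islift (star b) (fun t => star (f t)).
Proof.
move=> [bf hf]; split=> [|w Phi hP]; first exact: (ubnd_star (S := S)).
by rewrite (cl_starE (S := S)) // (hf _ _ hP) -star_morph.
Qed.

Lemma islift_sum n (b : 'I_n -> B) (f : 'I_n -> R -> A) : (forall i, islift (b i) (f i)) ->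
  islift (\sum_i b i) (fun t => \sum_i f i t).
Proof.
elim: n b f => [|n ih] b f h.
  have -> : (fun t => \sum_(i < 0) f i t) = (fun=> 0) by apply/funext => t; rewrite big_ord0.
  by rewrite big_ord0 -(rmorph0 (cp_emb B)); exact: islift_emb.
have -> : (fun t => \sum_i f i t) = (fun t => f ord0 t + \sum_i f (lift ord0 i) t).
  by apply/funext => t; rewrite big_ord_recl.
by rewrite big_ord_recl; apply: isliftD => //; exact: ih.
Qed.

Definition cp_poly n (a : 'I_n -> A) (g : 'I_n -> G) : B :=
  \sum_i cp_emb B (a i) * cp_unit B (g i).
Definition cp_poly_lift n (a : 'I_n -> A) (g : 'I_n -> G) (t : R) : A :=
  \sum_i a i * v (g i) t.

Lemma islift_cp_poly n (a : 'I_n -> A) (g : 'I_n -> G) :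
  islift (cp_poly a g) (cp_poly_lift a g).
Proof. by apply: islift_sum => i; apply: isliftM; [exact: islift_emb | exact: islift_unit]. Qed.

(* By [v_conj], [alpha k] acts on the lifted unitaries as conjugation by
   [cp_unit B k] does on [B]. *)
Lemma islift_conj_cp_poly n (a : 'I_n -> A) (g : 'I_n -> G) k :
  islift (cp_unit B k * cp_poly a g * star (cp_unit B k))
         (fun t => alpha k (cp_poly_lift a g t)).
Proof.
have [[uU uM] uc] := cp_covariant B.
have -> : cp_unit B k * cp_poly a g * star (cp_unit B k) =
    \sum_i cp_emb B (alpha k (a i)) * cp_unit B (k * g i * k^-1)%g.
  rewrite /cp_poly mulr_sumr mulr_suml; apply: eq_bigr => i _.
  rewrite -uc !uM (repV (conj uU uM)) -!mulrA; congr (_ * (_ * _)).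
  by rewrite mulrA -(uM k^-1%g) mulVg (rep1 (conj uU uM)) mul1r.
have -> : (fun t => alpha k (cp_poly_lift a g t)) =
    (fun t => \sum_i alpha k (a i) * alpha k (v (g i) t)).
  by apply/funext => t; rewrite rmorph_sum; apply: eq_bigr => i _; exact: starhomM.
apply: islift_sum => i; apply: isliftM; first exact: islift_emb.
have ub : (fun t => alpha k (v (g i) t)) \in ubnd S.
  apply/ubndP; exists 1 => t /=; apply: le_trans (starhom_le _ _) _.
  by rewrite cnorm_unitary.
split=> // w Phi [_ h]; rewrite h; apply: cl_eq => //; first exact: v_bnd.
exact: cvg_w (v_conj k (g i)).
Qed.

Variables (D : cstarAlgType R) (rho sigma : {starhom D -> B}).

(* Multiplying by [cp_unit B k] on the right turns the estimate in [B] into one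
   between lifts, which can be made in [A]. *)
Lemma intertwining_lift n (a : 'I_n -> A) (g : 'I_n -> G) (x : D) (k : G) (r s : A) (e : R) :
  sigma x = cp_emb B s * cp_unit B k -> rho x = cp_emb B r * cp_unit B k -> 0 < e ->
  \forall t \near +oo,
    cnorm (cp_emb B (cp_poly_lift a g t) * sigma x * star (cp_emb B (cp_poly_lift a g t))
           - rho x) <
    cnorm (cp_poly a g * sigma x * star (cp_poly a g) - rho x) + e.
Proof.
move=> sx rx e0; set P := cp_poly_lift a g; set p := cp_poly a g.
have [[uU uM] uc] := cp_covariant B.
(* The intertwining error is [F t] times [cp_unit B k]: covariance moves [cp_unit B k] to the right
   of [star (P t)] and applies [alpha k]. Likewise [b] is the error of [p] times
   [star (cp_unit B k)]. *)
pose F t := P t * s * star (alpha k (P t)) - r.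
pose b := p * cp_emb B s * star (cp_unit B k * p * star (cp_unit B k)) - cp_emb B r.
have hF : islift b F.
  apply: isliftB; last exact: islift_emb.
  apply: isliftM; last by apply: islift_star; exact: islift_conj_cp_poly.
  by apply: isliftM; [exact: islift_cp_poly | exact: islift_emb].
have bE : b = (p * sigma x * star p - rho x) * star (cp_unit B k).
  rewrite /b sx rx mulrBl -!mulrA (uU k).2 mulr1; congr (_ - _); congr (_ * (_ * _)).
  by rewrite !starM starK !mulrA.
have hb : cnorm b <= cnorm (p * sigma x * star p - rho x).
  rewrite bE; apply: le_trans (cnormM _ _) _.
  by rewrite cnorm_starE (cnorm_unitary (uU k)) mulr1.
apply: filterS (islift_near hF e0) => t ht.
have -> : cp_emb B (P t) * sigma x * star (cp_emb B (P t)) - rho x = cp_emb B (F t) * cp_unit B k.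
  rewrite /F rmorphB /= mulrBl rx; congr (_ - _).
  rewrite !starhomM star_morph -uc sx !starM starK -!mulrA (uU k).1 mulr1.
  by rewrite !mulrA.
apply: le_lt_trans (cnormM _ _) _; rewrite (cnorm_unitary (uU k)) mulr1.
apply: le_lt_trans (starhom_le _ _) _; apply: lt_le_trans ht _.
by rewrite lerD2r.
Qed.

End Lifts.

(** * Unitary paths *)

Section NewtonUnitary.
Variables (R : realType) (A : cstarAlgType R).
Implicit Types (x y e : A).

Definition defect y : A := 1 - star y * y.

(* One Newton step towards the unitary part of [y]; the defect contracts
   quadratically. *)
Definition newton y : A := (2^-1 : R)%:C *: (y * (2 + defect y)).

Lemma star_defect y : star (defect y) = defect y.
Proof. by rewrite /defect starB star1 starM starK. Qed.

Lemma star_nat n : star (n%:R : A) = n%:R.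
Proof. by elim: n => [|n ih]; rewrite ?star0 // -natr1 starD star1 ih. Qed.

Lemma natr_rs n : n%:R = rs n%:R :> A.
Proof. by rewrite /rs rmorph_nat scaler_nat. Qed.

(** Only powers of [e] occur, so the identity is checked in the commutative ring of polynomials and
    evaluated at [e]. *)
Lemma cubic_identity e : (2 + e) * (1 - e) * (2 + e) = 4 - (3 * (e * e) + e * e * e).
Proof.
have h : (2 + 'X) * (1 - 'X) * (2 + 'X) = 4 - (3 * ('X * 'X) + 'X * 'X * 'X) :> {poly R[i]} by ring.
have := congr1 (horner_alg e) h.
by rewrite !(rmorphB, rmorphD, rmorphM, rmorph_nat, rmorph1) /= !horner_algX.
Qed.

Lemma star_newton y : star (newton y) = newton (star y).
Proof.
rewrite /newton starZR starM starD star_nat star_defect /defect starK; congr (_ *: _).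
by rewrite mulrDl mulrDr mulrBl mulrBr mul1r mulr1 mulrA mulr_natl mulr_natr.
Qed.

Lemma defect_newton y : defect (newton y) =
  (4^-1 : R)%:C *: (3 * (defect y * defect y) + defect y * defect y * defect y).
Proof.
set e := defect y.
have dE : star y * y = 1 - e by rewrite /e /defect subKr.
rewrite {1}/defect /newton -/e starZR starM starD star_nat star_defect -/e.
rewrite -scalerAl -scalerAr scalerA -rmorphM -[_ * star y * _]mulrA [star y * _]mulrA dE mulrA cubic_identity.
have -> : (2^-1 * 2^-1 : R) = 4^-1 by field.
rewrite scalerBr opprB addrC; suff -> : (4^-1 : R)%:C *: (4 : A) = 1 by rewrite subrK.
by rewrite natr_rs scaleRrs mulVf ?rs1 // pnatr_eq0.
Qed.

(** For [q <= 1/2], the value [(3 q^2 + q^3) / 4] is at most [q / 2]. *)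
Lemma cnorm_defect_newton y : cnorm (defect y) <= 2^-1 ->
  cnorm (defect (newton y)) <= cnorm (defect y) / 2.
Proof.
move=> h; rewrite defect_newton cnormZR ger0_norm ?invr_ge0 //.
set e := defect y in h *; set q := cnorm e in h *.
have q0 : 0 <= q by exact: cnorm_ge0.
have h1 := cnormM e e; have h2 := cnormM (e * e) e.
have h3 : cnorm (3 * (e * e)) <= 3 * (q * q).
  rewrite natr_rs rs_mull cnormZR normr_nat.
  by rewrite ler_pM2l.
have h4 := cnormD (3 * (e * e)) (e * e * e).
have h5 : cnorm (e * e * e) <= q * q * q.
  by apply: le_trans h2 _; apply: ler_wpM2r.
have h6 : q * q <= 2^-1 * q by apply: ler_wpM2r.
have h7 : q * q * q <= 2^-1 * q * q by apply: ler_wpM2r.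
nra.
Qed.

Lemma cnorm_le2_of_defect y : cnorm (defect y) <= 2^-1 -> cnorm y <= 2.
Proof.
move=> h; rewrite -ler_sqr ?nnegrE // -cnorm_star.
have -> : star y * y = 1 - defect y by rewrite /defect subKr.
have := cnormB 1 (defect y); rewrite cnorm1; lra.
Qed.

Lemma newton_step y : cnorm (defect y) <= 2^-1 -> cnorm (newton y - y) <= cnorm (defect y).
Proof.
move=> h; have -> : newton y - y = (2^-1 : R)%:C *: (y * defect y).
  have {2}-> : y = (2^-1 : R)%:C *: (y * 2).
    by rewrite natr_rs rs_mulr scalerA -rmorphM mulVf ?scale1r // pnatr_eq0.
  by rewrite -scalerBr -mulrBr addrC addKr.
rewrite cnormZR ger0_norm ?invr_ge0 //; have := cnormM y (defect y).
have := cnorm_le2_of_defect h; have := cnorm_ge0 (defect y); have := cnorm_ge0 y; nra.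
Qed.

Lemma iter_newton_defect n y : cnorm (defect y) <= 2^-1 ->
  cnorm (defect (iter n newton y)) <= cnorm (defect y) * 2^-1 ^+ n /\
  cnorm (defect (iter n newton y)) <= 2^-1.
Proof.
move=> h; elim: n => [|n [ih1 ih2]]; first by rewrite /= expr0 mulr1.
have h1 := cnorm_defect_newton ih2; have h2 := cnorm_ge0 (defect (iter n newton y)).
by rewrite iterS exprS; split; lra.
Qed.

Lemma iter_newton_cauchy n m y : cnorm (defect y) <= 2^-1 -> (n <= m)%N ->
  cnorm (iter m newton y - iter n newton y) <= 2 * cnorm (defect y) * 2^-1 ^+ n.
Proof.
move=> h nm; set q := cnorm (defect y).
have q0 : 0 <= q by exact: cnorm_ge0.
have pw k : 0 < (2^-1 : R) ^+ k by rewrite exprn_gt0 // invr_gt0.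
(* The sharper bound telescopes: step [m] costs [q * 2^-m], which is twice [q] times the drop from
   [2^-m] to [2^-(m+1)]. *)
suff : cnorm (iter m newton y - iter n newton y) <= 2 * q * (2^-1 ^+ n - 2^-1 ^+ m).
  move=> h1; apply: le_trans h1 _; apply: ler_wpM2l; first by rewrite mulr_ge0.
  by rewrite gerBl ltW.
elim: m nm => [|m ih]; first by rewrite leqn0 => /eqP->; rewrite !subrr cnorm0 mulr0.
rewrite leq_eqVlt => /orP[/eqP->|]; first by rewrite !subrr cnorm0 mulr0.
rewrite ltnS => nm; have h1 := ih nm.
have [h2 h3] := iter_newton_defect m h.
have h4 := newton_step h3.
have h5 := cnorm_trans (iter m newton y) (iter m.+1 newton y) (iter n newton y).
by rewrite iterS in h5 *; rewrite exprS; rewrite -/q in h2; lra.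
Qed.

Lemma star_iter_newton n y : star (iter n newton y) = iter n newton (star y).
Proof. by elim: n => // n ih; rewrite !iterS star_newton ih. Qed.

Lemma cvg_geom2 (c : R) : (fun n => c * (2^-1 : R) ^+ n) @ \oo --> (0 : R).
Proof.
have -> : (0 : R) = c * 0 by rewrite mulr0.
apply: cvgM; [exact: cvg_cst | apply: cvg_expr].
by rewrite ger0_norm // invf_lt1 // ltr1n.
Qed.

Lemma newton_limit_exists : exists W : A -> A, forall y, cnorm (defect y) <= 2^-1 ->
  ncvg \oo (fun n => iter n newton y) (W y) /\
  forall n, cnorm (W y - iter n newton y) <= 2 * cnorm (defect y) * 2^-1 ^+ n.
Proof.
have h y : exists W, cnorm (defect y) <= 2^-1 ->
    ncvg \oo (fun n => iter n newton y) W /\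
    forall n, cnorm (W - iter n newton y) <= 2 * cnorm (defect y) * 2^-1 ^+ n.
  have [hy|hy] := pselect (cnorm (defect y) <= 2^-1); last by exists 0.
  have [l hl hn] := complete_seq (cvg_geom2 (2 * cnorm (defect y)))
     (fun n m => @iter_newton_cauchy n m y hy).
  by exists l.
by have [W hW] := choice h; exists W.
Qed.

Lemma isometry_of_newton_limit y l : cnorm (defect y) <= 2^-1 ->
  ncvg \oo (fun n => iter n newton y) l -> star l * l = 1.
Proof.
move=> hy hl; apply: (ncvg_unique (ncvgM (ncvg_star hl) hl)).
apply: ncvg_squeeze (cvg_geom2 (cnorm (defect y))); apply: nearW => n.
by rewrite cnormBC; exact: (iter_newton_defect n hy).1.
Qed.

(** Both defects are assumed small because [defect y] alone yields only an isometry. Each iterate is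
    a polynomial in [y] and [star y], and the iterates converge uniformly where the defect is at
    most [1/2], so [W] is continuous there. *)
Theorem newton_unitary : exists W : A -> A,
  (forall y, cnorm (defect y) <= 2^-1 -> cnorm (defect (star y)) <= 2^-1 ->
     unitary (W y) /\ cnorm (W y - y) <= 2 * cnorm (defect y)) /\
  (forall (T : Type) (F : set_system T) (FF : ProperFilter F) (y : T -> A) y0,
     ncvg F y y0 -> (forall t, cnorm (defect (y t)) <= 2^-1) -> cnorm (defect y0) <= 2^-1 ->
     ncvg F (fun t => W (y t)) (W y0)).
Proof.
have [W hW] := newton_limit_exists; exists W; split.
  move=> y h1 h2; have [hl hn] := hW y h1; split; last first.
    by have := hn 0%N; rewrite expr0 mulr1.
  split; first exact: isometry_of_newton_limit hl.
  rewrite -{1}[W y]starK; apply: (isometry_of_newton_limit h2).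
  by apply: ncvg_eq (ncvg_star hl) => n; rewrite star_iter_newton.
move=> T F FF y y0 hy hd hd0; apply/ncvgP => e e0.
have [n hn] : exists n, (2^-1 : R) ^+ n < e / 3.
  have e3 : 0 < e / 3 by rewrite divr_gt0.
  have := cvg_geom2 1; move/cvgr_lt => /(_ _ e3) [n _ h]; exists n.
  by have := h n (leqnn n); rewrite /= mul1r.
have close z : cnorm (defect z) <= 2^-1 -> cnorm (W z - iter n newton z) < e / 3.
  move=> hz; apply: le_lt_trans hn; apply: le_trans ((hW z hz).2 n) _.
  rewrite ler_piMl ?exprn_ge0 ?invr_ge0 //; lra.
have hc : ncvg F (fun t => iter n newton (y t)) (iter n newton y0).
  elim: n {hn close} => [//|n ih] /=.
  apply: ncvgZ; first exact: cvg_cst.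
  apply: ncvgM => //; apply: ncvgD; first exact: ncvg_cst.
  apply: ncvgB; first exact: ncvg_cst.
  by apply: ncvgM => //; exact: ncvg_star.
have e3 : 0 < e / 3 by rewrite divr_gt0.
move/ncvgP : hc => /(_ _ e3); apply: filterS => t ht.
have h1 := close _ (hd t); have h2 := close _ hd0.
have h3 := cnorm_trans (iter n newton (y t)) (W (y t)) (W y0).
have h4 := cnorm_trans (iter n newton y0) (iter n newton (y t)) (W y0).
rewrite cnormBC in h2.
have : e = e / 3 + e / 3 + e / 3 by field.
lra.
Qed.

End NewtonUnitary.

Section SlowSampling.
Variables (R : realType) (B : cstarAlgType R) (u : R -> B).
Hypothesis hu : forall t : R, 0 <= t -> ncvg (within `[0, +oo[ (nbhs t)) u (u t).

Lemma path_modulus t (e : R) : 0 <= t -> 0 < e -> exists2 d : R, 0 < d &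
  forall s, 0 <= s -> `|t - s| < d -> cnorm (u s - u t) < e.
Proof.
move=> t0 e0; have := hu t0; move/cvgr_lt => /(_ _ e0).
move=> [d d0 hd]; exists d => // s s0 ts.
by apply: (hd s) => //=; rewrite in_itv /= s0.
Qed.

Let good (s h : R) := forall s', s <= s' -> s' <= s + h -> cnorm (u s' - u s) <= (1 + s)^-1.

(* Each step is the longest admissible dyadic one. If the samples accumulated at
   some [c], continuity at [c] would admit steps longer than the remaining gap. *)
Lemma slow_sampling : exists s : nat -> R,
  [/\ forall n, 0 <= s n, forall M : R, exists N, forall n, (N <= n)%N -> M <= s n &
      forall n, cnorm (u (s n.+1) - u (s n)) <= (1 + s n)^-1].
Proof.
have pw k : 0 < (2^-1 : R) ^+ k by rewrite exprn_gt0 // invr_gt0.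
have small (d : R) : 0 < d -> exists m, (2^-1 : R) ^+ m < d.
  have e0 := @cvg_geom2 R 1; move=> d0; move/cvgr_lt : e0 => /(_ _ d0) [m _ h].
  by exists m; have := h m (leqnn m); rewrite /= mul1r.
have hs s : exists n, 0 <= s ->
    good s (2^-1 ^+ n) /\ forall m, good s (2^-1 ^+ m) -> (n <= m)%N.
  have [s0|] := pselect (0 <= s); last by exists 0%N.
  have s1 : 0 < (1 + s)^-1 by rewrite invr_gt0 ltr_pwDl.
  have [d d0 hd] := path_modulus s0 s1; have [m hm] := small d d0.
  have ex : exists m, `[< good s (2^-1 ^+ m) >].
    exists m; apply/asboolP => s' h1 h2; apply/ltW/hd; first exact: le_trans h1.
    by rewrite distrC ger0_norm ?subr_ge0 //; lra.
  have [n /asboolP gn hn] := ex_minnP ex.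
  by exists n => _; split => // k gk; apply: hn; apply/asboolP.
have [k hk] := choice hs.
pose s := fix s n : R := if n is n'.+1 then s n' + 2^-1 ^+ k (s n') else 0.
have s0 n : 0 <= s n by elim: n => //= n ih; rewrite addr_ge0 // ltW.
have sS n : s n.+1 = s n + 2^-1 ^+ k (s n) by [].
have smono n m : (n <= m)%N -> s n <= s m.
  elim: m => [|m ih]; first by rewrite leqn0 => /eqP->.
  rewrite leq_eqVlt => /orP[/eqP->//|]; rewrite ltnS => /ih h.
  by apply: le_trans h _; rewrite sS lerDl ltW.
have good_s n : good (s n) (2^-1 ^+ k (s n)) by exact: (hk _ (s0 n)).1.
exists s; split=> //; last first.
  by move=> n; apply: good_s; rewrite sS // lerDl ltW.
move=> M; apply: contrapT => hM.
have sM n : s n <= M.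
  rewrite leNgt; apply/negP => nM; apply: hM; exists n => m nm.
  exact: le_trans (ltW nM) (smono _ _ nm).
have hsup : has_sup (range s).
  by split; [exists (s 0%N), 0%N | exists M => _ [n _ <-]].
set c := sup (range s).
have sc n : s n <= c by apply: ub_le_sup; [exact: hsup.2 | exists n].
have c0 : 0 <= c := le_trans (s0 0%N) (sc 0%N).
(* Half the tolerance at [c]: two points near [c] are compared through [u c], and the tolerance at
   [s j <= c] is no smaller. *)
have e0 : 0 < (1 + c)^-1 / 2 by rewrite divr_gt0 // invr_gt0 ltr_pwDl.
have [d d0 hd] := path_modulus c0 e0.
have d2 : 0 < d / 2 by rewrite divr_gt0.
have [m hm] := small _ d2.
(* The sample [s j] lies within [2^-m] of [c], so the admissible step [2^-m] would carry [s j.+1]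
   beyond the supremum. *)
have [_ [j _ <-] hj] := sup_adherent (pw m) hsup; rewrite -/c in hj.
have gj : good (s j) (2^-1 ^+ m).
  move=> s' h1 h2; have s'0 : 0 <= s' := le_trans (s0 j) h1.
  have dd : d / 2 + d / 2 = d by rewrite -splitr.
  have h3 : cnorm (u s' - u c) < (1 + c)^-1 / 2.
    apply: hd => //; rewrite ltr_norml; have sj := sc j; apply/andP; split; lra.
  have h4 : cnorm (u (s j) - u c) < (1 + c)^-1 / 2.
    apply: hd => //; rewrite ltr_norml; have sj := sc j; apply/andP; split; lra.
  have h5 : (1 + c)^-1 <= (1 + s j)^-1.
    by rewrite lef_pV2 ?posrE ?ltr_pwDl // lerD2l.
  have h6 := cnorm_trans (u c) (u s') (u (s j)); rewrite [cnorm (u c - _)]cnormBC in h6.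
  by apply: le_trans h5; lra.
have kj := (hk _ (s0 j)).2 _ gj.
have : (2^-1 : R) ^+ m <= 2^-1 ^+ k (s j).
  by apply: ler_wiXn2l => //; rewrite invf_le1 // ler1n.
by have := sc j.+1; rewrite sS; lra.
Qed.

End SlowSampling.

Section Interpolation.
Variables (R : realType).
Implicit Types (r : R).

(** Tent functions: on [[j, j + 1]] only [hat j] and [hat j.+1] can be nonzero, and they add up to
    [1]. *)
Definition hat (j : nat) r : R := Num.max 0 (1 - `|r - j%:R|).

Lemma hat_eq0 j r : 1 <= `|r - j%:R| -> hat j r = 0.
Proof. by move=> h; apply/max_idPl; rewrite subr_le0. Qed.

Lemma hat_left j r : j%:R <= r -> r <= j.+1%:R -> hat j r = 1 - (r - j%:R).
Proof.
move=> h1 h2; rewrite /hat ger0_norm ?subr_ge0 //; apply/max_idPr.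
by rewrite subr_ge0 lerBlDr nat1r.
Qed.

Lemma hat_right j r : j%:R <= r -> r <= j.+1%:R -> hat j.+1 r = r - j%:R.
Proof.
move=> h1 h2; rewrite /hat ler0_norm ?subr_le0 // opprB -natr1.
have -> : 1 - (j%:R + 1 - r) = r - j%:R by ring.
by apply/max_idPr; rewrite subr_ge0.
Qed.

Lemma hat_continuous j r : hat j x @[x --> r] --> hat j r.
Proof.
rewrite /hat; apply: (@continuous_max _ _ (fun=> 0) (fun x : R => 1 - `|x - j%:R|)).
  exact: cvg_cst.
apply: cvgB; first exact: cvg_cst.
by apply: cvg_norm; apply: cvgB; [exact: cvg_id | exact: cvg_cst].
Qed.

Definition nsupp r : nat := (Num.bound `|r|).+1.

Lemma hat_far r (n j : nat) : r < n%:R -> (n < j)%N -> hat j r = 0.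
Proof.
move=> rn nj; apply: hat_eq0; rewrite distrC ger0_norm.
  rewrite lerBrDr; apply: le_trans (_ : n.+1%:R <= _); last by rewrite ler_nat.
  by rewrite -natr1 addrC lerD2r ltW.
by rewrite subr_ge0; apply: le_trans (ltW rn) _; rewrite ler_nat ltnW.
Qed.

(* [F j h] is the [j]-th value with weight [h]. *)
Variables (V : zmodType) (F : nat -> R -> V).
Hypothesis F0 : forall j, F j 0 = 0.

Definition interpolate r : V := \sum_(j < nsupp r) F j (hat j r).

(** The number of terms in [interpolate] varies with [r]; a bound valid near a point replaces it, so
    that continuity concerns a fixed finite sum. *)
Lemma interpolateE r (n : nat) : r < n%:R -> interpolate r = \sum_(j < n.+1) F j (hat j r).
Proof.
move=> rn.
have far (m M : nat) : r < m%:R -> (m <= M)%N ->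
    \sum_(j < M.+1) F j (hat j r) = \sum_(j < m.+1) F j (hat j r).
  move=> rm mM.
  rewrite -[LHS](big_mkord predT (fun j => F j (hat j r))).
  rewrite -[RHS](big_mkord predT (fun j => F j (hat j r))).
  rewrite (@big_cat_nat _ _ _ m.+1) //= ?ltnS // [X in _ + X]big1_seq ?addr0 // => j.
  by rewrite mem_index_iota /= => /andP[mj _]; rewrite (hat_far rm mj).
have rb : r < (Num.bound `|r|)%:R.
  by apply: le_lt_trans (ler_norm r) _; exact: archi_boundP.
rewrite /interpolate /nsupp.
by case/orP: (leq_total n (Num.bound `|r|)) => h; [exact: far | rewrite -(far _ _ rb h)].
Qed.

Lemma interpolate_segment r (j : nat) : j%:R <= r -> r < j.+1%:R ->
  interpolate r = F j (1 - (r - j%:R)) + F j.+1 (r - j%:R).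
Proof.
move=> h1 h2; rewrite (interpolateE h2) !big_ord_recr /=.
rewrite (hat_left h1 (ltW h2)) (hat_right h1 (ltW h2)) big1 ?add0r // => i _.
rewrite hat_eq0 // ger0_norm.
  rewrite lerBrDr; apply: le_trans h1; rewrite addrC natr1 ler_nat.
  exact: ltn_ord.
by rewrite subr_ge0; apply: le_trans h1; rewrite ler_nat ltnW.
Qed.

End Interpolation.

Section InterpolationContinuity.
Variables (R : realType).

Lemma cvg_sum_ord (T : Type) (F : set_system T) (FF : Filter F) n (f : 'I_n -> T -> R) (l : 'I_n -> R) :
  (forall i, f i @ F --> l i) -> (fun t => \sum_i f i t) @ F --> \sum_i l i.
Proof.
elim: n f l => [|n ih] f l h.
  by rewrite big_ord0; under eq_fun do rewrite big_ord0; exact: cvg_cst.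
rewrite big_ord_recl; under eq_fun do rewrite big_ord_recl.
by apply: cvgD => //; apply: ih.
Qed.

Lemma lt_nat_near (r : R) : exists n : nat, r < n%:R /\ \forall x \near r, x < n%:R.
Proof.
exists (Num.bound (`|r| + 1)).
have h : r < (Num.bound (`|r| + 1))%:R.
  apply: le_lt_trans (_ : `|r| + 1 < _); last by apply: archi_boundP; rewrite addr_ge0.
  by apply: le_trans (ler_norm r) _; rewrite lerDl.
by split=> //; exact: lt_nbhsl.
Qed.

Lemma interpolate_cvgR (T : nat -> R) (r : R) :
  interpolate (fun j h => h * T j) x @[x --> r] --> interpolate (fun j h => h * T j) r.
Proof.
have F0 j : 0 * T j = 0 by rewrite mul0r.
have [n [rn hn]] := lt_nat_near r; rewrite (interpolateE F0 rn).
have h : (fun x => \sum_(j < n.+1) hat j x * T j) @ r --> \sum_(j < n.+1) hat j r * T j.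
  by apply: cvg_sum_ord => i; apply: cvgM; [exact: hat_continuous | exact: cvg_cst].
apply: cvg_trans h; apply: near_eq_cvg; apply: filterS hn => x xn.
by rewrite (interpolateE F0 xn).
Qed.

Lemma interpolate_ncvg (A : cstarAlgType R) (P : nat -> R -> A) (tau : R -> R) (r : R) :
  tau x @[x --> r] --> tau r -> (forall j t, ncvg (nbhs t) (P j) (P j t)) ->
  ncvg (nbhs r) (fun x => interpolate (fun j h => h%:C *: P j (tau x)) x)
    (interpolate (fun j h => h%:C *: P j (tau r)) r).
Proof.
move=> ht hP; have F0 x j : 0%:C *: P j (tau x) = 0 by rewrite scale0r.
have [n [rn hn]] := lt_nat_near r; rewrite (interpolateE (F0 r) rn).
have h : ncvg (nbhs r) (fun x => \sum_(j < n.+1) (hat j x)%:C *: P j (tau x))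
    (\sum_(j < n.+1) (hat j r)%:C *: P j (tau r)).
  apply: ncvg_sum => j; apply: ncvgZ; first exact: hat_continuous.
  exact: (cvg_comp _ _ ht (hP j (tau r))).
apply: cvg_trans h; apply: near_eq_cvg; apply: filterS hn => x xn.
by rewrite (interpolateE (F0 x) xn).
Qed.

End InterpolationContinuity.

Section PathConstruction.
Variables (R : realType) (A : cstarAlgType R).
Variables (G : groupType) (alpha : action G A) (B : crossed_product alpha).

Lemma conj_perturb (E : cstarAlgType R) (x y z : E) :
  cnorm (x * z * star x - y * z * star y) <= cnorm (x - y) * (cnorm x + cnorm y) * cnorm z.
Proof.
have -> : x * z * star x - y * z * star y = (x - y) * z * star x + y * z * star (x - y).
  by rewrite starB mulrBr !mulrBl subrKA.
apply: le_trans (cnormD _ _) _.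
have h1 : cnorm ((x - y) * z * star x) <= cnorm (x - y) * cnorm z * cnorm x.
  apply: le_trans (cnormM _ _) _; rewrite cnorm_starE; apply: ler_wpM2r => //.
  exact: cnormM.
have h2 : cnorm (y * z * star (x - y)) <= cnorm y * cnorm z * cnorm (x - y).
  apply: le_trans (cnormM _ _) _; rewrite cnorm_starE; apply: ler_wpM2r => //.
  exact: cnormM.
by apply: le_trans (lerD h1 h2) _; rewrite le_eqVlt; apply/orP; left; apply/eqP; ring.
Qed.

Lemma defect_perturb (E : cstarAlgType R) (x y : E) :
  cnorm (defect x) <= cnorm (defect y) + cnorm (x - y) * (cnorm x + cnorm y).
Proof.
have -> : defect x = defect y + (star y * y - star x * x).
  by rewrite /defect addrA subrK.
apply: le_trans (cnormD _ _) _; rewrite lerD2l.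
have := conj_perturb (star y) (star x) 1.
rewrite !mulr1 !starK cnorm1 mulr1 -starB !cnorm_starE cnormBC.
by rewrite [cnorm y + _]addrC.
Qed.

Lemma defect_unitary (E : cstarAlgType R) (x : E) : unitary x -> defect x = 0.
Proof. by move=> [h _]; rewrite /defect h subrr. Qed.

Lemma unitary_star (E : cstarAlgType R) (x : E) : unitary x -> unitary (star x).
Proof. by move=> [h1 h2]; split; rewrite starK. Qed.

Variable v : G -> R -> A.
Hypothesis v_unitary : forall g t, unitary (v g t).
Hypothesis v_cont : forall g t, ncvg (nbhs t) (v g) (v g t).
Hypothesis v_mul : forall g h,
  cnorm (v g t * v h t - v (g * h)%g t) @[t --> +oo] --> (0 : R).
Hypothesis v_conj : forall g h,
  cnorm (alpha g (v h t) - v (g * h * g^-1)%g t) @[t --> +oo] --> (0 : R).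
Hypothesis v_act : forall g a,
  cnorm (v g t * a * star (v g t) - alpha g a) @[t --> +oo] --> (0 : R).

Variables (D : cstarAlgType R) (rho sigma : {starhom D -> B}).

(** The shape required by [intertwining_lift]: the same [k] serves both homomorphisms. By
    equivariance the generators of [D] have it, those from [C] with [k] the identity. *)
Definition tracked (x : D) : Prop := exists k s r,
  sigma x = cp_emb B s * cp_unit B k /\ rho x = cp_emb B r * cp_unit B k.

Lemma cp_poly_lift_cont n (a : 'I_n -> A) (g : 'I_n -> G) t :
  ncvg (nbhs t) (cp_poly_lift v a g) (cp_poly_lift v a g t).
Proof. by apply: ncvg_sum => i; apply: ncvgM => //; exact: ncvg_cst. Qed.

Variables (x : nat -> D) (w : nat -> B) (b : nat -> R).
Hypothesis x_tracked : forall k, tracked (x k).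
Hypothesis w_unitary : forall j, unitary (w j).
Hypothesis w_conj : forall k, ncvg \oo (fun j => w j * sigma (x k) * star (w j)) (rho (x k)).
(** The error budget [b j] covers the jump of [w] and three errors of size [1 / j.+1]: approximating
    [w j] and [w j.+1] by polynomials, and lifting their difference. *)
Hypothesis w_slow : forall j, cnorm (w j.+1 - w j) + 3 / j.+1%:R <= b j.
Hypothesis b_lim : b @ \oo --> (0 : R).
Hypothesis b_le : forall j, b j <= 4.

Let eta (j : nat) : R := j.+1%:R^-1.
Let eta_gt0 j : 0 < eta j. Proof. by rewrite invr_gt0. Qed.
Let eta_le1 j : eta j <= 1. Proof. by rewrite invf_le1 // ler1n. Qed.
Let eta_dec j : eta j.+1 <= eta j. Proof. by rewrite lef_pV2 ?posrE // ler_nat. Qed.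
Let eta_b j : 3 * eta j <= b j.
Proof. by apply: le_trans (w_slow j); rewrite -/(eta j) lerDr. Qed.

Let poly_data := {n : nat & (('I_n -> A) * ('I_n -> G))%type}.
Let pol (p : poly_data) : B := cp_poly B (projT2 p).1 (projT2 p).2.
Let lft (p : poly_data) : R -> A := cp_poly_lift v (projT2 p).1 (projT2 p).2.

Let pol_near j : exists p : poly_data, cnorm (w j - pol p) < eta j.
Proof.
have [_ [n [a [g ->]]] h] := @dense_approx R B _ (w j) (eta j) (cp_dense (c := B)) (eta_gt0 j).
by exists (existT _ n (a, g)).
Qed.

(** What the lifts satisfy at late times. Of [4 * eta j], three parts come from the defect of the
    polynomial and one from lifting. Only [k <= j] is asked, so finitely many eventual conditions
    hold from a common time on. *)
Let stage (p : nat -> poly_data) (j : nat) (t : R) : Prop :=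
  [/\ cnorm (defect (lft (p j) t)) < 4 * eta j,
      cnorm (defect (star (lft (p j) t))) < 4 * eta j,
      cnorm (lft (p j) t - lft (p j.+1) t) < b j &
      forall k, (k < j.+1)%N ->
        cnorm (cp_emb B (lft (p j) t) * sigma (x k) * star (cp_emb B (lft (p j) t)) - rho (x k)) <
        cnorm (w j * sigma (x k) * star (w j) - rho (x k)) + b j * (2 * cnorm (x k) + 1)].

Let stage_near (p : nat -> poly_data) j : (forall j, cnorm (w j - pol (p j)) < eta j) ->
  \forall t \near +oo, stage p j t.
Proof.
move=> hp.
have lift q : islift v (pol q) (lft q) by exact: islift_cp_poly.
have nb (q : B) (e : R) f : islift v q f -> 0 < e -> \forall t \near +oo, cnorm (f t) < cnorm q + e.
  exact: islift_near.
have np j' : cnorm (pol (p j')) <= 1 + eta j'.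
  have := cnorm_trans (w j') (pol (p j')) 0; rewrite !subr0 cnormBC.
  rewrite (cnorm_unitary (w_unitary j')); have := hp j'; lra.
have wp : cnorm (pol (p j) - w j) < eta j by rewrite cnormBC.
have w1 := cnorm_unitary (w_unitary j).
have e0 := eta_gt0 j; have e1 := eta_le1 j; have npj := np j.
have d1 : cnorm (defect (pol (p j))) <= 3 * eta j.
  have := defect_perturb (pol (p j)) (w j); rewrite (defect_unitary (w_unitary j)) cnorm0 add0r w1.
  have := cnorm_ge0 (pol (p j) - w j); nra.
have d2 : cnorm (defect (star (pol (p j)))) <= 3 * eta j.
  have := defect_perturb (star (pol (p j))) (star (w j)).
  rewrite (defect_unitary (unitary_star (w_unitary j))) cnorm0 add0r -starB !cnorm_starE w1.
  have := cnorm_ge0 (pol (p j) - w j); nra.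
have d3 : cnorm (pol (p j) - pol (p j.+1)) + eta j <= b j.
  have h1 := cnorm_trans (w j) (pol (p j)) (pol (p j.+1)).
  have h2 := cnorm_trans (w j.+1) (w j) (pol (p j.+1)).
  have := hp j.+1; have := eta_dec j; have := w_slow j; rewrite -/(eta j) cnormBC; lra.
have d4 k : cnorm (pol (p j) * sigma (x k) * star (pol (p j)) - rho (x k)) <=
    cnorm (w j * sigma (x k) * star (w j) - rho (x k)) + b j * (2 * cnorm (x k)).
  have h1 := cnorm_trans (w j * sigma (x k) * star (w j))
    (pol (p j) * sigma (x k) * star (pol (p j))) (rho (x k)).
  have h2 := conj_perturb (pol (p j)) (w j) (sigma (x k)); rewrite w1 in h2.
  have h3 := starhom_le sigma (x k).
  have h4 : cnorm (pol (p j) - w j) * (cnorm (pol (p j)) + 1) * cnorm (sigma (x k)) <=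
      (3 * eta j) * cnorm (x k).
    apply: ler_pM => //; first by rewrite mulr_ge0 // addr_ge0.
    have := cnorm_ge0 (pol (p j) - w j); nra.
  have h5 : (3 * eta j) * cnorm (x k) <= b j * cnorm (x k) by apply: ler_wpM2r.
  have h6 : 0 <= b j * cnorm (x k).
    by apply: le_trans h5; rewrite mulr_ge0 // mulr_ge0 // ltW.
  by apply: le_trans h1 _; rewrite addrC lerD2l mulrCA; lra.
have n1 := nb _ _ _ (isliftB (islift1 B v) (isliftM (islift_star (lift (p j))) (lift (p j)))) e0.
have n2 := nb _ _ _ (isliftB (islift1 B v)
   (isliftM (islift_star (islift_star (lift (p j)))) (islift_star (lift (p j))))) e0.
have n3 := nb _ _ _ (isliftB (lift (p j)) (lift (p j.+1))) e0.
have n4 : \forall t \near +oo, forall k, (k < j.+1)%N ->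
   cnorm (cp_emb B (lft (p j) t) * sigma (x k) * star (cp_emb B (lft (p j) t)) - rho (x k)) <
   cnorm (pol (p j) * sigma (x k) * star (pol (p j)) - rho (x k)) + eta j.
  apply: filter_forall_lt => k _; have [k' [s [r [hs hr]]]] := x_tracked k.
  exact: (intertwining_lift v_unitary v_mul v_conj v_act _ _ hs hr e0).
apply: filterS (filterI (filterI n1 n2) (filterI n3 n4)) => t [[h1 h2] [h3 h4]]; split.
- by apply: lt_le_trans h1 _; rewrite -/(defect (pol (p j))); lra.
- by apply: lt_le_trans h2 _; rewrite -/(defect (star (pol (p j)))); lra.
- exact: lt_le_trans h3 d3.
- move=> k kj; apply: lt_le_trans (h4 k kj) _; have := d4 k; have := eta_b j; lra.
Qed.

Lemma unitary_path_construction : exists U : R -> A,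
  [/\ forall t, unitary (U t), forall t, ncvg (nbhs t) U (U t) &
      forall k, ncvg +oo (fun t => cp_emb B (U t) * sigma (x k) * star (cp_emb B (U t)))
                     (rho (x k))].
Proof.
have [p hp] := choice pol_near.
have hT j : exists T : R, forall t, T <= t -> stage p j t.
  have [M [_ hM]] := stage_near j hp.
  by exists (M + 1) => t Mt; apply: hM; apply: lt_le_trans Mt; rewrite ltrDl.
have [T' hT'] := choice hT.
(* Running maxima of the thresholds, so that [T] is nondecreasing. *)
pose T := fix T j : R := if j is j'.+1 then Num.max (T j') (T' j) else T' 0%N.
have TS j : T j <= T j.+1 by rewrite /= le_max lexx.
have TT' j : T' j <= T j by case: j => //= j; rewrite le_max lexx orbT.
pose P j := lft (p j).
(* The clock: on [[j, j + 1]] it is at least [T j], so stage [j] is in force. Neighbouring lifts are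
   read at the same time [tau r], as the comparison in [stage] requires. *)
pose tau r := interpolate (fun j h => h * T j) r.
have tau_c r : tau z @[z --> r] --> tau r by exact: interpolate_cvgR.
have P_c j t : ncvg (nbhs t) (P j) (P j t) by exact: cp_poly_lift_cont.
pose y (r : R) : A := interpolate (fun j h => h%:C *: P j (tau r)) r.
have y_c r : ncvg (nbhs r) y (y r) by exact: interpolate_ncvg.
have b0 j : 0 <= b j by apply: le_trans (eta_b j); rewrite mulr_ge0 // ltW.
(* In [14 * b j], four parts cover [4 * eta j], and ten cover [cnorm (y r - P j (tau r))] times the
   sum of the norms of [y r] and [P j (tau r)], which is at most [(3 + 4) + 3]. *)
have est (r : R) j : j%:R <= r -> r < j.+1%:R -> [/\ stage p j (tau r),
    cnorm (y r - P j (tau r)) <= b j, cnorm (defect (y r)) <= 14 * b j,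
    cnorm (defect (star (y r))) <= 14 * b j & cnorm (P j (tau r)) <= 3].
  move=> h1 h2; set th := r - j%:R.
  have th0 : 0 <= th by rewrite subr_ge0.
  have th1 : th <= 1 by move: h2; rewrite -natr1 /th; lra.
  have tauE : tau r = (1 - th) * T j + th * T j.+1.
    by rewrite /tau (interpolate_segment _ h1 h2) // => i; rewrite mul0r.
  have Ttau : T j <= tau r by rewrite tauE; have := TS j; nra.
  have st : stage p j (tau r) by apply: hT'; apply: le_trans (TT' j) Ttau.
  have [s1 s2 s3 s4] := st.
  have yE : y r = (1 - th)%:C *: P j (tau r) + th%:C *: P j.+1 (tau r).
    by rewrite /y (interpolate_segment _ h1 h2) // => i; rewrite scale0r.
  have yP : cnorm (y r - P j (tau r)) <= b j.
    have -> : y r - P j (tau r) = th%:C *: (P j.+1 (tau r) - P j (tau r)).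
      by rewrite yE rmorphB rmorph1 scalerBl scale1r scalerBr addrAC
         [X in X + _]addrAC subrr sub0r addrC.
    rewrite cnormZR ger0_norm // cnormBC; have := cnorm_ge0 (P j (tau r) - P j.+1 (tau r)).
    by move: s3; rewrite -/(P _) -/(P _); have := b0 j; nra.
  have P3 : cnorm (P j (tau r)) <= 3.
    rewrite -ler_sqr ?nnegrE // -cnorm_star.
    have -> : star (P j (tau r)) * P j (tau r) = 1 - defect (P j (tau r)) by rewrite /defect subKr.
    have := cnormB 1 (defect (P j (tau r))); rewrite cnorm1; have := eta_le1 j.
    move: s1; rewrite -/(P j); lra.
  have y3 : cnorm (y r) <= 3 + b j.
    have := cnorm_trans (P j (tau r)) (y r) 0; rewrite !subr0; lra.
  have eb := eta_b j; have b4 := b_le j; have yp0 := cnorm_ge0 (y r - P j (tau r)).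
  have prod : cnorm (y r - P j (tau r)) * (cnorm (y r) + cnorm (P j (tau r))) <= b j * 10.
    by apply: ler_pM => //; [rewrite addr_ge0 | lra].
  split=> //.
    by apply: le_trans (defect_perturb _ (P j (tau r))) _; move: s1; rewrite -/(P j); lra.
  apply: le_trans (defect_perturb _ (star (P j (tau r)))) _; rewrite -starB !cnorm_starE.
  by move: s2; rewrite -/(P j); lra.
have [J hJ] : exists J, forall j, (J <= j)%N -> 14 * b j <= 2^-1.
  have e0 : 0 < 2^-1 / 14 :> R by rewrite divr_gt0 // invr_gt0.
  move/cvgr_lt : b_lim => /(_ _ e0) [J _ h]; exists J => j Jj.
  by have := h j Jj; rewrite /= ltr_pdivlMr // mulrC => /ltW.
have idx (r : R) : 0 <= r -> exists j : nat, j%:R <= r /\ r < j.+1%:R.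
  by move=> r0; exists (Num.truncn r); have /andP[] := truncn_itv r0.
have idxJ (r : R) : exists j, [/\ (J <= j)%N, j%:R <= `|r| + J%:R & `|r| + J%:R < j.+1%:R].
  have [j [h1 h2]] : exists j : nat, j%:R <= `|r| + J%:R /\ `|r| + J%:R < j.+1%:R.
    by apply: idx; rewrite addr_ge0.
  exists j; split=> //; rewrite -ltnS -(ltr_nat R); apply: le_lt_trans h2.
  by rewrite lerDr.
(* From parameter [J] on, the defects are within the domain of the Newton iteration; the absolute
   value makes the path defined and continuous on the whole line. *)
pose z (r : R) : A := y (`|r| + J%:R).
have z_def (r : R) : cnorm (defect (z r)) <= 2^-1 /\ cnorm (defect (star (z r))) <= 2^-1.
  have [j [Jj h1 h2]] := idxJ r; have [_ _ e1 e2 _] := est _ _ h1 h2.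
  by split; [apply: le_trans e1 _ | apply: le_trans e2 _]; exact: hJ.
have [W [hW1 hW2]] := newton_unitary A.
exists (fun r => W (z r)); split.
- by move=> r; have [h1 h2] := z_def r; have [] := hW1 _ h1 h2.
- move=> r; apply: hW2.
  + have c : `|q| + J%:R @[q --> r] --> `|r| + J%:R.
      by apply: cvgD; [apply: cvg_norm; exact: cvg_id | exact: cvg_cst].
    exact: (cvg_comp _ _ c (y_c _)).
  + by move=> t; have [] := z_def t.
  + by have [] := z_def r.
move=> k; set C := cnorm (x k).
(* The unitary is within [29 * b j] of the lift: [2 * 14] from Newton and [1] from interpolation.
   Conjugation costs a factor [4 * C], and [stage] adds [2 * C]; [116 + 2] is rounded up to
   [200]. *)
pose E j := cnorm (w j * sigma (x k) * star (w j) - rho (x k)) + b j * (200 * C + 1).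
have E_lim : E @ \oo --> (0 : R).
  have -> : (0 : R) = 0 + 0 * (200 * C + 1) by rewrite mul0r addr0.
  by apply: cvgD; [exact: w_conj | apply: cvgM => //; exact: cvg_cst].
have C0 : 0 <= C by exact: cnorm_ge0.
have key (r : R) j : (J <= j)%N -> (k <= j)%N -> j%:R <= `|r| + J%:R -> `|r| + J%:R < j.+1%:R ->
    cnorm (cp_emb B (W (z r)) * sigma (x k) * star (cp_emb B (W (z r))) - rho (x k)) <= E j.
  move=> Jj kj h1 h2; have [[_ _ _ s4] yP d1 d2 P3] := est _ _ h1 h2.
  have [z1 z2] := z_def r; have [uW nW] := hW1 _ z1 z2.
  set Q := P j (tau (`|r| + J%:R)) in yP P3.
  have WQ : cnorm (W (z r) - Q) <= 29 * b j.
    have := cnorm_trans (z r) (W (z r)) Q; rewrite -/(z r) in yP d1 *; lra.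
  have t1 := cnorm_trans (cp_emb B Q * sigma (x k) * star (cp_emb B Q))
    (cp_emb B (W (z r)) * sigma (x k) * star (cp_emb B (W (z r)))) (rho (x k)).
  have t2 := s4 k kj.
  have t3 := conj_perturb (cp_emb B (W (z r))) (cp_emb B Q) (sigma (x k)).
  have t4 : cnorm (cp_emb B (W (z r)) - cp_emb B Q) <= 29 * b j.
    by rewrite -rmorphB; apply: le_trans (starhom_le _ _) WQ.
  have t5 : cnorm (cp_emb B (W (z r))) + cnorm (cp_emb B Q) <= 4.
    have := starhom_le (cp_emb B) (W (z r)); rewrite (cnorm_unitary uW).
    have := starhom_le (cp_emb B) Q; lra.
  have t6 : cnorm (cp_emb B (W (z r)) - cp_emb B Q) *
      (cnorm (cp_emb B (W (z r))) + cnorm (cp_emb B Q)) * cnorm (sigma (x k)) <= 29 * b j * 4 * C.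
    apply: ler_pM => //; [by rewrite mulr_ge0 // addr_ge0 | | exact: starhom_le].
    by apply: ler_pM => //; rewrite addr_ge0.
  have t7 : 0 <= b j * C by rewrite mulr_ge0.
  rewrite -/C -/Q in t2; apply: le_trans t1 _; rewrite /E -/C.
  have e1 : 29 * b j * 4 * C = 116 * (b j * C) by ring.
  have e2 : b j * (200 * C + 1) = 200 * (b j * C) + b j by ring.
  have e3 : b j * (2 * C + 1) = 2 * (b j * C) + b j by ring.
  lra.
apply/ncvgP => e e0; move/cvgr_lt : E_lim => /(_ _ e0) [N _ hN].
exists ((maxn N (maxn J k)).+1)%:R; split; first exact: num_real.
move=> t ht.
have [j [Jj h1 h2]] := idxJ t.
have tj : (maxn N (maxn J k) <= j)%N.
  rewrite -ltnS -(ltr_nat R); apply: le_lt_trans h2; apply: le_trans (_ : t <= _).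
    by apply/ltW/(le_lt_trans _ ht); rewrite ler_nat.
  by apply: le_trans (ler_norm t) _; rewrite lerDl.
move: tj; rewrite !geq_max => /and3P[Nj _ kj].
by apply: le_lt_trans (key t j Jj kj h1 h2) _; exact: hN.
Qed.

End PathConstruction.

(** * From generators of [D] to all of [D], and the equivalence *)

Lemma countable_enum (T : Type) (Z : set T) : countable Z -> Z !=set0 ->
  exists2 x : nat -> T, (forall k, Z (x k)) & forall z, Z z -> exists k, x k = z.
Proof.
move=> /countable_injP[f finj] [z0 Zz0].
have hx k : exists z, Z z /\ forall z', Z z' -> f z' = k -> z = z'.
  have [[z [Zz fz]]|nz] := pselect (exists z, Z z /\ f z = k).
    by exists z; split=> // z' Zz' fz'; apply: finj; rewrite ?inE // fz.
  by exists z0; split=> // z' Zz' fz'; case: nz; exists z'.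
have [x hxx] := choice hx; exists x => [k|z Zz]; first exact: (hxx k).1.
by exists (f z); exact: (hxx (f z)).2.
Qed.

Section Intertwining.
Variables (R : realType) (D B : cstarAlgType R) (rho sigma : {starhom D -> B}).
Variable u : R -> B.
Hypothesis u_unitary : forall t, unitary (u t).

(** The lemmas of this section make [X] a closed subring of [D]. Closure under adjoints need not be
    invoked, because finite sums of products [cp_emb D a * cp_unit D g] are dense. *)
Let X := [set x | ncvg +oo (fun t => u t * sigma x * star (u t)) (rho x)].

Lemma intertwinedD x y : X x -> X y -> X (x + y).
Proof.
rewrite /X /= !rmorphD => hx hy; apply: ncvg_eq (ncvgD hx hy) => t.
by rewrite mulrDr mulrDl.
Qed.

Lemma intertwinedM x y : X x -> X y -> X (x * y).
Proof.
rewrite /X /= !starhomM => hx hy; apply: ncvg_eq (ncvgM hx hy) => t.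
by rewrite !mulrA -[u t * _ * _ * _]mulrA (u_unitary t).1 mulr1.
Qed.

Lemma intertwined_sum n (x : 'I_n -> D) : (forall i, X (x i)) -> X (\sum_i x i).
Proof.
move=> hx; elim/big_rec: _ => [|i y _ hy]; last exact: intertwinedD.
by rewrite /X /= !rmorph0; apply: ncvg_eq (ncvg_cst 0) => t; rewrite mulr0 mul0r.
Qed.

Lemma intertwined_closed x : (forall e : R, 0 < e -> exists2 y, X y & cnorm (x - y) < e) -> X x.
Proof.
move=> hx; apply/ncvgP => e e0; have e3 : 0 < e / 3 by lra.
have [y /ncvgP hy xy] := hx _ e3; apply: filterS (hy _ e3) => t ht.
have -> : u t * sigma x * star (u t) - rho x =
  u t * sigma (x - y) * star (u t) + (u t * sigma y * star (u t) - rho y) - rho (x - y).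
  by rewrite !rmorphB mulrBr mulrBl subrKA opprB subrKA.
have h1 : cnorm (u t * sigma (x - y) * star (u t)) <= cnorm (x - y).
  apply: le_trans (cnormM _ _) _; rewrite cnorm_starE (cnorm_unitary (u_unitary t)) mulr1.
  apply: le_trans (cnormM _ _) _; rewrite (cnorm_unitary (u_unitary t)) mul1r.
  exact: starhom_le.
have h2 := starhom_le rho (x - y).
apply: le_lt_trans (cnormB _ _) _; move: (cnormD (u t * sigma (x - y) * star (u t))
  (u t * sigma y * star (u t) - rho y)); lra.
Qed.

End Intertwining.

Section Main.
Variables (R : realType) (G : groupType).

(** Precomposition with the absolute value extends the paths from the half line to [R], so that
    unitarity and continuity hold at every [t]; limits at [+oo] do not change. *)
Lemma asymptotically_representable_cont (A : cstarAlgType R) (alpha : action G A) :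
  asymptotically_representable alpha -> exists v : G -> R -> A,
    [/\ (forall g t, unitary (v g t)) /\ (forall g t, ncvg (nbhs t) (v g) (v g t)),
        (forall g h, cnorm (v g t * v h t - v (g * h)%g t) @[t --> +oo] --> (0 : R)),
        (forall g h,
           cnorm (alpha g (v h t) - v (g * h * g^-1)%g t) @[t --> +oo] --> (0 : R)) &
        forall g a, cnorm (v g t * a * star (v g t) - alpha g a) @[t --> +oo] --> (0 : R)].
Proof.
move=> [v [vp vM vJ va]]; exists (fun g t => v g `|t|).
have eq0 (f h : R -> R) : (forall t, 0 <= t -> f t = h t) ->
    f t @[t --> +oo] --> (0 : R) -> h t @[t --> +oo] --> (0 : R).
  move=> fh; apply: cvg_trans; apply: near_eq_cvg.
  by exists 0; split => // t /ltW /fh ->.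
split.
- split=> [g t|g t]; first by have [_ ] := vp g; apply.
  have [/subspace_continuousP vc _] := vp g.
  have /cnorm_cvgP h := vc `|t| (ltac:(by rewrite /= in_itv /= normr_ge0)).
  apply: (cvg_comp _ _ _ h) => //.
  have c : `|q| @[q --> t] --> `|t| by apply: cvg_norm; exact: cvg_id.
  move=> P hP; have : \forall q \near t, `[0, +oo[%classic `|q| -> P `|q| by exact: c _ hP.
  by apply: filterS => q; apply; rewrite /= in_itv /= normr_ge0.
- by move=> g h; apply: eq0 (vM g h) => t t0; rewrite ger0_norm.
- by move=> g h; apply: eq0 (vJ g h) => t t0; rewrite ger0_norm.
- by move=> g a; apply: eq0 (va g a) => t t0; rewrite ger0_norm.
Qed.

Lemma intertwiner_in_base (A C : cstarAlgType R) (alpha : action G A) (gamma : action G C)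
    (B : crossed_product alpha) (D : crossed_product gamma) (CG : group_cstar R G)
    (BG : cstar_tensor B CG) (DG : cstar_tensor D CG)
    (alpha_hat : {starhom B -> BG}) (gamma_hat : {starhom D -> DG})
    (rho sigma : {starhom D -> B}) (u : R -> B) :
  countable [set: G] -> asymptotically_representable alpha -> separable C ->
  dual_coaction alpha_hat -> dual_coaction gamma_hat ->
  equivariant_hom gamma_hat alpha_hat rho -> equivariant_hom gamma_hat alpha_hat sigma ->
  asymptotic_intertwiner rho sigma u -> Ghat_asymp_unitarily_equiv rho sigma.
Proof.
move=> Gc /asymptotically_representable_cont[v [[v_un v_c] v_m v_j v_a]] [S Sc Sd] ha hg hr hs.
move=> [[/subspace_continuousP uc u_un] u_lim].
have iso := cp_emb_isometric B v_un v_m v_a.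
have cpu := (cp_covariant B).1.
(* A countable set of tracked elements that generates a dense subalgebra of [D]: here separability
   of [C] and countability of [G] enter. *)
pose Z := cp_emb D @` S `|` range (cp_unit D).
have Zc : countable Z.
  rewrite /Z -bigcup2E; apply: bigcup_countable => [|[|[|i]] _ //=].
  - exact: countableP.
  - exact: sub_countable (card_image_le _ _) Sc.
  - exact: sub_countable (card_image_le _ _) Gc.
have Z0 : Z !=set0 by exists (cp_unit D 1%g); right; exists 1%g.
have [x xZ Zx] := countable_enum Zc Z0.
have x_tr k : tracked rho sigma (x k).
  have [[c _ <-]|[g _ <-]] := xZ k.
    have [s s_] := equivariant_emb ha iso hg hs c.
    have [r r_] := equivariant_emb ha iso hg hr c.
    by exists 1%g, s, r; rewrite (rep1 cpu) !mulr1.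
  have [s s_] := equivariant_unit ha iso hg hs g.
  have [r r_] := equivariant_unit ha iso hg hr g.
  by exists g, s, r.
have uc' (t : R) : 0 <= t -> ncvg (within `[0, +oo[ (nbhs t)) u (u t).
  move=> t0; apply/cnorm_cvgP; apply: uc; by rewrite /= in_itv /= t0.
have [s [s0 s_oo s_slow]] := slow_sampling uc'.
have s_cvg : s @ \oo --> +oo.
  apply/cvgryPge => M; have [N hN] := s_oo M.
  by exists N => // n /= /hN.
(* The jump allowed by slow sampling plus the polynomial and lifting errors; it tends to [0] because
   the sampling times are unbounded. *)
pose b (j : nat) : R := (1 + s j)^-1 + 3 / j.+1%:R.
have b_lim : b @ \oo --> (0 : R).
  have -> : (0 : R) = 0 + 3 * 0 by rewrite mulr0 addr0.
  apply: cvgD; last by apply: cvgM; [exact: cvg_cst | exact: cvg_harmonic].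
  apply/cvgrPdist_lt => e e0; have [N hN] := s_oo e^-1; exists N => // n /= /hN sn.
  have e1 : 0 < e^-1 by rewrite invr_gt0.
  rewrite sub0r normrN ger0_norm ?invr_ge0 ?addr_ge0 //.
  by rewrite -[ltRHS]invrK ltf_pV2 ?posrE //; have := s0 n; lra.
have b_le j : b j <= 4.
  have h1 : (1 + s j)^-1 <= 1 by rewrite invf_le1 //; have := s0 j; lra.
  have h2 : j.+1%:R^-1 <= 1 :> R by rewrite invf_le1 // ler1n.
  have -> : 4 = 1 + 3 * 1 :> R by ring.
  by rewrite lerD // ler_wpM2l.
have w_lim k : ncvg \oo (fun j => u (s j) * sigma (x k) * star (u (s j))) (rho (x k)).
  have /cnorm_cvgP h := u_lim (x k); exact: (cvg_comp _ _ s_cvg h).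
have w_slow j : cnorm (u (s j.+1) - u (s j)) + 3 / j.+1%:R <= b j by rewrite lerD2r.
have [U [U_un U_c U_lim]] := unitary_path_construction v_un v_c v_m v_j v_a
  x_tr (fun j => u_un _ (s0 j)) w_lim w_slow b_lim b_le.
pose u' (t : R) : B := cp_emb B (U t).
have u'_un t : unitary (u' t).
  by have [h1 h2] := U_un t; split; rewrite -star_morph -rmorphM ?h1 ?h2 rmorph1.
have X_near := intertwined_closed (rho := rho) (sigma := sigma) u'_un.
have X_emb c : ncvg +oo (fun t => u' t * sigma (cp_emb D c) * star (u' t)) (rho (cp_emb D c)).
  apply: X_near => e e0; have [y Sy cy] := dense_approx c Sd e0.
  exists (cp_emb D y); last by rewrite -rmorphB; apply: le_lt_trans (starhom_le _ _) cy.
  (* Only [y] in the dense set [S] is enumerated; general elements of [C] follow by closedness of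
     the intertwined set. *)
  by have [k <-] /= := Zx (cp_emb D y) (or_introl (ex_intro2 _ _ y Sy erefl)); exact: U_lim.
have X_unit g : ncvg +oo (fun t => u' t * sigma (cp_unit D g) * star (u' t)) (rho (cp_unit D g)).
  by have [k <-] := Zx (cp_unit D g) (or_intror (ex_intro2 _ _ g I erefl)); exact: U_lim.
exists u'; last by move=> t _; exists (U t).
split.
  split=> [|t _]; last exact: u'_un.
  have u'_c t : ncvg (nbhs t) u' (u' t).
    apply: (ncvg_squeeze _ (U_c t)).
    by apply: nearW => q; rewrite -rmorphB; exact: starhom_le.
  apply/subspace_continuousP => t _; apply/cnorm_cvgP.
  exact: cvg_trans (cvg_app _ (@cvg_within _ _ _ _)) (u'_c t).
move=> d; apply/cnorm_cvgP; apply: X_near => e e0.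
have [_ [n [a [g ->]]] dy] := @dense_approx R D _ d e (cp_dense (c := D)) e0.
exists (\sum_i cp_emb D (a i) * cp_unit D (g i)) => //.
by apply: intertwined_sum => i; apply: (intertwinedM u'_un); [exact: X_emb | exact: X_unit].
Qed.

End Main.

Theorem theorem4p8 (R : realType) (G : groupType)
    (A C : cstarAlgType R) (alpha : action G A) (gamma : action G C)
    (B : crossed_product alpha) (D : crossed_product gamma)
    (CG : group_cstar R G)
    (BG : cstar_tensor B CG) (DG : cstar_tensor D CG)
    (alpha_hat : {starhom B -> BG}) (gamma_hat : {starhom D -> DG})
    (rho sigma : {starhom D -> B}) :
  countable [set: G]%classic -> amenable R G ->
  separable A -> nuclear A -> asymptotically_representable alpha ->
  separable C -> nuclear C ->
  dual_coaction alpha_hat -> dual_coaction gamma_hat ->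
  equivariant_hom gamma_hat alpha_hat rho ->
  equivariant_hom gamma_hat alpha_hat sigma ->
  (Ghat_asymp_unitarily_equiv rho sigma <-> asymp_unitarily_equiv rho sigma).
Proof.
move=> Gc _ _ _ rep Cs _ ha hg hr hs; split=> [[u hu _]|[u hu]]; first by exists u.
exact: (intertwiner_in_base Gc rep Cs ha hg hr hs hu).
Qed.
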